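(* In the setting described in the context, let $\mathcal{P}$ be a bounded polyhedral packing of type $\Pi$. The domain of absolute convergence $A\subseteq V^*$ of $Z(\mathbf{s})=\sum_{\mathbf{b}\in\mathcal{P}}e^{-\mathbf{b}\cdot\mathbf{s}}$, viewed in $\mathbb{RP}^3$, equals $$J\cup\bigcup_{\mathbf{s}\in\Omega}C(\mathbf{s}),$$ the union of the open timelike ball $J$ and the open solid cones $C(\mathbf{s})$ tangent to $N$, where $\Omega=\{w^T\boldsymbol{\omega}_i: w\in W,\ 1\le i\le m\}$; moreover the base circles $c(\mathbf{s})$, $\mathbf{s}\in\Omega$, of these cones form a packing of the same polyhedral type $\Pi$ as $\mathcal{P}$ on the sphere $N$.
   Context: Let $\Pi$ be a convex polyhedron with vertices $1,\ldots,m$ and faces $1,\ldots,n$. Augmented curvature-center coordinates: an oriented generalized circle is represented by $\mathbf{c}=(\tilde b,b,h_1,h_2)^T\in\mathbb{R}^4$ ($b$ signed curvature, $\tilde b$ curvature after inversion in the unit circle, $(h_1,h_2)$ equal to $b$ times the center; for a line $b=0$ and $(h_1,h_2)$ is the unit normal; orientation inward if $b>0$, outward if $b<0$). Let $P=\begin{pmatrix}0&-\tfrac12&0&0\\-\tfrac12&0&0&0\\0&0&1&0\\0&0&0&1\end{pmatrix}$. A polyhedral configuration for $\Pi$: oriented circles $c_1,\ldots,c_m$ with pairwise disjoint interiors, $c_i,c_k$ tangent iff vertices $i,k$ adjacent (else disjoint); oriented dual circles $d_1,\ldots,d_n$ with pairwise disjoint interiors, tangent iff the faces share an edge (else disjoint);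 $c_i\perp d_j$ if vertex $i$ is on face $j$, else disjoint. $W_{\mathrm{geom}}$ is generated by inversions in the $d_j$; $\mathcal{P}$ is the family of tuples $(gc_1,\ldots,gc_m)$, $g\in W_{\mathrm{geom}}$; bounded means all circles lie in a bounded region of $\mathbb{C}$. $Z$ sums over all Descartes tuples (curvature vectors of these tuples) with multiplicity, one term per $g$, for real $\mathbf{s}$. Let $C$ be the $4\times m$ matrix with columns $\mathbf{c}_i$; $V$ = column space of $C^T$; $V^*=\mathbb{R}^m/\ker C$ with pairing $\mathbf{b}\cdot\mathbf{s}$ ($Z$ is a function on $V^*$); $\boldsymbol{\omega}_i$ = image of the $i$-th standard basis vector in $V^*$; $\boldsymbol{\alpha}_j=-C^TP\mathbf{d}_j$; $\tilde C$ with $C\tilde C=I_4$; $\tilde G=\tilde CP^{-1}\tilde C^T$; $\sigma_j(\mathbf{b})=\mathbf{b}-2(\boldsymbol{\alpha}_j^T\tilde G\mathbf{b})\boldsymbol{\alpha}_j$ on $V$; $W=\langle\sigma_1,\ldots,\sigma_n\rangle$; $w^T$ the dual map on $V^*$, $(w\mathbf{b})\cdot\mathbf{s}=\mathbf{b}\cdot w^T\mathbf{s}$. $V^*$ carries $G=C^TPC$ of signature $(3,1)$. Since $A$ is a convex cone, it is viewed in $\mathbb{RP}^3$ via coordinates where $\mathbf{s}^TG\mathbf{s}=x^2+y^2+z^2-t^2$ and the affine chart $t=1$; $N=\{\mathbf{s}^TG\mathbf{s}=0\}$ is the lightlike sphere, $J=\{\mathbf{s}^TG\mathbf{s}<0\}$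 the timelike ball. For spacelike $\mathbf{s}$ ($\mathbf{s}^TG\mathbf{s}>0$), $c(\mathbf{s})$ is the circle on $N$ that is the base of the cone tangent to $N$ with apex $\mathbf{s}$, and $C(\mathbf{s})$ is the open solid cone with apex $\mathbf{s}$ and base circle $c(\mathbf{s})$ (interior of the convex hull of $\mathbf{s}$ and $c(\mathbf{s})$). *)

(* Defs.v *)
From HB Require Import structures.
From mathcomp Require Import all_boot all_order all_algebra.
From mathcomp Require Import all_classical all_reals all_analysis.
From mathcomp Require Import complex.

Set Implicit Arguments.
Unset Strict Implicit.
Unset Printing Implicit Defensive.

Import Order.TTheory GRing.Theory Num.Theory.
Import numFieldNormedType.Exports.

Local Open Scope classical_set_scope.
Local Open Scope complex_scope.
Local Open Scope ring_scope.

Definition dotv {R : realType} {k : nat} (u v : 'cV[R]_k) : R :=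
  (u^T *m v) 0 0.

(* When each [gens j] is an involution (inversions and reflections below), the
   words in the generators are the whole group that they generate. *)
Definition generated {T : Type} {n : nat} (op : T -> T -> T) (e : T)
    (gens : 'I_n -> T) : set T :=
  [set g | exists js : seq 'I_n, g = foldr (fun j => op (gens j)) e js].

(* The polyhedron is the convex hull of the points [v i]; each of its faces
   (of any dimension) is given by the set of vertices that lie on it. *)
Definition is_face {R : realType} {m : nat} (v : 'I_m -> 'cV[R]_3)
    (S : {set 'I_m}) : Prop :=
  exists (a : 'cV[R]_3) (k : R), [/\ a != 0, forall i, dotv a (v i) <= k &
    forall i, (i \in S) = (dotv a (v i) == k)].

Definition is_facet {R : realType} {m : nat} (v : 'I_m -> 'cV[R]_3)
    (S : {set 'I_m}) : Prop :=
  is_face v S /\ exists i j k, [/\ i \in S, j \in S, k \in S &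
    \rank (row_mx (v j - v i) (v k - v i)) = 2%N].

Definition is_edge {R : realType} {m : nat} (v : 'I_m -> 'cV[R]_3)
    (i k : 'I_m) : Prop :=
  i != k /\ is_face v [set i; k].

Definition convex_polyhedron {R : realType} {m n : nat} (v : 'I_m -> 'cV[R]_3)
    (F : 'I_n -> {set 'I_m}) : Prop :=
  [/\ (* not contained in a plane *)
      forall (a : 'cV[R]_3) (k : R), a != 0 -> exists i, dotv a (v i) != k,
      forall i, is_face v [set i],
      injective F &
      forall S, is_facet v S <-> exists j, S = F j].

Definition share_edge {R : realType} {m n : nat} (v : 'I_m -> 'cV[R]_3)
    (F : 'I_n -> {set 'I_m}) (j l : 'I_n) : Prop :=
  exists i k, is_edge v i k /\ [set i; k] \subset F j :&: F l.

(* The point at infinity is [None]. *)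
Notation riemann_sphere R := (option R[i]).

Definition qform (R : realType) : 'M[R]_4 :=
  \matrix_(i, j) nth 0 (nth [::]
    [:: [:: 0      ; - 2^-1 ; 0 ; 0];
        [:: - 2^-1 ; 0      ; 0 ; 0];
        [:: 0      ; 0      ; 1 ; 0];
        [:: 0      ; 0      ; 0 ; 1]] i) j.

(* Augmented curvature-center coordinates are ordered [(b~, b, h1, h2)]. *)
Definition cocurv {R : realType} (c : 'cV[R]_4) : R := c 0 0.
Definition curv {R : realType} (c : 'cV[R]_4) : R := c 1 0.
Definition hvec {R : realType} (c : 'cV[R]_4) : R[i] := c 2 0 +i* c 3 0.

Definition dotc {R : realType} (z w : R[i]) : R :=
  complex.Re z * complex.Re w + complex.Im z * complex.Im w.

Definition cnorm {R : realType} (z : R[i]) : R := ComplexField.Normc.normc z.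

Definition center {R : realType} (c : 'cV[R]_4) : R[i] :=
  hvec c * ((curv c)^-1)%:C.

(* The condition is [|h|^2 - b~ * b = 1]. If [b != 0], let [z = h / b] and
   [r = 1 / |b|]: it says [b~ = b * (|z|^2 - r^2)], the signed curvature of the
   image of the circle under inversion in the unit circle. If [b = 0], it says
   that [h] is a unit vector; the line is then [{z | <h, z> = b~ / 2}], whose
   image under that inversion has curvature [b~]. *)
Definition ocircle {R : realType} (c : 'cV[R]_4) : Prop :=
  c^T *m qform R *m c = 1%:M.

Definition curve {R : realType} (c : 'cV[R]_4) : set (riemann_sphere R) :=
  [set x | match x with
    | Some z => if curv c == 0 then dotc (hvec c) z = cocurv c / 2
                else cnorm (z - center c) = `|curv c|^-1
    | None => curv c = 0
    end].

(* The interior: the inside if [b > 0], the outside (with infinity) if [b < 0],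
   the half-plane into which the normal [h] points if [b = 0]. *)
Definition disc {R : realType} (c : 'cV[R]_4) : set (riemann_sphere R) :=
  [set x | match x with
    | Some z => if curv c == 0 then cocurv c / 2 < dotc (hvec c) z
                else if 0 < curv c then cnorm (z - center c) < (curv c)^-1
                else `|curv c|^-1 < cnorm (z - center c)
    | None => curv c < 0
    end].

Definition inversion {R : realType} (d : 'cV[R]_4) (x : riemann_sphere R) :
    riemann_sphere R :=
  if curv d == 0 then
    (if x is Some z then
       Some (z - (2 * (dotc (hvec d) z - cocurv d / 2))%:C * hvec d)
     else None)
  else
    (if x is Some z then
       if z == center d then None
       else Some (center d + ((curv d) ^- 2)%:C / conjc (z - center d))
     else Some (center d)).

Definition tangent {R : realType} (c d : 'cV[R]_4) : Prop :=
  exists x, curve c `&` curve d = [set x].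

Definition disjoint_circles {R : realType} (c d : 'cV[R]_4) : Prop :=
  curve c `&` curve d = set0.

Definition normal_at {R : realType} (c : 'cV[R]_4) (z : R[i]) : R[i] :=
  if curv c == 0 then hvec c else z - center c.

(* Orthogonal generalized circles always meet at a finite point, and the two
   angles at the two intersection points are equal. *)
Definition orthogonal {R : realType} (c d : 'cV[R]_4) : Prop :=
  exists z, [/\ curve c (Some z), curve d (Some z) &
                dotc (normal_at c z) (normal_at d z) = 0].

(* The oriented circle whose interior is the image of that of [c]. *)
Definition act {R : realType} (g : riemann_sphere R -> riemann_sphere R)
    (c : 'cV[R]_4) : 'cV[R]_4 :=
  xget 0 [set c' | ocircle c' /\ disc c' = g @` disc c].

Definition polyhedral_configuration {R : realType} {m n : nat}
    (v : 'I_m -> 'cV[R]_3) (F : 'I_n -> {set 'I_m})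
    (C : 'M[R]_(4, m)) (D : 'M[R]_(4, n)) : Prop :=
  [/\ (forall i, ocircle (col i C)) /\ (forall j, ocircle (col j D)),
      forall i k, i != k ->
        [/\ disc (col i C) `&` disc (col k C) = set0,
            is_edge v i k -> tangent (col i C) (col k C) &
            ~ is_edge v i k -> disjoint_circles (col i C) (col k C)],
      forall j l, j != l ->
        [/\ disc (col j D) `&` disc (col l D) = set0,
            share_edge v F j l -> tangent (col j D) (col l D) &
            ~ share_edge v F j l -> disjoint_circles (col j D) (col l D)] &
      forall i j,
        (i \in F j -> orthogonal (col i C) (col j D)) /\
        (i \notin F j -> disjoint_circles (col i C) (col j D))].

Definition Wgeom {R : realType} {n : nat} (D : 'M[R]_(4, n)) :
    set (riemann_sphere R -> riemann_sphere R) :=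
  generated (fun f g : riemann_sphere R -> riemann_sphere R => f \o g) id
    (fun j => inversion (col j D)).

(* The packing is the family of the tuples [i |-> act g (col i C)] for [g] in
   [Wgeom D]. *)
Definition bounded_packing {R : realType} {m n : nat}
    (C : 'M[R]_(4, m)) (D : 'M[R]_(4, n)) : Prop :=
  exists M : R, forall g i, Wgeom D g ->
    curve (act g (col i C)) `<=` Some @` [set z | cnorm z <= M].

Definition curvature_vector {R : realType} {m : nat} (C : 'M[R]_(4, m))
    (g : riemann_sphere R -> riemann_sphere R) : 'cV[R]_m :=
  \col_i curv (act g (col i C)).

(* The space V* = R^m / ker C is handled through representatives in 'cV[R]_m:
   everything below depends only on the class modulo ker C. *)
Definition abs_conv_domain {R : realType} {m n : nat}
    (C : 'M[R]_(4, m)) (D : 'M[R]_(4, n)) : set 'cV[R]_m :=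
  [set s | summable (Wgeom D)
             (fun g => (expR (- dotv (curvature_vector C g) s))%:E)].

Definition alpha {R : realType} {m n : nat} (C : 'M[R]_(4, m))
    (D : 'M[R]_(4, n)) (j : 'I_n) : 'cV[R]_m :=
  - (C^T *m qform R *m col j D).

Definition Gtilde {R : realType} {m : nat} (Ct : 'M[R]_(m, 4)) : 'M[R]_m :=
  Ct *m invmx (qform R) *m Ct^T.

(* The matrix of [b |-> b - 2 (alpha_j^T G~ b) alpha_j]. It maps the column
   space V of C^T to itself, so its transpose maps ker C to itself and is the
   dual map on V*. *)
Definition sigma {R : realType} {m n : nat} (C : 'M[R]_(4, m))
    (D : 'M[R]_(4, n)) (Ct : 'M[R]_(m, 4)) (j : 'I_n) : 'M[R]_m :=
  1%:M - 2 *: (alpha C D j *m ((alpha C D j)^T *m Gtilde Ct)).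

Definition Wrefl {R : realType} {m n : nat} (C : 'M[R]_(4, m))
    (D : 'M[R]_(4, n)) (Ct : 'M[R]_(m, 4)) : set 'M[R]_m :=
  generated mulmx 1%:M (sigma C D Ct).

Definition omega {R : realType} {m : nat} (i : 'I_m) : 'cV[R]_m :=
  delta_mx i 0.

Definition Omega {R : realType} {m n : nat} (C : 'M[R]_(4, m))
    (D : 'M[R]_(4, n)) (Ct : 'M[R]_(m, 4)) : set 'cV[R]_m :=
  [set s | exists w i, Wrefl C D Ct w /\ s = w^T *m omega i].

Definition lorentz_form (R : realType) : 'M[R]_4 :=
  diag_mx (\row_i (if i == 3 then -1 else 1)).

(* Linear coordinates with [s^T G s = x^2 + y^2 + z^2 - t^2], [G = C^T P C].
   This forces [ker L = ker C] when C has rank 4. *)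
Definition lorentz_coordinates {R : realType} {m : nat} (C : 'M[R]_(4, m))
    (L : 'M[R]_(4, m)) : Prop :=
  L^T *m lorentz_form R *m L = C^T *m qform R *m C.

Definition tcoord {R : realType} {m : nat} (L : 'M[R]_(4, m)) (s : 'cV[R]_m) :
    R := (L *m s) 3 0.

Definition chart {R : realType} {m : nat} (L : 'M[R]_(4, m)) (s : 'cV[R]_m) :
    'cV[R]_3 :=
  \col_i ((L *m s) (widen_ord (leqnSn 3) i) 0 / tcoord L s).

Definition lightlike_sphere {R : realType} : set 'cV[R]_3 :=
  [set q | dotv q q = 1].

Definition timelike_ball {R : realType} : set 'cV[R]_3 :=
  [set q | dotv q q < 1].

(* The points of tangency with N of the lines through the apex [p]. *)
Definition base_circle {R : realType} (p : 'cV[R]_3) : set 'cV[R]_3 :=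
  [set q | lightlike_sphere q /\ dotv (p - q) q = 0].

Definition convex_hull {R : realType} {k : nat} (S : set 'cV[R]_k) :
    set 'cV[R]_k :=
  [set p | exists (N : nat) (q : 'I_N -> 'cV[R]_k) (a : 'I_N -> R),
    [/\ forall i, S (q i), forall i, 0 <= a i, \sum_i a i = 1 &
        p = \sum_i a i *: q i]].

Definition solid_cone {R : realType} (p : 'cV[R]_3) : set 'cV[R]_3 :=
  (convex_hull ([set p] `|` base_circle p))°.

Definition vec3 {R : realType} (x y z : R) : 'cV[R]_3 :=
  \col_i nth 0 [:: x; y; z] i.

(* Inverse stereographic projection of the Riemann sphere onto N. *)
Definition stereo {R : realType} (x : riemann_sphere R) : 'cV[R]_3 :=
  if x is Some z then
    let r := complex.Re z ^+ 2 + complex.Im z ^+ 2 in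
    vec3 (2 * complex.Re z / (r + 1)) (2 * complex.Im z / (r + 1))
      ((r - 1) / (r + 1))
  else vec3 0 0 1.

(* A family of m-tuples of circles on N is a polyhedral packing of the type of
   the polyhedron [(v, F)] if it is one on the Riemann sphere, transported to N
   by stereographic projection. *)
Definition packing_on_N {R : realType} {m n : nat} (v : 'I_m -> 'cV[R]_3)
    (F : 'I_n -> {set 'I_m}) (T : set ('I_m -> set 'cV[R]_3)) : Prop :=
  exists (C : 'M[R]_(4, m)) (D : 'M[R]_(4, n)),
    polyhedral_configuration v F C D /\
    T = [set fun i => stereo @` curve (act g (col i C)) | g in Wgeom D].

(* Main.v *)
Require Import Defs.
From HB Require Import structures.
From mathcomp Require Import finmap.
From mathcomp Require Import all_boot all_order all_algebra.
From mathcomp Require Import all_classical all_reals all_analysis.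
From mathcomp Require Import complex ring lra.

(** Augmented curvature-center coordinates identify oriented circles with unit
    spacelike vectors of the Lorentz form [P], points with light rays, and
    inversions with reflections. Put [x = C s], so that the sum is
    [sum_g exp (- b (g x))], where [b] is the curvature functional.

    Distinct circles of the packing satisfy [<a, a'> <= -1] (ping-pong), so the
    integer parts of the entries of [g C] determine [g]. For timelike future [x]
    the boundedness of the packing bounds all these entries by a multiple of
    [b (g x)], and the sum is dominated by a product of geometric series. A point
    of an open cone is a multiple of a circle of the orbit plus such an [x], and
    the curvatures of the circles are bounded below.

    Conversely, if the sum converges at [x], then only finitely many [g] satisfy
    [b (g x) <= B]. Choosing [g] extremal brings [x] into the chamber
    [<x, d_j> <= 0], and there at most one of these products vanishes, because two
    reflections fixing [x] would generate an infinite stabilizer. A simplex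
    argument on the edges of the polyhedron, first at a vertex and then globally,
    shows that such an [x] is timelike or lies in the open cone of some [c_i]. *)

Set Implicit Arguments.
Unset Strict Implicit.
Unset Printing Implicit Defensive.

Import Order.TTheory GRing.Theory Num.Theory.
Import numFieldNormedType.Exports.

Local Open Scope classical_set_scope.
Local Open Scope ring_scope.

(** * The Lorentz form *)

Section LorentzForm.
Context {R : realType}.
Implicit Types (x y z : 'cV[R]_4) (a b : R).

(** Disjointness of two interiors is a statement about time orientation, [fut (c + d)], stronger
    than a bound on the product. Lorentz maps and addition of future vectors preserve it, so
    ping-pong becomes a sum of future vectors and discs disappear after the translation.

    Integer parts separate group elements for a metric reason: distinct images of one circle differ
    by a vector of norm at least 4, while a vector with entries of modulus at most 1 has norm at
    most 3. In the converse direction convergence enters only through the finiteness of the set of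
    terms above a given bound.

    The extremal choice of [g] needs two functionals. The curvature, composed with a suitable group
    element, is nonnegative on the dual circles; it provides a finite set that is stable under
    reflections towards the chamber. It may vanish on some of them, so the choice inside this set is
    made with the product with [csum], which is strictly negative on all dual circles.

    The simplex argument uses only products of circles with dual circles and the value -1 on edges;
    the polyhedron contributes the edges and facets around a vertex. *)

Definition lform x y : R := (x^T *m qform R *m y) 0 0.

Lemma lformE x y : lform x y =
  - (x 0 0 * y 1 0 + x 1 0 * y 0 0) / 2 + x 2 0 * y 2 0 + x 3 0 * y 3 0.
Proof.
rewrite /lform -mulmxA !mxE !big_ord_recl big_ord0 !mxE.
rewrite !big_ord_recl !big_ord0 !mxE /=.
have e1 : lift 0 (0 : 'I_3) = 1 :> 'I_4 by exact/val_inj.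
have e2 : lift 0 (lift 0 (0 : 'I_2)) = 2 :> 'I_4 by exact/val_inj.
have e3 : lift 0 (lift 0 (lift 0 (0 : 'I_1))) = 3 :> 'I_4 by exact/val_inj.
by rewrite ?e1 ?e2 ?e3; field.
Qed.

Lemma cV4P x y : x 0 0 = y 0 0 -> x 1 0 = y 1 0 -> x 2 0 = y 2 0 ->
  x 3 0 = y 3 0 -> x = y.
Proof.
move=> h0 h1 h2 h3; apply/matrixP => i j; rewrite (ord1 j).
case: i => [[|[|[|[|//]]]]] /= lti.
- by rewrite (_ : Ordinal lti = 0); first exact: h0; exact/val_inj.
- by rewrite (_ : Ordinal lti = 1); first exact: h1; exact/val_inj.
- by rewrite (_ : Ordinal lti = 2); first exact: h2; exact/val_inj.
- by rewrite (_ : Ordinal lti = 3); first exact: h3; exact/val_inj.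
Qed.

Lemma lformC x y : lform x y = lform y x.
Proof. by rewrite !lformE; ring. Qed.

Lemma lformDl x y z : lform (x + y) z = lform x z + lform y z.
Proof. by rewrite !lformE !mxE; field. Qed.
Lemma lformZl a x z : lform (a *: x) z = a * lform x z.
Proof. by rewrite !lformE !mxE; field. Qed.
Lemma lformNl x z : lform (- x) z = - lform x z.
Proof. by rewrite !lformE !mxE; field. Qed.
Lemma lformDr x y z : lform z (x + y) = lform z x + lform z y.
Proof. by rewrite lformC lformDl !(lformC z). Qed.
Lemma lformZr a x z : lform z (a *: x) = a * lform z x.
Proof. by rewrite lformC lformZl (lformC z). Qed.
Lemma lformNr x z : lform z (- x) = - lform z x.
Proof. by rewrite lformC lformNl (lformC z). Qed.
Lemma lform0l x : lform 0 x = 0.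
Proof. by rewrite -(scale0r x) lformZl mul0r. Qed.
Lemma lform0r x : lform x 0 = 0.
Proof. by rewrite lformC lform0l. Qed.

Lemma lform_suml (I : Type) (r : seq I) (P : pred I) (f : I -> 'cV[R]_4) z :
  lform (\sum_(i <- r | P i) f i) z = \sum_(i <- r | P i) lform (f i) z.
Proof.
by elim/big_rec2: _ => [|i y1 y2 _ <-]; rewrite ?lform0l // lformDl.
Qed.

Definition lformlin := (lformDl, lformDr, lformNl, lformNr, lformZl, lformZr).

(* [x 0 0] and [x 1 0] are null coordinates, so [fut] and [tfut] are the closed and
   the open future cone of the form. *)
Definition fut x := [/\ 0 <= x 0 0, 0 <= x 1 0 &
  x 2 0 ^+ 2 + x 3 0 ^+ 2 <= x 0 0 * x 1 0].
Definition tfut x := [/\ 0 < x 0 0, 0 < x 1 0 &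
  x 2 0 ^+ 2 + x 3 0 ^+ 2 < x 0 0 * x 1 0].

Lemma tfutW x : tfut x -> fut x.
Proof. by case=> h0 h1 h2; split; exact: ltW. Qed.

Lemma futZ a x : 0 <= a -> fut x -> fut (a *: x).
Proof.
move=> a0 [h0 h1 h2]; split; rewrite !mxE; try exact: mulr_ge0.
rewrite !exprMn -mulrDr (_ : a * _ * _ = a ^+ 2 * (x 0 0 * x 1 0)); last by ring.
by rewrite ler_wpM2l // sqr_ge0.
Qed.

Lemma tfutZ a x : 0 < a -> tfut x -> tfut (a *: x).
Proof.
move=> a0 [h0 h1 h2]; split; rewrite !mxE; try exact: mulr_gt0.
rewrite !exprMn -mulrDr (_ : a * _ * _ = a ^+ 2 * (x 0 0 * x 1 0)); last by ring.
by rewrite ltr_pM2l // exprn_gt0.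
Qed.

Lemma fut0 : fut 0.
Proof. by split; rewrite !mxE ?mulr0 ?expr0n /= ?addr0. Qed.

(** Reversed Cauchy-Schwarz inequality: the usual one for the last two coordinates, then the
    arithmetic-geometric mean inequality for [x0 * y1] and [x1 * y0]. *)
Lemma lform_fut_le0 x y : fut x -> fut y -> lform x y <= 0.
Proof.
rewrite /fut lformE => -[].
move: (x 0 0) (x 1 0) (x 2 0) (x 3 0) (y 0 0) (y 1 0) (y 2 0) (y 3 0).
move=> x0 x1 x2 x3 y0 y1 y2 y3 hx0 hx1 hx [hy0 hy1 hy].
suff : 2 * (x2 * y2 + x3 * y3) <= x0 * y1 + x1 * y0 by lra.
have s0 : 0 <= x0 * y1 + x1 * y0 by rewrite addr_ge0 // mulr_ge0.
case: (lerP (x2 * y2 + x3 * y3) 0) => ht; first lra.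
rewrite -(@ler_pXn2r _ 2) ?nnegrE //; last lra.
apply: (@le_trans _ _ (4 * ((x2 ^+ 2 + x3 ^+ 2) * (y2 ^+ 2 + y3 ^+ 2)))).
  have := sqr_ge0 (x2 * y3 - x3 * y2); nra.
apply: (@le_trans _ _ (4 * ((x0 * x1) * (y0 * y1)))).
  rewrite ler_pM2l //; apply: ler_pM => //; by rewrite addr_ge0 // sqr_ge0.
have := sqr_ge0 (x0 * y1 - x1 * y0); nra.
Qed.

Lemma futD x y : fut x -> fut y -> fut (x + y).
Proof.
move=> hx hy; have := lform_fut_le0 hx hy.
move: hx hy => [hx0 hx1 hx] [hy0 hy1 hy]; rewrite lformE => h.
split; rewrite !mxE ?addr_ge0 //; nra.
Qed.

Lemma tfutD x y : tfut x -> fut y -> tfut (x + y).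
Proof.
move=> hx hy; have := lform_fut_le0 (tfutW hx) hy.
move: hx hy => [hx0 hx1 hx] [hy0 hy1 hy]; rewrite lformE => h.
split; rewrite !mxE ?ltr_pwDl //; nra.
Qed.

Lemma fut_anti x : fut x -> fut (- x) -> x = 0.
Proof.
move=> [h0 h1 h2] []; rewrite !mxE => k0 k1 k2.
have e0 : x 0 0 = 0 by lra.
have e1 : x 1 0 = 0 by lra.
have h : x 2 0 ^+ 2 + x 3 0 ^+ 2 <= 0 by rewrite (le_trans h2)// e0 mul0r.
have s2 := sqr_ge0 (x 2 0); have s3 := sqr_ge0 (x 3 0).
apply: cV4P; rewrite mxE //; apply/eqP; rewrite -sqrf_eq0; apply/eqP; lra.
Qed.

Lemma fut_lform x : fut x -> lform x x <= 0.
Proof. by move=> h; exact: lform_fut_le0. Qed.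

Lemma causal_cases x : lform x x <= 0 -> fut x \/ fut (- x).
Proof.
rewrite lformE /fut !mxE => h.
have {h} : x 2 0 ^+ 2 + x 3 0 ^+ 2 <= x 0 0 * x 1 0 by nra.
have s2 := sqr_ge0 (x 2 0); have s3 := sqr_ge0 (x 3 0).
rewrite !sqrrN mulrNN => h.
move: s2 s3 h.
move: (x 2 0 ^+ 2) (x 3 0 ^+ 2) (x 0 0) (x 1 0) => p q x0 x1 p0 q0 h.
case: (lerP 0 x0) => h0; case: (lerP 0 x1) => h1.
- by left.
- right; split; [|lra|lra].
  rewrite oppr_ge0 leNgt; apply/negP => k; have : x0 * x1 < 0 by rewrite nmulr_llt0.
  lra.
- right; split; [lra| |lra].
  rewrite oppr_ge0 leNgt; apply/negP => k; have : x0 * x1 < 0 by rewrite nmulr_rlt0.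
  lra.
- by right; split => //; lra.
Qed.

Lemma tfutP x : tfut x <-> fut x /\ lform x x < 0.
Proof.
split=> [hx|[[h0 h1 h2]]].
  split; first exact: tfutW.
  move: hx => [h0 h1 h2]; rewrite lformE; nra.
rewrite lformE => h.
have s2 := sqr_ge0 (x 2 0); have s3 := sqr_ge0 (x 3 0).
have h' : x 2 0 ^+ 2 + x 3 0 ^+ 2 < x 0 0 * x 1 0 by nra.
split => //.
- by rewrite lt_neqAle h0 andbT; apply/eqP => e; move: h'; rewrite -e mul0r; lra.
- by rewrite lt_neqAle h1 andbT; apply/eqP => e; move: h'; rewrite -e mulr0; lra.
Qed.

Lemma timelike_cases x : lform x x < 0 -> tfut x \/ tfut (- x).
Proof.
move=> h; case: (causal_cases (ltW h)) => hx; [left|right]; apply/tfutP; split=> //.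
by rewrite !lformlin opprK.
Qed.

(** The open cone absorbs every direction. Expanding the quadratic condition at [x - e *: y] changes
    the gap [g] by nine products, counted with multiplicity, each at most [X * (e * K)]; hence the
    safe constant 16. *)
Lemma fut_subr x y : tfut x -> (exists2 e, 0 < e & fut (x - e *: y)).
Proof.
move=> [h0 h1 h2].
set x0 := x 0 0 in h0 h2 *; set x1 := x 1 0 in h1 h2 *.
set x2 := x 2 0 in h2 *; set x3 := x 3 0 in h2 *.
pose K := 1 + `|y 0 0| + `|y 1 0| + `|y 2 0| + `|y 3 0|.
have hK i : `|y i 0| <= K.
  have n0 j := normr_ge0 (y j 0).
  have := n0 0; have := n0 1; have := n0 2; have := n0 3.
  rewrite /K => k3 k2 k1 k0.
  case: i => [[|[|[|[|//]]]]] lti.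
  + by rewrite (_ : Ordinal lti = 0); [lra|exact/val_inj].
  + by rewrite (_ : Ordinal lti = 1); [lra|exact/val_inj].
  + by rewrite (_ : Ordinal lti = 2); [lra|exact/val_inj].
  + by rewrite (_ : Ordinal lti = 3); [lra|exact/val_inj].
have K1 : 1 <= K.
  have n0 j := normr_ge0 (y j 0).
  have := n0 0; have := n0 1; have := n0 2; have := n0 3.
  by rewrite /K; lra.
pose g := x0 * x1 - (x2 ^+ 2 + x3 ^+ 2).
have g0 : 0 < g by rewrite subr_gt0.
pose X := 1 + `|x0| + `|x1| + `|x2| + `|x3|.
have X1 : 1 <= X by rewrite /X -!addrA lerDl !addr_ge0.
pose e := Num.min (1 / K) (Num.min (Num.min (x0 / K) (x1 / K)) (g / (16 * X * K))).
have K0 : 0 < K by lra.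
have XK0 : 0 < 16 * X * K by rewrite !mulr_gt0 //; lra.
have e0 : 0 < e by rewrite !lt_min !divr_gt0.
have eK1 : e * K <= 1.
  by rewrite -ler_pdivlMr // ge_min lexx.
have eKx0 : e * K <= x0 by rewrite -ler_pdivlMr // !ge_min lexx !orbT.
have eKx1 : e * K <= x1 by rewrite -ler_pdivlMr // !ge_min lexx !orbT.
have eg : e * K * (16 * X) <= g.
  by rewrite (_ : _ * _ * _ = e * (16 * X * K)); [rewrite -ler_pdivlMr // !ge_min lexx !orbT|ring].
exists e => //.
have hy i : `|e * y i 0| <= e * K by rewrite normrM (gtr0_norm e0) ler_pM2l.
have := hy 0; have := hy 1; have := hy 2; have := hy 3.
rewrite /fut !mxE -/x0 -/x1 -/x2 -/x3.
have ek0 : 0 <= e * K by rewrite mulr_ge0 // ltW.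
move: (e * K) (e * y 0 0) (e * y 1 0) (e * y 2 0) (e * y 3 0) ek0 eK1 eKx0 eKx1 eg.
move=> k y0 y1 y2 y3 k0 k1 kx0 kx1 kg.
have n0 := normr_ge0 x0; have n1 := normr_ge0 x1; have n2 := normr_ge0 x2.
have n3 := normr_ge0 x3.
have bnd p q : `|p| <= X -> `|q| <= k -> - (X * k) <= p * q <= X * k.
  by move=> pX qk; rewrite -ler_norml normrM ler_pM.
move=> b3 b2 b1 b0.
have kX : k <= X by lra.
have /andP[_ t0] : - (X * k) <= x0 * y1 <= X * k by apply: bnd => //; rewrite /X; lra.
have /andP[_ t1] : - (X * k) <= x1 * y0 <= X * k by apply: bnd => //; rewrite /X; lra.
have /andP[t2 _] : - (X * k) <= x2 * y2 <= X * k by apply: bnd => //; rewrite /X; lra.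
have /andP[t3 _] : - (X * k) <= x3 * y3 <= X * k by apply: bnd => //; rewrite /X; lra.
have /andP[s0 _] : - (X * k) <= y0 * y1 <= X * k by apply: bnd => //; lra.
have /andP[_ s2] : - (X * k) <= y2 * y2 <= X * k by apply: bnd => //; lra.
have /andP[_ s3] : - (X * k) <= y3 * y3 <= X * k by apply: bnd => //; lra.
move: b0 b1; rewrite !ler_norml => /andP[_ b0] /andP[_ b1].
split; [lra|lra|].
by rewrite /g in kg; lra.
Qed.

Lemma lform_tfut_lt0 x y : tfut x -> fut y -> y != 0 -> lform x y < 0.
Proof.
move=> hx hy y0.
have [e e0 he] := fut_subr (delta_mx 0 0 + delta_mx 1 0) hx.
have := lform_fut_le0 he hy; rewrite !lformlin => h.
suff : 0 < - lform (delta_mx 0 0) y - lform (delta_mx 1 0) y by nra.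
rewrite !lformE !mxE /=.
move: hy => [h0 h1 h2].
have s2 := sqr_ge0 (y 2 0); have s3 := sqr_ge0 (y 3 0).
suff : y 0 0 + y 1 0 != 0 by move=> /eqP; lra.
apply: contra y0 => /eqP q.
have e1 : y 1 0 = 0 by lra.
have e0y : y 0 0 = 0 by lra.
rewrite e0y mul0r in h2.
by apply/eqP/cV4P; rewrite mxE //; apply/eqP; rewrite -sqrf_eq0; apply/eqP; lra.
Qed.

(** Equality case of the reversed inequality. It turns a point of tangency into the direction of a
    sum of two circles. *)
Lemma fut_orthogonal_colinear x y : fut x -> fut y -> lform x y = 0 -> x != 0 ->
  exists k, y = k *: x.
Proof.
move=> hx hy xy x0.
have [->|y0] := eqVneq y 0; first by exists 0; rewrite scale0r.
have xx : lform x x = 0.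
  apply/eqP; apply: contraT => ne.
  have tx : tfut x by apply/tfutP; split => //; rewrite lt_neqAle ne fut_lform.
  by have := lform_tfut_lt0 tx hy y0; rewrite xy ltxx.
have yy : lform y y = 0.
  apply/eqP; apply: contraT => ne.
  have ty : tfut y by apply/tfutP; split => //; rewrite lt_neqAle ne fut_lform.
  by have := lform_tfut_lt0 ty hx x0; rewrite lformC xy ltxx.
(* a null combination of x and y with vanishing time component is 0 *)
pose tx := x 0 0 + x 1 0; pose ty := y 0 0 + y 1 0.
pose z := tx *: y - ty *: x.
have zz : lform z z = 0 by rewrite /z !lformlin (lformC y x) xx yy xy; ring.
have zt : z 0 0 + z 1 0 = 0 by rewrite /z !mxE /tx /ty; ring.
have z0 : z = 0.
  move: zz zt; rewrite lformE => zz zt.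
  have s2 := sqr_ge0 (z 2 0); have s3 := sqr_ge0 (z 3 0); have s0 := sqr_ge0 (z 0 0).
  have e1 : z 1 0 = - z 0 0 by lra.
  rewrite e1 in zz.
  apply: cV4P; rewrite [RHS]mxE; apply/eqP; rewrite ?e1 ?oppr_eq0 -sqrf_eq0; apply/eqP; nra.
have tx0 : tx != 0.
  apply: contra x0 => /eqP t0; move: hx => [h0 h1 h2].
  have s2 := sqr_ge0 (x 2 0); have s3 := sqr_ge0 (x 3 0).
  have e1 : x 1 0 = 0 by rewrite /tx in t0; lra.
  have e0 : x 0 0 = 0 by rewrite /tx in t0; lra.
  rewrite e0 mul0r in h2.
  by apply/eqP/cV4P; rewrite mxE //; apply/eqP; rewrite -sqrf_eq0; apply/eqP; lra.
exists (ty / tx); move/eqP: z0; rewrite subr_eq0 => /eqP /(congr1 (fun v => tx^-1 *: v)).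
by rewrite !scalerA mulVf // scale1r mulrC.
Qed.

(** Self-duality of the light cone, tested on the lifts of infinity and of the points [(c, d)] of
    the plane. If [y 1 0] is positive, the test at the maximum of the quadratic in [(c, d)] is the
    cone inequality. *)
Lemma fut_dual y : (forall q, fut q -> lform y q <= 0) -> fut y.
Proof.
move=> h.
pose q (a b c : R) : 'cV[R]_4 := \col_i nth 0 [:: a; b; c; 0] i.
pose Q (c d : R) : 'cV[R]_4 := \col_i nth 0 [:: c ^+ 2 + d ^+ 2; 1; c; d] i.
have hQ c d : fut (Q c d).
  by split; rewrite !mxE /= ?mulr1 // ?addr_ge0 ?sqr_ge0.
have hq : fut (delta_mx 0 0).
  by split; rewrite !mxE //= ?mulr0 ?expr0n /= ?addr0.
have := h _ hq; rewrite lformE !mxE /= => hy1.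
have hQy c d : - (y 0 0 + y 1 0 * (c ^+ 2 + d ^+ 2)) / 2 + y 2 0 * c + y 3 0 * d <= 0.
  by have := h _ (hQ c d); rewrite lformE !mxE /= mulr1.
have y1 : 0 <= y 1 0 by lra.
have y0 : 0 <= y 0 0 by have := hQy 0 0; rewrite expr0n /=; lra.
split => //.
have [y10|y10] := eqVneq (y 1 0) 0; last first.
  have y1p : 0 < y 1 0 by rewrite lt_neqAle eq_sym y10.
  have := hQy (y 2 0 / y 1 0) (y 3 0 / y 1 0).
  rewrite (_ : _ + _ + _ = ((y 2 0 ^+ 2 + y 3 0 ^+ 2) - y 0 0 * y 1 0) / (2 * y 1 0)); last by field.
  rewrite pmulr_lle0 ?invr_gt0 ?mulr_gt0 //; lra.
rewrite y10 mulr0; set s := _ + _.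
(* The test function is now affine in [(c, d)]; the scaling makes its linear part equal to
   [y 0 0 + 1], which exceeds [y 0 0 / 2]. *)
rewrite leNgt; apply/negP => s0.
have := hQy ((y 0 0 + 1) / s * y 2 0) ((y 0 0 + 1) / s * y 3 0).
rewrite y10 (_ : _ + _ + _ = - y 0 0 / 2 + (y 0 0 + 1) / s * s); last by rewrite /s; ring.
by rewrite divfK ?gt_eqF //; lra.
Qed.

End LorentzForm.

(** * Reflections and orthogonality in Lorentz space *)

Section Reflections.
Context {R : realType}.
Implicit Types (x y z c d e p q f : 'cV[R]_4) (a b : R).

Definition refl d : 'M[R]_4 := 1%:M - 2 *: (d *m (d^T *m qform R)).

Lemma reflE d x : refl d *m x = x - (2 * lform x d) *: d.
Proof.
rewrite /refl mulmxBl mul1mx -scalemxAl -mulmxA; congr (_ - _).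
rewrite [d^T *m _ *m x]mx11_scalar -/(lform d x) mul_mx_scalar lformC.
by rewrite scalerA.
Qed.

Lemma lform_refl d x y : lform d d = 1 ->
  lform (refl d *m x) (refl d *m y) = lform x y.
Proof. by move=> dd; rewrite !reflE !lformlin dd (lformC d y); ring. Qed.

Lemma reflK d x : lform d d = 1 -> refl d *m (refl d *m x) = x.
Proof.
move=> dd; rewrite !reflE !lformlin dd.
by apply/matrixP => i j; rewrite !mxE; ring.
Qed.

Lemma mulmx_colP (m n : nat) (A B : 'M[R]_(m, n)) :
  (forall x : 'cV_n, A *m x = B *m x) -> A = B.
Proof.
move=> h; apply/matrixP => i j; have /matrixP /(_ i 0) := h (delta_mx j 0).
by rewrite -!colE !mxE.
Qed.

Lemma refl_refl d : lform d d = 1 -> refl d *m refl d = 1%:M.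
Proof.
by move=> dd; apply: mulmx_colP => x; rewrite -mulmxA reflK // mul1mx.
Qed.

(** If the image were past, its product with [x] would be nonnegative. But that product is
    [lform x x - 2 * lform x d ^+ 2], negative unless [x] is fixed. *)
Lemma fut_refl d x : lform d d = 1 -> fut x -> fut (refl d *m x).
Proof.
move=> dd fx.
have [xd|xd] := eqVneq (lform x d) 0.
  by rewrite reflE xd mulr0 scale0r subr0.
have : lform (refl d *m x) (refl d *m x) <= 0 by rewrite lform_refl // fut_lform.
case/causal_cases => // h.
have := lform_fut_le0 fx h; rewrite reflE !lformlin => k.
have := fut_lform fx.
have : 0 < lform x d * lform x d by rewrite -expr2 exprn_even_gt0.
by nra.
Qed.

Lemma lform_mulmx (T : 'M[R]_4) x y :
  T^T *m qform R *m T = qform R -> lform (T *m x) (T *m y) = lform x y.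
Proof. by move=> h; rewrite /lform trmx_mul -!mulmxA (mulmxA _ (qform R)) (mulmxA _ T) h. Qed.

Lemma spacelike_orthogonal p f : lform p p < 0 -> lform f p = 0 -> f != 0 ->
  0 < lform f f.
Proof.
move=> pp fp f0; rewrite ltNge; apply/negP => ff.
wlog tp : p pp fp / tfut p.
  move=> w; case: (timelike_cases pp) => tp; first exact: (w p).
  by apply: (w (- p)) => //; rewrite !lformlin ?opprK // fp oppr0.
case: (causal_cases ff) => h.
  by have := lform_tfut_lt0 tp h f0; rewrite lformC fp ltxx.
have := lform_tfut_lt0 tp h; rewrite oppr_eq0 => /(_ f0).
by rewrite lformlin lformC fp oppr0 ltxx.
Qed.

Lemma orthogonal3 c d e : exists f : 'cV[R]_4,
  [/\ f != 0, lform f c = 0, lform f d = 0 & lform f e = 0].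
Proof.
pose A := qform R *m row_mx c (row_mx d e) : 'M[R]_(4, 1 + (1 + 1)).
have : kermx A != 0.
  rewrite -mxrank_eq0 mxrank_ker subn_eq0 -ltnNge.
  by rewrite (leq_ltn_trans (rank_leq_col _)).
case/rowV0Pn => v /sub_kermxP vA v0.
have e' : row_mx (v *m qform R *m c) (row_mx (v *m qform R *m d) (v *m qform R *m e)) = 0.
  by rewrite -!mul_mx_row -mulmxA.
have [h1 h'] := eq_row_mx (etrans e' (esym (row_mx0 _ _ _ _))).
have [h2 h3] := eq_row_mx (etrans h' (esym (row_mx0 _ _ _ _))).
by exists v^T; split; rewrite ?trmx_eq0 // /lform trmxK ?h1 ?h2 ?h3 mxE.
Qed.

(** The time axis, a future vector of norm -1. *)
Definition u0 : 'cV[R]_4 := \col_i nth 0 [:: 1; 1; 0; 0] i.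

Lemma tfut_u0 : tfut u0.
Proof. by split; rewrite !mxE /= ?addr0 ?add0r ?expr0n /= ?addr0 ?mulr1 ?ltr01. Qed.

Lemma lform_u0 x : lform x u0 = - (x 0 0 + x 1 0) / 2.
Proof. by rewrite lformE !mxE /=; field. Qed.

Lemma fut_of_time x : lform x x <= 0 -> 0 <= x 0 0 + x 1 0 -> fut x.
Proof.
move=> /causal_cases[//|h] x0; suff -> : x = 0 by exact: fut0.
move: (h) => [h0 h1 h2]; rewrite -[x]opprK.
suff -> : - x = 0 by rewrite oppr0.
apply: fut_anti => //; rewrite opprK; split; move: h0 h1 h2; rewrite !mxE; [lra|lra|].
by rewrite !sqrrN mulrNN.
Qed.

Lemma tfut_of_lform x p : lform x x < 0 -> tfut p -> lform x p <= 0 -> tfut x.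
Proof.
move=> xx tp xp; case: (timelike_cases xx) => // h.
have x0 : x != 0 by apply: contraTneq xx => ->; rewrite lform0l ltxx.
have := lform_tfut_lt0 h (tfutW tp).
rewrite lformlin; have -> : p != 0.
  by case: tp => p0 _ _; apply: contraTneq p0 => ->; rewrite mxE ltxx.
by move=> /(_ isT); lra.
Qed.

(* Moving a timelike vector in a spacelike direction orthogonal to [c], [d] and
   to the time axis reaches the light cone. *)
Lemma null_shift p c d : tfut p -> exists q,
  [/\ fut q, lform q q = 0, 0 < q 1 0, lform q c = lform p c & lform q d = lform p d].
Proof.
move=> tp; have [f [f0 fc fd fu]] := orthogonal3 c d u0.
have ff : 0 < lform f f by apply: (spacelike_orthogonal _ fu f0); case/tfutP: tfut_u0.
have pp : lform p p < 0 by case/tfutP: tp.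
have key s : lform (p + s *: f) (p + s *: f) =
    lform f f * s ^+ 2 + 2 * lform f p * s + lform p p.
  by rewrite !lformlin (lformC p f); ring.
have shift s : lform p p + 2 * lform f p * s + lform f f * s ^+ 2 = 0 ->
    [/\ fut (p + s *: f), lform (p + s *: f) (p + s *: f) = 0,
      lform (p + s *: f) c = lform p c & lform (p + s *: f) d = lform p d].
  move=> e; rewrite key !lformlin fc fd !mulr0 !addr0; split=> //; last lra.
  apply: fut_of_time; first by rewrite key; lra.
  have := lform_u0 (p + s *: f); rewrite lformlin lformZl fu mulr0 addr0 lform_u0.
  by case: tp; lra.
pose D := lform f p ^+ 2 - lform f f * lform p p.
have D0 : 0 < D by rewrite /D; have := sqr_ge0 (lform f p); nra.
have sD : Num.sqrt D ^+ 2 = D by rewrite sqr_sqrtr // ltW.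
have root (e : R) : e ^+ 2 = 1 -> let s := (- lform f p + e * Num.sqrt D) / lform f f in
    lform p p + 2 * lform f p * s + lform f f * s ^+ 2 = 0.
  move=> e2 s; rewrite /s.
  rewrite (_ : _ + _ = (lform p p * lform f f - lform f p ^+ 2 + e ^+ 2 * Num.sqrt D ^+ 2) / lform f f).
    by rewrite e2 sD /D mul1r; field; rewrite gt_eqF.
  by field; rewrite gt_eqF.
have [] := shift _ (root 1 (expr1n _ _)).
set s1 := _ / _ => a1 a2 a3 a4.
have [] := shift _ (root (-1) (etrans (sqrrN 1) (expr1n _ 2))).
set s2 := _ / _ => b1 b2 b3 b4.
(* The roots have opposite signs, and [(p + s *: f) 1 0] is affine in [s] and positive at 0, so it
   is positive at one of them. Positivity makes the point finite. *)
case: (ltrP 0 ((p + s1 *: f) 1 0)) => q1; first by exists (p + s1 *: f).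
case: (ltrP 0 ((p + s2 *: f) 1 0)) => q2; first by exists (p + s2 *: f).
exfalso.
have : `|lform f p| < Num.sqrt D.
  rewrite -sqrtr_sqr ltr_sqrt // /D ltrBrDl gtrDr nmulr_llt0 //.
rewrite ltr_norml => /andP[l1 l2].
have s10 : 0 < s1 by rewrite divr_gt0 // mul1r; lra.
have s20 : s2 < 0 by rewrite /s2 pmulr_llt0 ?invr_gt0 // mulN1r; lra.
case: tp => _ p1 _; move: q1 q2; rewrite !mxE => q1 q2.
by case: (lerP 0 (f 1 0)) => hf; nra.
Qed.

End Reflections.

(** * Oriented circles as spacelike unit vectors *)

Section Points.
Context {R : realType}.
Implicit Types (x y : riemann_sphere R) (c d p q w : 'cV[R]_4).

(* The representative on the light cone of a point of the Riemann sphere. *)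
Definition ptv x : 'cV[R]_4 :=
  if x is Some z then
    \col_i nth 0 [:: complex.Re z ^+ 2 + complex.Im z ^+ 2; 1;
                     complex.Re z; complex.Im z] i
  else delta_mx 0 0.

Definition vpt q : riemann_sphere R :=
  if q 1 0 == 0 then None else Some ((q 2 0 / q 1 0) +i* (q 3 0 / q 1 0))%C.

Lemma fut_ptv x : fut (ptv x).
Proof.
case: x => [z|]; split; rewrite !mxE /= ?mulr0 ?mulr1 ?expr0n /= ?addr0 //.
by rewrite addr_ge0 ?sqr_ge0.
Qed.

Lemma ptv_null x : lform (ptv x) (ptv x) = 0.
Proof. by case: x => [z|]; rewrite lformE !mxE /=; field. Qed.

Lemma vpt_scale k x : 0 < k -> vpt (k *: ptv x) = x.
Proof.
move=> k0; case: x => [[a b]|]; rewrite /vpt !mxE /= ?mulr0 ?eqxx //.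
by rewrite mulr1 gt_eqF // !(mulrC k) !mulfK ?gt_eqF.
Qed.

Lemma ptv_vpt q : fut q -> lform q q = 0 -> q != 0 ->
  exists2 k, 0 < k & q = k *: ptv (vpt q).
Proof.
case=> q0 q1 _; rewrite lformE => qq qn0; rewrite /vpt.
have s2 := sqr_ge0 (q 2 0); have s3 := sqr_ge0 (q 3 0).
have [e1|ne1] := eqVneq (q 1 0) 0.
  rewrite e1 in qq.
  have e2 : q 2 0 = 0 by apply/eqP; rewrite -sqrf_eq0; apply/eqP; lra.
  have e3 : q 3 0 = 0 by apply/eqP; rewrite -sqrf_eq0; apply/eqP; lra.
  exists (q 0 0); last by apply: cV4P; rewrite !mxE /= ?mulr1 ?mulr0.
  rewrite lt_neqAle q0 eq_sym andbT; apply: contra qn0 => /eqP e0.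
  by apply/eqP/cV4P; rewrite mxE.
exists (q 1 0); first by rewrite lt_neqAle q1 eq_sym ne1.
apply: cV4P; rewrite !mxE /=; [|by rewrite mulr1|by field|by field].
apply: (mulfI ne1); rewrite (_ : q 1 0 * q 0 0 = q 2 0 ^+ 2 + q 3 0 ^+ 2); last by lra.
by field.
Qed.

Lemma centerE c : Defs.center c = ((c 2 0 / c 1 0) +i* (c 3 0 / c 1 0))%C.
Proof.
rewrite /Defs.center /hvec /curv; apply/eqP.
by rewrite eq_complex /= !mulr0 subr0 add0r !eqxx.
Qed.

Lemma cnormE (z : R[i]) :
  cnorm z = Num.sqrt (complex.Re z ^+ 2 + complex.Im z ^+ 2).
Proof. by case: z. Qed.

Lemma unit_norm c : lform c c = 1 -> c 2 0 ^+ 2 + c 3 0 ^+ 2 - c 0 0 * c 1 0 = 1.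
Proof. by rewrite lformE => h; lra. Qed.

(** Up to the factor [- c 1 0 / 2], this is the power of the point [z] with respect to the circle;
    the sign of the factor records the orientation. *)
Lemma lform_ptv_center (z : R[i]) c : lform c c = 1 -> c 1 0 != 0 ->
  lform (ptv (Some z)) c =
  c 1 0 / 2 * (`|c 1 0|^-1 ^+ 2 - cnorm (z - Defs.center c) ^+ 2).
Proof.
move=> /unit_norm cc c1; rewrite cnormE sqr_sqrtr ?addr_ge0 ?sqr_ge0 // exprVn.
rewrite (_ : `|c 1 0| ^+ 2 = c 1 0 ^+ 2); last by rewrite real_normK ?num_real.
case: z => a b; rewrite centerE lformE !mxE /=.
have -> : c 0 0 = (c 2 0 ^+ 2 + c 3 0 ^+ 2 - 1) / c 1 0.
  by apply: (mulIf c1); rewrite divfK //; lra.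
by field.
Qed.

Lemma cnorm_ge0 (z : R[i]) : 0 <= cnorm z.
Proof. by rewrite cnormE sqrtr_ge0. Qed.

Lemma lform_ptv_line (z : R[i]) c : c 1 0 = 0 ->
  lform (ptv (Some z)) c = dotc (hvec c) z - cocurv c / 2.
Proof. by move=> c1; rewrite lformE !mxE /= c1 /dotc /hvec /cocurv /=; field. Qed.

Lemma lform_ptv_infty c : lform (ptv None) c = - curv c / 2.
Proof. by rewrite lformE !mxE /= /curv; field. Qed.

Lemma discE c : lform c c = 1 -> disc c = [set x | 0 < lform (ptv x) c].
Proof.
move=> cc; apply/seteqP; split=> -[z|] /=; rewrite /disc /= ?lform_ptv_infty; try by lra.
all: rewrite /curv; case: eqVneq => c1.
1, 3: by rewrite (lform_ptv_line _ c1); lra.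
all: have n0 := cnorm_ge0 (z - Defs.center c); rewrite lform_ptv_center //.
all: have i0 : 0 <= `|c 1 0|^-1 by rewrite invr_ge0.
all: case: (ltrP 0 (c 1 0)) => c10.
- rewrite pmulr_rgt0 ?divr_gt0 // subr_gt0 gtr0_norm // => h.
  by rewrite ltr_pXn2r ?nnegrE // ?invr_ge0 ltW.
- have c1n : c 1 0 < 0 by rewrite lt_neqAle c1.
  rewrite nmulr_rgt0 ?pmulr_llt0 // subr_lt0 => h.
  by rewrite ltr_pXn2r ?nnegrE.
- rewrite pmulr_rgt0 ?divr_gt0 // subr_gt0.
  by rewrite ltr_pXn2r ?nnegrE // gtr0_norm.
- have c1n : c 1 0 < 0 by rewrite lt_neqAle c1.
  by rewrite nmulr_rgt0 ?pmulr_llt0 // subr_lt0 ltr_pXn2r ?nnegrE.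
Qed.

Lemma curveE c : lform c c = 1 -> curve c = [set x | lform (ptv x) c = 0].
Proof.
move=> cc; apply/seteqP; split=> -[z|] /=; rewrite /curve /= ?lform_ptv_infty; try by lra.
all: rewrite /curv; case: eqVneq => c1.
1, 3: by rewrite (lform_ptv_line _ c1); lra.
all: have n0 := cnorm_ge0 (z - Defs.center c); rewrite lform_ptv_center //.
- by move=> ->; rewrite subrr mulr0.
- have i0 : 0 <= `|c 1 0|^-1 by rewrite invr_ge0.
  move/eqP; rewrite mulf_eq0 mulf_eq0 invr_eq0 (negPf c1) pnatr_eq0 /= subr_eq0.
  by rewrite eqrXn2 // => /eqP.
Qed.

(** For a proper circle and a finite point, the second coordinate of the reflected lift is the
    squared curvature times the squared distance to the center, so [vpt] reads infinity exactly at
    the center. *)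
Lemma inversionE d x : lform d d = 1 -> inversion d x = vpt (refl d *m ptv x).
Proof.
move=> dd; have dn := unit_norm dd.
rewrite /inversion /vpt reflE /curv; have [d1|d1] := eqVneq (d 1 0) 0.
  case: x => [[a b]|]; last by rewrite !mxE /= d1 !mulr0 subr0 eqxx.
  rewrite (lform_ptv_line _ d1) !mxE /= d1 !mulr0 subr0 oner_eq0 !divr1.
  congr Some; apply/eqP; rewrite eq_complex /=.
  by rewrite !mul0r subr0 addr0 !eqxx.
case: x => [z|]; last first.
  rewrite lform_ptv_infty !mxE /= /curv.
  have -> : 0 - 2 * (- d 1 0 / 2) * d 1 0 = d 1 0 ^+ 2 by field.
  rewrite expf_eq0 /= (negPf d1) centerE; congr Some; apply/eqP.
  by rewrite eq_complex /=; apply/andP; split; apply/eqP; field.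
have hl := lform_ptv_center z dd d1.
rewrite cnormE sqr_sqrtr ?addr_ge0 ?sqr_ge0 // exprVn in hl.
rewrite (_ : `|d 1 0| ^+ 2 = d 1 0 ^+ 2) in hl; last by rewrite real_normK ?num_real.
have [zc|zc] := eqVneq z (Defs.center d).
  rewrite zc subrr /= expr0n /= addr0 subr0 in hl.
  rewrite !mxE /= zc hl (_ : 1 - _ = 0) ?eqxx //; by field.
have w0 : 0 < complex.Re (z - Defs.center d) ^+ 2 + complex.Im (z - Defs.center d) ^+ 2.
  rewrite lt_neqAle addr_ge0 ?sqr_ge0 // andbT eq_sym.
  apply: contra zc; rewrite paddr_eq0 ?sqr_ge0 // !sqrf_eq0.
  by rewrite -(subr_eq0 z) eq_complex.
rewrite !mxE /= hl.
set W := _ + _ in w0 *.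
have -> : 1 - 2 * (d 1 0 / 2 * ((d 1 0 ^+ 2)^-1 - W)) * d 1 0 = d 1 0 ^+ 2 * W by field.
rewrite mulf_eq0 expf_eq0 (gt_eqF w0) (negPf d1) /=; congr Some.
have Wn : W != 0 by rewrite gt_eqF.
have ez : z = Defs.center d + (z - Defs.center d) by rewrite addrC subrK.
move: (z - Defs.center d) ez @W w0 Wn => [a b] -> W w0 Wn.
rewrite /W centerE /= in w0 Wn *.
apply/eqP; rewrite eq_complex /=; apply/andP; split; apply/eqP.
all: by rewrite !sqrrN; field; rewrite d1 Wn.
Qed.

Lemma vpt_of_null q : fut q -> lform q q = 0 -> 0 < q 1 0 ->
  exists2 z, vpt q = Some z & exists2 k, 0 < k & q = k *: ptv (Some z).
Proof.
move=> fq qq q1; have qn0 : q != 0.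
  by apply: contraTneq q1 => ->; rewrite mxE ltxx.
have [k k0 e] := ptv_vpt fq qq qn0.
by case: (vpt q) e => [z|] e; [exists z => //; exists k|rewrite e !mxE /= mulr0 ltxx in q1].
Qed.

Lemma tfut_with_positive c : lform c c = 1 -> exists2 p, tfut p & 0 < lform p c.
Proof.
move=> cc; have [_ uu] := (iffLR (tfutP _)) (@tfut_u0 R).
have uu1 : lform u0 u0 = -1 :> R by rewrite lform_u0 !mxE /=; lra.
(* The projection of [u0] orthogonal to [c] has norm at most -1, which leaves room for half of the
   unit vector [c]. *)
exists (u0 - lform u0 c *: c + 2^-1 *: c); last by rewrite !lformlin cc; lra.
have := sqr_ge0 (lform u0 c); set x := lform u0 c => x2.
apply: (tfut_of_lform _ (tfut_u0)).
  by rewrite !lformlin cc uu1 (lformC c u0) -/x; nra.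
by rewrite !lformlin uu1 (lformC c u0) -/x; nra.
Qed.

(** The vectors [c] and [d] span a positive definite plane, and [p] is the projection of [u0] to its
    orthogonal complement; [a] and [b] solve the Gram system, of determinant [1 - g ^+ 2]. *)
Lemma tfut_orthogonal c d : lform c c = 1 -> lform d d = 1 ->
  `|lform c d| < 1 -> exists p, [/\ tfut p, lform p p <= -1, lform p c = 0 & lform p d = 0].
Proof.
move=> cc dd; rewrite ltr_norml => /andP[].
set g := lform c d => g1 g2.
have gg : 0 < 1 - g ^+ 2 by nra.
have uu1 : lform u0 u0 = -1 :> R by rewrite lform_u0 !mxE /=; lra.
set x := lform u0 c; set y := lform u0 d.
pose a := (x - g * y) / (1 - g ^+ 2); pose b := (y - g * x) / (1 - g ^+ 2).
pose p := u0 - a *: c - b *: d.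
have gn : 1 - g ^+ 2 != 0 by rewrite gt_eqF.
have pc : lform p c = 0.
  by rewrite /p !lformlin cc (lformC d c) -/x -/g /a /b; field.
have pd : lform p d = 0.
  by rewrite /p !lformlin dd -/y -/g /a /b; field.
have pu : lform p u0 = - 1 - ((x - g * y) ^+ 2 / (1 - g ^+ 2) + y ^+ 2).
  by rewrite /p !lformlin uu1 (lformC c u0) (lformC d u0) -/x -/y /a /b; field.
have pp : lform p p = lform p u0.
  by rewrite {2}/p lformDr lformDr !lformNr !lformZr pc pd; ring.
have h : lform p u0 <= -1.
  rewrite pu lerBlDr lerDl addr_ge0 ?sqr_ge0 //.
  by rewrite divr_ge0 ?sqr_ge0 // ltW.
exists p; split=> //; last by rewrite pp.
by apply: (tfut_of_lform _ tfut_u0); [rewrite pp|]; lra.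
Qed.

Lemma common_point c d : lform c c = 1 -> lform d d = 1 -> `|lform c d| < 1 ->
  exists z, lform (ptv (Some z)) c = 0 /\ lform (ptv (Some z)) d = 0.
Proof.
move=> cc dd /(tfut_orthogonal cc dd)[p [tp _ pc pd]].
have [q [fq qq q1 qc qd]] := null_shift c d tp.
have [z _ [k k0 e]] := vpt_of_null fq qq q1.
move: qc qd; rewrite pc pd e !lformZl => /eqP; rewrite mulf_eq0 gt_eqF //= => /eqP h1.
by move=> /eqP; rewrite mulf_eq0 gt_eqF //= => /eqP h2; exists z.
Qed.

(* Disjointness of the interiors gives the time orientation of [c + d], not only
   [lform c d <= -1], which would also allow interiors that cover the sphere. *)
Lemma disjoint_disc_fut c d : lform c c = 1 -> lform d d = 1 ->
  (forall x, 0 < lform (ptv x) c -> 0 < lform (ptv x) d -> False) -> fut (c + d).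
Proof.
move=> cc dd dis.
(* [null_shift] extends the hypothesis from points to timelike vectors, which are easier to
   construct. *)
have key p : tfut p -> 0 < lform p c -> 0 < lform p d -> False.
  move=> tp; have [q [fq qq q1 <- <-]] := null_shift c d tp.
  have [z _ [k k0 ->]] := vpt_of_null fq qq q1.
  by rewrite !lformZl !pmulr_rgt0 //; exact: dis.
have [g1|g1] := ltrP `|lform c d| 1.
  have [p [tp pp pc pd]] := tfut_orthogonal cc dd g1.
  move: g1; rewrite ltr_norml => /andP[g1 g2].
  (* Crossing circles: [p] is orthogonal to both and can be pushed into both interiors at once. *)
  exfalso; apply: (key (p + 2^-1 *: (c + d))).
  - apply: (tfut_of_lform _ tp).
      by rewrite !lformlin cc dd (lformC d c) !(lformC _ p) pc pd; lra.
    by rewrite !lformlin !(lformC _ p) pc pd; lra.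
  - by rewrite !lformlin pc cc (lformC d c); lra.
  - by rewrite !lformlin pd dd; lra.
have [g0|g0] := lerP 0 (lform c d).
  rewrite ger0_norm // in g1; exfalso.
  (* Nested interiors: a vector positive on the inner circle is positive on the outer one. *)
  have : lform (c - d) (c - d) <= 0.
    by rewrite !lformlin cc dd (lformC d c); lra.
  case/causal_cases => h.
    have [p tp pc] := tfut_with_positive cc.
    apply: (key p) => //; have := lform_fut_le0 (tfutW tp) h.
    by rewrite !lformlin; lra.
  have [p tp pd] := tfut_with_positive dd.
  apply: (key p) => //; have := lform_fut_le0 (tfutW tp) h.
  by rewrite !lformlin; lra.
rewrite ltr0_norm // in g1.
have : lform (c + d) (c + d) <= 0.
  by rewrite !lformlin cc dd (lformC d c); lra.
case/causal_cases => // h.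
have [e0|w0] := eqVneq (c + d) 0; first by rewrite e0; exact: fut0.
exfalso.
have uu1 : lform u0 u0 = -1 :> R by rewrite lform_u0 !mxE /=; lra.
(* Here the interiors would cover the sphere. A future timelike vector orthogonal to [c - d] has
   equal products with [c] and [d], and their sum is positive because [- (c + d)] is future and
   nonzero. *)
have [e ec] : exists e, e = c - d by exists (c - d).
have ee : lform e e = 2 - 2 * lform c d.
  by rewrite ec !lformlin cc dd (lformC d c); ring.
have een : lform e e != 0 by rewrite gt_eqF // ee; lra.
pose p := u0 - (lform u0 e / lform e e) *: e.
have pe : lform p e = 0 by rewrite /p !lformlin; field.
have pu : lform p u0 = -1 - lform u0 e ^+ 2 / lform e e.
  by rewrite /p !lformlin (lformC e u0) uu1; field.
have pp : lform p p = lform p u0.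
  by rewrite {2}/p lformDr lformNr lformZr pe; ring.
have pu1 : lform p u0 <= -1.
  by rewrite pu lerBlDr lerDl divr_ge0 ?sqr_ge0 // ee; lra.
have tp : tfut p by apply: (tfut_of_lform _ tfut_u0); [rewrite pp|]; lra.
have := lform_tfut_lt0 tp h; rewrite oppr_eq0 => /(_ w0).
move: pe; rewrite ec !lformlin => h1 h2.
by apply: (key p) => //; rewrite /p !lformlin; lra.
Qed.

(** At a common point the form equals the dot product of the gradients ([grad]), and [normal_at] is
    a nonzero multiple of the gradient ([nrm]). The converse takes its point from [common_point]. *)
Lemma orthogonalP c d : lform c c = 1 -> lform d d = 1 ->
  Defs.orthogonal c d <-> lform c d = 0.
Proof.
move=> cc dd.
have grad z : lform (ptv (Some z)) c = 0 -> lform (ptv (Some z)) d = 0 ->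
    lform c d = (c 1 0 * complex.Re z - c 2 0) * (d 1 0 * complex.Re z - d 2 0) +
                (c 1 0 * complex.Im z - c 3 0) * (d 1 0 * complex.Im z - d 3 0).
  by rewrite !lformE !mxE /=; nra.
have nrm c' z : exists2 k, k != 0 & normal_at c' z =
    (k * (c' 1 0 * complex.Re z - c' 2 0) +i* (k * (c' 1 0 * complex.Im z - c' 3 0)))%C.
  rewrite /normal_at /curv; case: eqVneq => e.
    exists (-1); first by rewrite oppr_eq0 oner_eq0.
    by rewrite e !mul0r !sub0r !mulN1r !opprK.
  exists (c' 1 0)^-1; rewrite ?invr_eq0 // centerE.
  by case: z => a b; apply/eqP; rewrite eq_complex /=; apply/andP; split; apply/eqP; field.
split=> [[z]|cd].
  rewrite (curveE cc) (curveE dd) => -[zc zd].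
  have [k k0 ->] := nrm c z; have [k' k0' ->] := nrm d z.
  rewrite /dotc /= => h; apply/eqP; move/eqP: h.
  rewrite (grad z zc zd).
  set A := c 1 0 * _ - _; set B := d 1 0 * _ - _.
  set A' := c 1 0 * _ - _; set B' := d 1 0 * _ - _.
  rewrite (_ : _ + _ = k * k' * (A * B + A' * B')); last by ring.
  by rewrite !mulf_eq0 (negPf k0) (negPf k0').
have [|z [zc zd]] := common_point cc dd; first by rewrite cd normr0 ltr01.
exists z; rewrite (curveE cc) (curveE dd); split=> //.
have [k k0 ->] := nrm c z; have [k' k0' ->] := nrm d z.
have := grad z zc zd; rewrite cd /dotc /= => h.
transitivity (k * k' * 0); last by rewrite mulr0.
by rewrite [in RHS]h; ring.
Qed.

End Points.

(** * Time-preserving Lorentz maps and their action on points and circles *)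

Section LorentzGroup.
Context {R : realType}.
Implicit Types (x y : riemann_sphere R) (c d p q : 'cV[R]_4) (T U : 'M[R]_4).

Definition lorentz T :=
  T^T *m qform R *m T = qform R /\ forall p, fut p -> fut (T *m p).

Lemma lorentz_lform T p q : lorentz T -> lform (T *m p) (T *m q) = lform p q.
Proof. by case=> h _; exact: lform_mulmx. Qed.

Lemma lform_preserving T :
  (forall p q, lform (T *m p) (T *m q) = lform p q) -> T^T *m qform R *m T = qform R.
Proof.
move=> h; apply/matrixP => i j; have := h (delta_mx i 0) (delta_mx j 0).
have e (A : 'M[R]_4) : (delta_mx 0 i *m A *m delta_mx j 0 : 'M[R]_1) 0 0 = A i j.
  by rewrite -rowE -colE !mxE.
rewrite /lform trmx_mul !trmx_delta !mulmxA e.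
by rewrite -(mulmxA _ T^T) -(mulmxA _ (T^T *m _)) e.
Qed.

Lemma lorentz1 : lorentz 1%:M.
Proof. by split=> [|p]; rewrite ?trmx1 ?mul1mx ?mulmx1. Qed.

Lemma lorentzM T U : lorentz T -> lorentz U -> lorentz (T *m U).
Proof.
move=> hT hU; split=> [|p fp]; last by rewrite -mulmxA; apply: hT.2; exact: hU.2.
by apply: lform_preserving => p q; rewrite -!mulmxA !lorentz_lform.
Qed.

Lemma lorentz_refl d : lform d d = 1 -> lorentz (refl d).
Proof.
move=> dd; split=> [|p]; last exact: fut_refl.
by apply: lform_preserving => p q; exact: lform_refl.
Qed.

Lemma unit_qform : qform R \in unitmx.
Proof.
have e : qform R *m (\matrix_(i, j) nth 0 (nth [::]
    [:: [:: 0; - 2; 0; 0]; [:: - 2; 0; 0; 0]; [:: 0; 0; 1; 0]; [:: 0; 0; 0; 1]] i) j) = 1%:M.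
  apply/matrixP => i j; rewrite !mxE !big_ord_recl big_ord0 !mxE /=.
  by case: i => [[|[|[|[|//]]]]] ?; case: j => [[|[|[|[|//]]]]] ?; rewrite /=; field.
by case: (mulmx1_unit e).
Qed.

Lemma lorentz_unit T : lorentz T -> T \in unitmx.
Proof.
case=> h _; have := unit_qform; rewrite -h unitmx_mul => /andP[_ //].
Qed.

Lemma lorentz_inv T : lorentz T -> lorentz (invmx T).
Proof.
move=> hT; have uT := lorentz_unit hT.
have TK p : T *m (invmx T *m p) = p by rewrite mulKVmx.
split=> [|p fp].
  by apply: lform_preserving => p q; rewrite -(lorentz_lform _ _ hT) !TK.
have : lform (invmx T *m p) (invmx T *m p) <= 0.
  by rewrite -(lorentz_lform _ _ hT) !TK fut_lform.
case/causal_cases => // h; suff -> : p = 0 by rewrite mulmx0; exact: fut0.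
by apply: fut_anti => //; rewrite -(TK p) -mulmxN; exact: hT.2.
Qed.

Lemma lorentz_tfut T p : lorentz T -> tfut p -> tfut (T *m p).
Proof.
move=> hT /tfutP[fp pp]; apply/tfutP; rewrite lorentz_lform //; split=> //.
exact: hT.2.
Qed.

Definition vact T x := vpt (T *m ptv x).

Lemma ptv_neq0 x : ptv x != 0.
Proof.
case: x => [z|]; apply/eqP => /matrixP h.
  by have := h 1 0; rewrite !mxE /= => /eqP; rewrite oner_eq0.
by have := h 0 0; rewrite !mxE /= => /eqP; rewrite oner_eq0.
Qed.

Lemma ptv_vact T x : lorentz T ->
  exists2 k, 0 < k & T *m ptv x = k *: ptv (vact T x).
Proof.
move=> hT; apply: ptv_vpt; first by apply: hT.2; exact: fut_ptv.
  by rewrite lorentz_lform // ptv_null.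
apply: contra (ptv_neq0 x) => /eqP h.
by rewrite -(mulKmx (lorentz_unit hT) (ptv x)) h mulmx0.
Qed.

Lemma vact1 x : vact 1%:M x = x.
Proof. by rewrite /vact mul1mx -[ptv x]scale1r vpt_scale. Qed.

Lemma vactM T U x : lorentz T -> lorentz U ->
  vact (T *m U) x = vact T (vact U x).
Proof.
move=> hT hU; rewrite {1}/vact -mulmxA.
have [k k0 ->] := ptv_vact x hU; rewrite -scalemxAr.
have [k' k0' ->] := ptv_vact (vact U x) hT.
by rewrite scalerA vpt_scale ?mulr_gt0.
Qed.

Lemma vactK T x : lorentz T -> vact T (vact (invmx T) x) = x.
Proof.
move=> hT; rewrite -vactM ?mulmxV ?vact1 //; [exact: lorentz_unit|exact: lorentz_inv].
Qed.

Lemma vactKV T x : lorentz T -> vact (invmx T) (vact T x) = x.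
Proof.
move=> hT; rewrite -vactM ?mulVmx ?vact1 //; [exact: lorentz_unit|exact: lorentz_inv].
Qed.

Lemma vact_inj T : lorentz T -> injective (vact T).
Proof. by move=> hT x y /(congr1 (vact (invmx T))); rewrite !vactKV. Qed.

Lemma lform_vact T x c : lorentz T -> exists2 k, 0 < k &
  lform (ptv x) c = k * lform (ptv (vact T x)) (T *m c).
Proof.
move=> hT; have [k k0 e] := ptv_vact x hT; exists k => //.
by rewrite -(lorentz_lform _ _ hT) e lformZl.
Qed.

Lemma disc_vact T c : lorentz T -> lform c c = 1 ->
  disc (T *m c) = vact T @` disc c.
Proof.
move=> hT cc; rewrite !discE ?lorentz_lform //; apply/seteqP; split=> x /=.
  move=> h; exists (vact (invmx T) x); last exact: vactK.
  have [k k0 ->] := lform_vact (vact (invmx T) x) c hT.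
  by rewrite vactK // pmulr_rgt0.
move=> [y h <-]; move: h; have [k k0 ->] := lform_vact y c hT.
by rewrite pmulr_rgt0.
Qed.

Lemma curve_vact T c : lorentz T -> lform c c = 1 ->
  curve (T *m c) = vact T @` curve c.
Proof.
move=> hT cc; rewrite !curveE ?lorentz_lform //; apply/seteqP; split=> x /=.
  move=> h; exists (vact (invmx T) x); last exact: vactK.
  by have [k k0 ->] := lform_vact (vact (invmx T) x) c hT; rewrite vactK // h mulr0.
move=> [y h <-]; move: h; have [k k0 ->] := lform_vact y c hT.
by move/eqP; rewrite mulf_eq0 gt_eqF //= => /eqP.
Qed.

Lemma ocircleE c : ocircle c <-> lform c c = 1.
Proof.
split; first by rewrite /ocircle /lform => ->; rewrite mxE.
by rewrite /ocircle /lform => h; rewrite [LHS]mx11_scalar h.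
Qed.

(** Negation exchanges the two sides of a circle. Equal interiors thus make [c], [- d] and [d],
    [- c] disjoint pairs, so [c - d] and its opposite are both future. *)
Lemma disc_inj c d : lform c c = 1 -> lform d d = 1 -> disc c = disc d -> c = d.
Proof.
move=> cc dd; rewrite !discE // => /seteqP[h1 h2].
apply/eqP; rewrite -subr_eq0; apply/eqP; apply: fut_anti.
  apply: disjoint_disc_fut; rewrite ?lformlin ?opprK // => x /h1 /=.
  by rewrite lformlin; lra.
rewrite opprB; apply: disjoint_disc_fut; rewrite ?lformlin ?opprK // => x /h2 /=.
by rewrite lformlin; lra.
Qed.

(** [act] selects a circle by choice; [disc_inj] makes the candidate unique. *)
Lemma act_vact T c : lorentz T -> lform c c = 1 -> act (vact T) c = T *m c.
Proof.
move=> hT cc; apply: xget_unique => [/=|y [/ocircleE yy]].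
  by split; [apply/ocircleE; rewrite lorentz_lform|exact: disc_vact].
by rewrite -disc_vact // => /disc_inj -> //; rewrite lorentz_lform.
Qed.

Lemma vact_refl d x : lform d d = 1 -> vact (refl d) x = inversion d x.
Proof. by move=> dd; rewrite inversionE. Qed.

End LorentzGroup.

(** * Words in the reflections of the dual circles *)

Section Words.
Context {R : realType} {n : nat} (D : 'M[R]_(4, n)).
Hypothesis dd : forall j, lform (col j D) (col j D) = 1.

Definition word_mx (js : seq 'I_n) : 'M[R]_4 :=
  foldr (fun j => mulmx (refl (col j D))) 1%:M js.

Definition word_fun (js : seq 'I_n) : riemann_sphere R -> riemann_sphere R :=
  foldr (fun j g => inversion (col j D) \o g) id js.

Lemma lorentz_word js : lorentz (word_mx js).
Proof.
elim: js => [|j js IH] /=; first exact: lorentz1.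
by apply: lorentzM => //; exact: lorentz_refl.
Qed.

Lemma word_mx_cat js ks : word_mx (js ++ ks) = word_mx js *m word_mx ks.
Proof. by elim: js => [|j js IH] /=; rewrite ?mul1mx // IH mulmxA. Qed.

Lemma word_mx_rev js : word_mx (rev js) *m word_mx js = 1%:M.
Proof.
elim: js => [|j js IH] /=; first by rewrite mul1mx.
rewrite rev_cons -cats1 word_mx_cat /= mulmx1 -!mulmxA (mulmxA (refl _) (refl _)).
by rewrite refl_refl // mul1mx.
Qed.

Lemma word_funE js : word_fun js = vact (word_mx js).
Proof.
apply/funext; elim: js => [|j js IH] x /=; first by rewrite vact1.
rewrite vactM ?vact_refl ?IH //; first exact: lorentz_refl.
exact: lorentz_word.
Qed.

Lemma act_word js c : lform c c = 1 -> act (word_fun js) c = word_mx js *m c.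
Proof. by move=> cc; rewrite word_funE act_vact //; exact: lorentz_word. Qed.

Definition word_group : set 'M[R]_4 := [set M | exists js, M = word_mx js].

Lemma word_group1 : word_group 1%:M.
Proof. by exists [::]. Qed.

Lemma word_group_refl j M : word_group M -> word_group (refl (col j D) *m M).
Proof. by case=> js ->; exists (j :: js). Qed.

Lemma word_groupM M N : word_group M -> word_group N -> word_group (M *m N).
Proof. by case=> js -> [ks ->]; exists (js ++ ks); rewrite word_mx_cat. Qed.

Lemma word_group_lorentz M : word_group M -> lorentz M.
Proof. by case=> js ->; exact: lorentz_word. Qed.

Lemma word_group_inv M : word_group M -> word_group (invmx M).
Proof.
case=> js ->; exists (rev js); apply/esym.
rewrite -[LHS]mulmx1 -(mulmxV (lorentz_unit (lorentz_word js))) mulmxA.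
by rewrite word_mx_rev mul1mx.
Qed.

End Words.

(** * Edges and facets of a polyhedron *)

Lemma fin_argmin (R : realType) (I : finType) (P : pred I) (f : I -> R) i0 :
  P i0 -> exists2 i, P i & forall j, P j -> f i <= f j.
Proof. by move=> Pi0; case: (@Order.TotalTheory.arg_minP _ R I i0 P f Pi0) => i; exists i. Qed.

Lemma fin_argmax (R : realType) (I : finType) (P : pred I) (f : I -> R) i0 :
  P i0 -> exists2 i, P i & forall j, P j -> f j <= f i.
Proof.
move=> /(fin_argmin (fun i => - f i))[i Pi h]; exists i => // j /h.
by rewrite lerN2.
Qed.

Section DotProduct.
Context {R : realType} {k : nat}.
Implicit Types (u v w : 'cV[R]_k) (a : R).

Lemma dotvE u v : dotv u v = \sum_i u i 0 * v i 0.
Proof. by rewrite /dotv mxE; apply: eq_bigr => i _; rewrite mxE. Qed.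

Lemma dotvC u v : dotv u v = dotv v u.
Proof. by rewrite !dotvE; apply: eq_bigr => i _; rewrite mulrC. Qed.
Lemma dotvDr u v w : dotv u (v + w) = dotv u v + dotv u w.
Proof. by rewrite /dotv mulmxDr mxE. Qed.
Lemma dotvNr u v : dotv u (- v) = - dotv u v.
Proof. by rewrite /dotv mulmxN mxE. Qed.
Lemma dotvZr a u v : dotv u (a *: v) = a * dotv u v.
Proof. by rewrite /dotv -scalemxAr mxE. Qed.
Lemma dotvDl u v w : dotv (u + v) w = dotv u w + dotv v w.
Proof. by rewrite dotvC dotvDr !(dotvC w). Qed.
Lemma dotvNl u v : dotv (- u) v = - dotv u v.
Proof. by rewrite dotvC dotvNr dotvC. Qed.
Lemma dotvZl a u v : dotv (a *: u) v = a * dotv u v.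
Proof. by rewrite dotvC dotvZr dotvC. Qed.
Lemma dotv0l u : dotv 0 u = 0.
Proof. by rewrite -(scale0r 0) dotvZl mul0r. Qed.

Definition dotvlin := (dotvDl, dotvDr, dotvNl, dotvNr, dotvZl, dotvZr).

Lemma dotvv_ge0 u : 0 <= dotv u u.
Proof. by rewrite dotvE sumr_ge0 // => i _; rewrite -expr2 sqr_ge0. Qed.

Lemma dotvv_eq0 u : (dotv u u == 0) = (u == 0).
Proof.
apply/eqP/eqP => [|->]; last exact: dotv0l.
rewrite dotvE => /eqP; rewrite psumr_eq0 => [/allP h|i _]; last by rewrite -expr2 sqr_ge0.
apply/matrixP => i j; rewrite (ord1 j) mxE; apply/eqP.
by have := h i (mem_index_enum _); rewrite mulf_eq0 orbb.
Qed.

Lemma dotvv_gt0 u : (0 < dotv u u) = (u != 0).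
Proof. by rewrite lt_neqAle dotvv_ge0 andbT eq_sym dotvv_eq0. Qed.

Lemma rank_independent u v :
  (forall a b, a *: u + b *: v = 0 -> a = 0 /\ b = 0) -> \rank (row_mx u v) = 2%N.
Proof.
move=> h; rewrite -mxrank_tr tr_row_mx; apply/eqP/inj_row_free => x.
rewrite -[x]hsubmxK mul_row_col [lsubmx x]mx11_scalar [rsubmx x]mx11_scalar.
rewrite !mul_scalar_mx => /(congr1 trmx); rewrite linearD /= !linearZ /= !trmxK trmx0.
by move=> /h[-> ->]; rewrite raddf0 row_mx0.
Qed.

End DotProduct.

Section Polyhedron.
Context {R : realType} {m n : nat} (v : 'I_m -> 'cV[R]_3) (F : 'I_n -> {set 'I_m}).
Hypothesis vF : convex_polyhedron v F.
Implicit Types (i k l : 'I_m) (j : 'I_n) (a b f : 'cV[R]_3) (S : {set 'I_m}).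

Let w i l := v l - v i.

Lemma spanning a i : a != 0 -> exists l, dotv a (w i l) != 0.
Proof.
move=> a0; case: vF => h _ _ _; have [l hl] := h a (dotv a (v i)) a0.
by exists l; rewrite /w !dotvlin subr_eq0.
Qed.

Lemma vertex_functional i : exists p, forall l, l != i -> dotv p (w i l) < 0.
Proof.
case: vF => _ /(_ i) [p [c [_ h1 h2]]] _ _; exists p => l li.
have /eqP ei : dotv p (v i) == c by rewrite -h2 inE.
rewrite /w !dotvlin ei subr_lt0 lt_neqAle h1 andbT -h2 inE //.
Qed.

(** Of two vertices on one ray from [i], the nearer would lie on the segment from [i] to the
    farther, which the functional exposing it forbids. *)
Lemma vertex_ray_inj i l l' (s : R) : l != i -> l' != i -> 0 < s ->
  w i l' = s *: w i l -> l = l'.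
Proof.
wlog s1 : l l' s / s <= 1 => [H li l'i s0 e|li l'i s0 e].
  case: (lerP s 1) => s1; first exact: (H _ _ s).
  apply/esym/(H l' l s^-1) => //; rewrite ?invr_gt0 //; last first.
    by rewrite e scalerA mulVf ?scale1r // gt_eqF.
  by rewrite invf_le1 // ltW.
apply/eqP; apply: contraT => ne.
have [p hp] := vertex_functional l'.
have h1 := hp l ne; have h2 : dotv p (w l' i) < 0 by apply: hp; rewrite eq_sym.
have : dotv p (w i l') = s * dotv p (w i l) by rewrite e dotvZr.
by move: h1 h2; rewrite /w !dotvlin; nra.
Qed.

Lemma is_faceP i a S : a != 0 -> (forall l, dotv a (w i l) <= 0) ->
  (forall l, (l \in S) = (dotv a (w i l) == 0)) -> is_face v S.
Proof.
move=> a0 h1 h2; exists a, (dotv a (v i)); split=> // l.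
  by have := h1 l; rewrite /w !dotvlin subr_le0.
by rewrite h2 /w !dotvlin subr_eq0.
Qed.

Lemma face_functional S i : is_face v S -> i \in S -> exists a,
  [/\ a != 0, forall l, dotv a (w i l) <= 0 &
      forall l, (l \in S) = (dotv a (w i l) == 0)].
Proof.
move=> [a [c [a0 h1 h2]]] iS; exists a.
have /eqP ei : dotv a (v i) == c by rewrite -h2.
split=> // l; first by rewrite /w !dotvlin ei subr_le0.
by rewrite h2 /w !dotvlin ei subr_eq0.
Qed.

(* In the vertex figure at [i], the point farthest from that of [k] is exposed. *)
Lemma edge_in_face i k l a S : (forall l, dotv a (w i l) <= 0) ->
  (forall l, (l \in S) = (dotv a (w i l) == 0)) ->
  k \in S -> l \in S -> k != i -> l != i -> l != k ->
  exists l', [/\ l' \in S, l' != k & is_edge v i l'].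
Proof.
move=> a1 a2 kS lS ki li lk.
have [p hp] := vertex_functional i.
pose t l := - dotv p (w i l).
have t0 l' : l' != i -> 0 < t l' by move=> /hp; rewrite oppr_gt0.
(* The vertex figure: the ray through [l] is cut with the plane where [p] takes the value -1. *)
pose y l := (t l)^-1 *: w i l.
have y_inj l1 l2 : l1 != i -> l2 != i -> y l1 = y l2 -> l1 = l2.
  move=> h1 h2 e; apply: (@vertex_ray_inj i l1 l2 (t l2 / t l1)) => //.
    by rewrite divr_gt0 ?t0.
  by rewrite -scalerA -/(y l1) e /y scalerA divff ?scale1r // gt_eqF // t0.
pose M l := dotv (y l - y k) (y l - y k).
have Pk : (k \in S) && (k != i) by rewrite kS.
have [s /andP[sS si] smax] := @fin_argmax _ _ [pred l | (l \in S) && (l != i)] M k Pk.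
rewrite /= in smax.
have Ml : 0 < M l.
  by rewrite dotvv_gt0 subr_eq0; apply: contra lk => /eqP /y_inj ->.
have sk : s != k.
  apply: contraTneq Ml => sk; rewrite -leNgt.
  apply: (le_trans (smax l _)); first by rewrite lS.
  by rewrite sk /M subrr dotv0l.
exists s; split=> //.
have [e ee] : exists e, e = y s - y k by exists (y s - y k).
(* Linear form that agrees with [dotv e (y - y s)] on that plane; the constant term is carried by
   [p]. *)
have [f fE] : exists f, f = e + dotv e (y s) *: p by exists (e + dotv e (y s) *: p).
have fw l' : l' != i -> dotv f (w i l') = t l' * dotv e (y l' - y s).
  move=> l'i; have h : dotv e (w i l') = t l' * dotv e (y l').
    by rewrite /y dotvZr mulrA mulfV ?mul1r // gt_eqF ?t0.
  by rewrite [in RHS]dotvDr dotvNr fE dotvDl dotvZl h /t; ring.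
(* As [y s] is farthest from [y k], the vertex figure lies in a ball around [y k] through [y s]; [e]
   is the outer normal of this ball at [y s]. *)
have fS l' : l' \in S -> l' != i -> dotv e (y l' - y s) <= - dotv (y l' - y s) (y l' - y s) / 2.
  move=> l'S l'i; have := smax l'; rewrite l'S l'i => /(_ isT).
  rewrite /M -ee => h.
  have -> : y l' - y s = (y l' - y k) - e by rewrite ee opprB addrA subrK.
  move: h; move: (y l' - y k) => z; rewrite !dotvlin (dotvC z e); lra.
have fS0 l' : l' \in S -> dotv f (w i l') <= 0.
  have [->|l'i] := eqVneq l' i; first by rewrite /w subrr -(scale0r 0) dotvZr mul0r.
  move=> l'S; rewrite fw // pmulr_rle0 ?t0 //; apply: (le_trans (fS _ l'S l'i)).
  by have := dotvv_ge0 (y l' - y s); lra.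
have fSeq l' : l' \in S -> (dotv f (w i l') == 0) = (l' \in [set i; s]%SET).
  rewrite !inE => l'S; have [->|l'i] := eqVneq l' i.
    by rewrite /w subrr -(scale0r 0) dotvZr mul0r eqxx.
  rewrite fw // mulf_eq0 gt_eqF ?t0 //=.
  have [->|ne] := eqVneq l' s; first by rewrite subrr -(scale0r 0) dotvZr mul0r eqxx.
  apply: lt_eqF; apply: (le_lt_trans (fS _ l'S l'i)).
  suff : 0 < dotv (y l' - y s) (y l' - y s) by lra.
  by rewrite dotvv_gt0 subr_eq0; apply: contra ne => /eqP /y_inj ->.
have iS : i \in S by rewrite a2 /w subrr -(scale0r 0) dotvZr mul0r.
(* So large that [N *: a] outweighs [f] off [S]; on [S] the denominator vanishes and the quotient is
   0 by default. *)
pose N := 1 + \sum_l `|dotv f (w i l) / dotv a (w i l)|.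
have N0 : 0 < N by rewrite ltr_pwDl // sumr_ge0.
have hN l' : l' \notin S -> dotv (N *: a + f) (w i l') < 0.
  rewrite a2 => al; have al0 : dotv a (w i l') < 0 by rewrite lt_neqAle al a1.
  have : `|dotv f (w i l') / dotv a (w i l')| < N.
    rewrite /N (bigD1 l') //=; set X := `|_|; set Y := \sum_(_ | _) _.
    have : 0 <= Y by rewrite sumr_ge0.
    by lra.
  rewrite ltr_norml => /andP[hq _].
  have -> : dotv (N *: a + f) (w i l') =
      (N + dotv f (w i l') / dotv a (w i l')) * dotv a (w i l').
    by rewrite dotvDl dotvZl; field; rewrite lt_eqF.
  by rewrite pmulr_rlt0 //; lra.
split; first by rewrite eq_sym.
apply: (@is_faceP i (N *: a + f)).
- have fk : dotv f (w i k) != 0 by rewrite fSeq // !inE negb_or ki eq_sym.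
  apply: contra fk => /eqP h; have := dotv0l (w i k); rewrite -h dotvDl dotvZl.
  by have := kS; rewrite a2 => /eqP ->; rewrite mulr0 add0r => ->.
- move=> l'; case: (boolP (l' \in S)) => l'S; last exact/ltW/hN.
  rewrite dotvDl dotvZl; have := l'S; rewrite a2 => /eqP ->.
  by rewrite mulr0 add0r fS0.
- move=> l'; case: (boolP (l' \in S)) => l'S.
    rewrite -fSeq // dotvDl dotvZl; have := l'S; rewrite a2 => /eqP ->.
    by rewrite mulr0 add0r.
  rewrite (lt_eqF (hN _ l'S)); apply/negbTE; apply: contra l'S.
  by rewrite !inE => /orP[] /eqP ->.
Qed.

Lemma orthogonal2 e e' : exists f : 'cV[R]_3, [/\ f != 0, dotv f e = 0 & dotv f e' = 0].
Proof.
pose A := row_mx e e' : 'M[R]_(3, 1 + 1).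
have : kermx A != 0.
  rewrite -mxrank_eq0 mxrank_ker subn_eq0 -ltnNge.
  by rewrite (leq_ltn_trans (rank_leq_col _)).
case/rowV0Pn => x /sub_kermxP xA x0.
have e0 : row_mx (x *m e) (x *m e') = 0 by rewrite -mul_mx_row.
have [h1 h2] := eq_row_mx (etrans e0 (esym (row_mx0 _ _ _ _))).
by exists x^T; split; rewrite ?trmx_eq0 // /dotv trmxK ?h1 ?h2 mxE.
Qed.

Lemma third_vertex i k : exists l, (l != i) && (l != k).
Proof.
have [a [a0 ak _]] := orthogonal2 (w i k) 0.
have [l al] := spanning i a0; exists l; apply/andP; split.
  by apply: contra al => /eqP ->; rewrite /w subrr -(scale0r 0) dotvZr mul0r.
by apply: contra al => /eqP ->; rewrite ak.
Qed.

Lemma polyhedron_vertex_has_edge i : exists k, is_edge v i k.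
Proof.
have [k /andP[ki _]] := third_vertex i i.
have [l /andP[li lk]] := third_vertex i k.
(* The zero functional cuts out the whole vertex set as the face to search in. *)
have h0 l' : dotv 0 (w i l') <= 0 by rewrite dotv0l.
have hS l' : (l' \in finset.setT) = (dotv 0 (w i l') == 0) by rewrite dotv0l eqxx inE.
have [l' [_ _ e]] := edge_in_face h0 hS (finset.in_setT k) (finset.in_setT l) ki li lk.
by exists l'.
Qed.

Lemma facet_of_functional i k l f : f != 0 -> (forall l, dotv f (w i l) <= 0) ->
  dotv f (w i k) = 0 -> dotv f (w i l) = 0 ->
  (forall x y : R, x *: w i k + y *: w i l = 0 -> x = 0 /\ y = 0) ->
  exists2 j, i \in F j & forall l', (l' \in F j) = (dotv f (w i l') == 0).
Proof.
move=> f0 f1 fk fl ind; case: vF => _ _ _ hF.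
pose S := [set l' | dotv f (w i l') == 0]%SET.
have [j e] : exists j, S = F j.
  apply/hF; split; first by apply: (is_faceP f0 f1) => l'; rewrite inE.
  exists i, k, l; split; rewrite ?inE ?fk ?fl //.
    by rewrite /w subrr -(scale0r 0) dotvZr mul0r.
  exact: rank_independent.
by exists j => [|l']; rewrite -e inE // /w subrr -(scale0r 0) dotvZr mul0r.
Qed.

(** Rotate a plane about the edge: the functionals [b + c *: a] vanish on it, and the rotation first
    meets other vertices at the largest and the smallest value of [beta]. If these agreed, one
    functional would vanish on all vertices. *)
Lemma polyhedron_edge_in_two_facets i k : is_edge v i k -> exists j j',
  [/\ j != j', i \in F j, k \in F j, i \in F j' & k \in F j'].
Proof.
case=> ik /face_functional /(_ (set21 _ _)) [a [a0 a1 a2]].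
have ki : k != i by rewrite eq_sym.
have ak : dotv a (w i k) = 0 by apply/eqP; rewrite -a2 set22.
have aneg l : l \notin [set i; k]%SET -> dotv a (w i l) < 0.
  by rewrite a2 lt_neqAle a1 andbT.
have [b [b0 bk ba]] := orthogonal2 (w i k) a.
have wii : w i i = 0 by rewrite /w subrr.
have wk0 : w i k != 0.
  have [p hp] := vertex_functional i; apply: contraTneq (hp _ ki) => ->.
  by rewrite dotvC dotv0l ltxx.
pose beta l := - (dotv b (w i l) / dotv a (w i l)).
have betaE l c : l \notin [set i; k]%SET ->
    dotv (b + c *: a) (w i l) = (c - beta l) * dotv a (w i l).
  by move=> /aneg al; rewrite dotvDl dotvZl /beta; field; rewrite lt_eqF.
have zero c l : l \in [set i; k]%SET -> dotv (b + c *: a) (w i l) = 0.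
  rewrite !inE dotvDl dotvZl => /orP[] /eqP ->.
    by rewrite wii ![dotv _ 0]dotvC !dotv0l mulr0 addr0.
  by rewrite bk ak mulr0 addr0.
have [l0 Pl0] : exists l0, l0 \notin [set i; k]%SET.
  by have [l /andP[h1 h2]] := third_vertex i k; exists l; rewrite !inE negb_or h1.
have [l1 P1 max1] := @fin_argmax _ _ [pred l | l \notin [set i; k]%SET] beta l0 Pl0.
have [l2 P2 min2] := @fin_argmin _ _ [pred l | l \notin [set i; k]%SET] beta l0 Pl0.
have f0 c : b + c *: a != 0.
  apply/eqP => h; have := dotv0l b; rewrite -h dotvDl dotvZl (dotvC a) ba mulr0 addr0.
  by apply/eqP; rewrite dotvv_eq0.
have lt21 : beta l2 < beta l1.
  rewrite ltNge; apply/negP => le12; have [l] := spanning i (f0 (beta l1)).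
  case: (boolP (l \in [set i; k]%SET)) => hl; first by rewrite zero ?eqxx.
  rewrite betaE // (_ : beta l = beta l1) ?subrr ?mul0r ?eqxx //.
  by apply/eqP; rewrite eq_le max1 //= (le_trans le12) // min2.
have ind l (x y : R) : l \notin [set i; k]%SET -> x *: w i k + y *: w i l = 0 -> x = 0 /\ y = 0.
  move=> /aneg al e; have := congr1 (dotv a) e.
  rewrite dotvDr !dotvZr ak mulr0 add0r [dotv a 0]dotvC dotv0l => /eqP.
  rewrite mulf_eq0 (lt_eqF al) orbF => /eqP y0; split=> //.
  by move/eqP: e; rewrite y0 scale0r addr0 scaler_eq0 (negPf wk0) orbF => /eqP.
have F1 l : dotv (b + beta l1 *: a) (w i l) <= 0.
  case: (boolP (l \in [set i; k]%SET)) => hl; first by rewrite zero.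
  by rewrite betaE // mulr_ge0_le0 ?subr_ge0 ?max1 // ltW // aneg.
have F2 l : dotv (- (b + beta l2 *: a)) (w i l) <= 0.
  rewrite dotvNl oppr_le0.
  case: (boolP (l \in [set i; k]%SET)) => hl; first by rewrite zero.
  by rewrite betaE // mulr_le0 ?subr_le0 ?min2 // ltW // aneg.
have [j ij hj] := @facet_of_functional i k l1 _ (f0 _) F1 (zero _ k (set22 _ _))
  (etrans (betaE _ _ P1) (etrans (congr1 ( *%R^~ _) (subrr _)) (mul0r _)))
  (fun x y => @ind l1 x y P1).
have f0' : - (b + beta l2 *: a) != 0 by rewrite oppr_eq0.
have z2 l : dotv (b + beta l2 *: a) (w i l) = 0 -> dotv (- (b + beta l2 *: a)) (w i l) = 0.
  by rewrite dotvNl => ->; rewrite oppr0.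
have [j' ij' hj'] := @facet_of_functional i k l2 _ f0' F2 (z2 _ (zero _ k (set22 _ _)))
  (z2 _ (etrans (betaE _ _ P2) (etrans (congr1 ( *%R^~ _) (subrr _)) (mul0r _))))
  (fun x y => @ind l2 x y P2).
exists j, j'; split=> //.
- apply/eqP => jj; have := hj' l1; rewrite -jj hj betaE // subrr mul0r eqxx.
  rewrite dotvNl betaE // oppr_eq0 mulf_eq0 subr_eq0 (lt_eqF lt21) /=.
  by rewrite (lt_eqF (aneg _ P1)).
- by rewrite hj zero ?set22.
- by rewrite hj' z2 ?zero ?set22.
Qed.

Lemma polyhedron_facetP j : [/\ is_face v (F j) &
  exists i k l, [/\ i \in F j, k \in F j, l \in F j & [/\ i != k, i != l & k != l]]].
Proof.
case: vF => _ _ _ /(_ (F j)) [_ /(_ (ex_intro _ j erefl))] [fj [i [k [l [hi hk hl hr]]]]].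
split=> //; exists i, k, l; split=> //.
have rk1 (x : 'cV[R]_3) (A : 'M[R]_(3, 1 + 1)) : (A^T <= x^T)%MS -> \rank A != 2%N.
  move=> h; rewrite -mxrank_tr neq_ltn; apply/orP; left.
  exact: leq_ltn_trans (mxrankS h) (leq_ltn_trans (rank_leq_row _) _).
have tr1 (x y : 'cV[R]_3) : ((row_mx x y)^T <= y^T)%MS = (x^T <= y^T)%MS.
  by rewrite tr_row_mx col_mx_sub submx_refl andbT.
have tr2 (x y : 'cV[R]_3) : ((row_mx x y)^T <= x^T)%MS = (y^T <= x^T)%MS.
  by rewrite tr_row_mx col_mx_sub submx_refl.
split; apply/eqP => e; move/eqP: hr; apply/negP.
- by apply: (rk1 (v l - v i)); rewrite tr1 e subrr trmx0 sub0mx.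
- by apply: (rk1 (v k - v i)); rewrite tr2 e subrr trmx0 sub0mx.
- by apply: (rk1 (v k - v i)); rewrite tr2 e submx_refl.
Qed.

(** Applied to an edge from [i] to [k], it gives the second edge of the facet at [i]. *)
Lemma polyhedron_edge_in_facet j i k : i \in F j -> k \in F j -> k != i ->
  exists l, [/\ l \in F j, l != k & is_edge v i l].
Proof.
move=> iF kF ki; have [fj [x [y [z [xF yF zF [xy xz yz]]]]]] := polyhedron_facetP j.
have [a [_ a1 a2]] := face_functional fj iF.
have [l [lF li lk]] : exists l, [/\ l \in F j, l != i & l != k].
  have [/andP[h1 h2]|] := boolP ((x != i) && (x != k)); first by exists x.
  rewrite negb_and !negbK => hx.
  have [/andP[h1 h2]|] := boolP ((y != i) && (y != k)); first by exists y.
  rewrite negb_and !negbK => hy; exists z; split=> //.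
    apply/eqP => e; move: xz yz hx hy xy; rewrite e => /negPf -> /negPf -> /=.
    by move=> /eqP -> /eqP ->; rewrite eqxx.
  apply/eqP => e; move: xz yz hx hy xy; rewrite e => /negPf -> /negPf ->.
  by rewrite !orbF => /eqP -> /eqP ->; rewrite eqxx.
exact: (edge_in_face a1 a2 kF lF).
Qed.

Lemma polyhedron_facet_misses j : exists i, i \notin F j.
Proof.
have [[a [c [a0 _ h]]] _] := polyhedron_facetP j.
by case: vF => /(_ a c a0)[i hi] _ _ _; exists i; rewrite h.
Qed.

End Polyhedron.

(** * Polyhedral configurations *)

Section Configuration.
Context {R : realType} {m n : nat} (v : 'I_m -> 'cV[R]_3) (F : 'I_n -> {set 'I_m}).
Context (C : 'M[R]_(4, m)) (D : 'M[R]_(4, n)).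
Hypothesis vF : convex_polyhedron v F.
Hypothesis conf : polyhedral_configuration v F C D.
Implicit Types (i k l : 'I_m) (j : 'I_n).

Lemma conf_circle i : lform (col i C) (col i C) = 1.
Proof. by case: conf => -[h _] _ _ _; apply/ocircleE. Qed.

Lemma conf_dual j : lform (col j D) (col j D) = 1.
Proof. by case: conf => -[_ h] _ _ _; apply/ocircleE. Qed.

Lemma disc_disjoint_fut (c d : 'cV[R]_4) : lform c c = 1 -> lform d d = 1 ->
  disc c `&` disc d = set0 -> fut (c + d).
Proof.
move=> cc dd /seteqP[h _]; apply: disjoint_disc_fut => // x xc xd.
by apply: (h x); rewrite !discE.
Qed.

Lemma conf_circle_fut i k : i != k -> fut (col i C + col k C).
Proof.
move=> ik; apply: disc_disjoint_fut; try exact: conf_circle.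
by case: conf => _ /(_ i k ik) [].
Qed.

Lemma conf_dual_fut (j l : 'I_n) : j != l -> fut (col j D + col l D).
Proof.
move=> jl; apply: disc_disjoint_fut; try exact: conf_dual.
by case: conf => _ _ /(_ j l jl) [].
Qed.

Lemma unit_fut_le (c d : 'cV[R]_4) : lform c c = 1 -> lform d d = 1 ->
  fut (c + d) -> lform c d <= -1.
Proof.
by move=> cc dd /fut_lform; rewrite !lformlin cc dd (lformC d c); lra.
Qed.

Lemma conf_circle_le i k : i != k -> lform (col i C) (col k C) <= -1.
Proof. by move=> ik; apply: unit_fut_le; rewrite ?conf_circle //; exact: conf_circle_fut. Qed.

Lemma conf_dual_le (j l : 'I_n) : j != l -> lform (col j D) (col l D) <= -1.
Proof. by move=> ik; apply: unit_fut_le; rewrite ?conf_dual //; exact: conf_dual_fut. Qed.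

(** The lift of the point of tangency is null and orthogonal to the future vector
    [col i C + col k C], hence proportional to it; so this sum has norm 0. *)
Lemma conf_edge i k : is_edge v i k -> lform (col i C) (col k C) = -1.
Proof.
move=> e; case: (e) => ik _.
case: conf => _ /(_ i k ik) [_ /(_ e) [x /seteqP[_ /(_ x erefl) h]] _] _ _.
move: h; rewrite !curveE ?conf_circle // => -[/= xc xd].
have [|s hs] := fut_orthogonal_colinear (fut_ptv x) (conf_circle_fut ik) _ (ptv_neq0 x).
  by rewrite lformDr xc xd addr0.
have := congr1 (fun w => lform w w) hs.
rewrite /= lformZl lformZr ptv_null !mulr0 !lformlin !conf_circle (lformC (col k C)).
by lra.
Qed.

Lemma conf_incident i j : i \in F j -> lform (col i C) (col j D) = 0.
Proof.
case: conf => _ _ _ /(_ i j) [h _] /h.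
by move/orthogonalP; apply; [exact: conf_circle|exact: conf_dual].
Qed.

Lemma vertex_in_facet i : exists j, i \in F j.
Proof.
have [k /(polyhedron_edge_in_two_facets vF) [j [_ [_ h _ _ _]]]] :=
  polyhedron_vertex_has_edge vF i.
by exists j.
Qed.

(* Disjointness of the curves leaves four possibilities; the other three are
   excluded by a face through [i] and a vertex on [j]. *)
Lemma conf_not_incident i j : i \notin F j -> fut (col i C + col j D).
Proof.
move=> ij; have [l il] := vertex_in_facet i.
have [_ [k [_ [_ [kj _ _ _]]]]] := polyhedron_facetP vF j.
have jl : j != l by apply: contraNneq ij => ->.
have ik : i != k by apply: contraNneq ij => ->.
have cc := conf_circle i; have dd := conf_dual j.
have g1 : 1 <= `|lform (col i C) (col j D)|.
  rewrite leNgt; apply/negP => /(common_point cc dd) [z [zc zd]].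
  case: conf => _ _ _ /(_ i j) [_ /(_ ij) /seteqP[h _]].
  by apply: (h (Some z)); rewrite !curveE.
have fj := conf_dual_fut jl; have fi := conf_circle_fut ik.
have cl := conf_incident il; have kd := conf_incident kj.
have gj := conf_dual_le jl; have gi := conf_circle_le ik.
have [g0|g0] := lerP 0 (lform (col i C) (col j D)).
  rewrite ger0_norm // in g1; exfalso.
  have : lform (col i C - col j D) (col i C - col j D) <= 0.
    by rewrite !lformlin cc dd (lformC (col j D)); lra.
  case/causal_cases => h.
    by have := lform_fut_le0 h fj; rewrite !lformlin cl dd; lra.
  have := lform_fut_le0 h fi; rewrite !lformlin cc (lformC (col j D) (col k C)) kd.
  by rewrite (lformC (col j D)); lra.
rewrite ltr0_norm // in g1.
have : lform (col i C + col j D) (col i C + col j D) <= 0.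
  by rewrite !lformlin cc dd (lformC (col j D)); lra.
case/causal_cases => // h; exfalso.
by have := lform_fut_le0 h fj; rewrite !lformlin cl dd; lra.
Qed.

Lemma conf_not_incident_le i j : i \notin F j -> lform (col i C) (col j D) <= -1.
Proof.
move=> ij; apply: unit_fut_le; rewrite ?conf_circle ?conf_dual //.
exact: conf_not_incident.
Qed.

Lemma conf_circle_dual_le0 i j : lform (col i C) (col j D) <= 0.
Proof.
case: (boolP (i \in F j)) => [/conf_incident -> //|/conf_not_incident_le]; lra.
Qed.

Let M := word_mx D.

Let packs (x y : 'cV[R]_4) := x = y \/ fut (x + y).

Lemma refl_fix j x : lform x (col j D) = 0 -> refl (col j D) *m x = x.
Proof. by move=> h; rewrite reflE h mulr0 scale0r subr0. Qed.

Lemma refl_dual j : refl (col j D) *m col j D = - col j D.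
Proof.
rewrite reflE conf_dual mulr1; apply/matrixP => x y; rewrite !mxE; ring.
Qed.

(* Ping-pong: along a reduced word the image of a circle lies in the dual circle
   of its first letter. *)
Lemma reduced_word_disc j js i :
  sorted (fun a b => a != b) (j :: js) -> i \notin F (last j js) ->
  fut (M (j :: js) *m col i C - col j D).
Proof.
elim: js j => [|l js IH] j /=.
  move=> _ ij; rewrite mulmx1.
  have -> : refl (col j D) *m col i C - col j D = refl (col j D) *m (col i C + col j D).
    by rewrite mulmxDr refl_dual.
  by apply: fut_refl; [exact: conf_dual|exact: conf_not_incident].
move=> /andP[jl p] il; rewrite -mulmxA.
have -> : refl (col j D) *m (M (l :: js) *m col i C) - col j D =
    refl (col j D) *m ((M (l :: js) *m col i C - col l D) + (col j D + col l D)).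
  rewrite addrA addrAC addrNK mulmxDr refl_dual //.
apply: fut_refl; [exact: conf_dual|apply: futD; last exact: conf_dual_fut].
exact: IH.
Qed.

Lemma unreduced_word js : ~~ sorted (fun a b => a != b) js ->
  exists ks, (size ks < size js)%N /\ M ks = M js.
Proof.
elim: js => [//|j [//|l js] IH] /=; rewrite negb_and => /orP[|h].
  rewrite negbK => /eqP <-; exists js; split=> //=.
  by rewrite mulmxA refl_refl ?mul1mx //; exact: conf_dual.
have [ks [sk e]] := IH h; exists (j :: ks); split=> //=.
by rewrite -/(M ks) e.
Qed.

(** Induction on the length. A last letter fixing [col i C] is dropped; a first letter fixing
    [col k C] is applied to the claim for the rest. Otherwise the image lies inside the first dual
    circle and [col k C] outside it. *)
Lemma word_packs js i k : packs (M js *m col i C) (col k C).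
Proof.
have [N] := ubnP (size js); elim: N js => // N IH js /ltnSE sN.
have [red|/unreduced_word [ks [sk <-]]] := boolP (sorted (fun a b => a != b) js); last first.
  by apply: IH; exact: leq_trans sk sN.
case: js red sN => [|j js] red sN.
  rewrite mul1mx; have [->|ik] := eqVneq i k; first by left.
  by right; exact: conf_circle_fut.
have [il|il] := boolP (i \in F (last j js)).
  have e : M (j :: js) *m col i C = M (belast j js) *m col i C.
    rewrite /M lastI -cats1 word_mx_cat /= mulmx1 -mulmxA refl_fix //.
    exact: conf_incident.
  by rewrite e; apply: IH; rewrite size_belast.
have [kj|kj] := boolP (k \in F j); last first.
  right; have := futD (reduced_word_disc red il) (conf_not_incident kj).
  by rewrite [col k C + _]addrC addrA addrNK.
have := IH js sN; rewrite /packs /= -mulmxA => -[e|h].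
  by left; rewrite -/(M js) e refl_fix //; exact: conf_incident.
right; rewrite -(refl_fix (conf_incident kj)) -mulmxDr.
by apply: fut_refl => //; exact: conf_dual.
Qed.

Lemma orbit_packs A B i k : word_group D A -> word_group D B ->
  A *m col i C = B *m col k C \/ fut (A *m col i C + B *m col k C).
Proof.
move=> gA gB; have lB := word_group_lorentz conf_dual gB.
have [js e] := word_groupM (word_group_inv conf_dual gB) gA.
have eA : A *m col i C = B *m (M js *m col i C).
  by rewrite /M -e -mulmxA mulKVmx // lorentz_unit.
rewrite eA -mulmxDr; case: (word_packs js i k) => [->|h]; [by left|right].
exact: lB.2.
Qed.

(** A future timelike vector with negative products with all dual circles: a base point in the
    interior of the chamber. *)
Definition csum : 'cV[R]_4 := \sum_i col i C.

Lemma three_vertices i : exists k l, [/\ k != i, l != i & l != k].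
Proof.
have [k /andP[ki _]] := third_vertex vF i i.
by have [l /andP[li lk]] := third_vertex vF i k; exists k, l.
Qed.

Lemma vertex_exists : exists i : 'I_m, true.
Proof.
case: vF => h _ _ _; have [|i _] := h (const_mx 1) 0; last by exists i.
by apply/eqP => /matrixP /(_ 0 0); rewrite !mxE; apply/eqP; rewrite oner_eq0.
Qed.

(** At most one circle of the configuration coincides with the image and contributes 1; at least two
    others contribute at most -1 each. *)
Lemma csum_orbit_lt0 A k : word_group D A -> lform csum (A *m col k C) < 0.
Proof.
move=> gA; have lA := word_group_lorentz conf_dual gA.
have aa : lform (A *m col k C) (A *m col k C) = 1.
  by rewrite lorentz_lform // conf_circle.
have pk i : A *m col k C = col i C \/ lform (col i C) (A *m col k C) <= -1.
  have := orbit_packs k i gA (word_group1 D); rewrite !mul1mx => -[->|h]; first by left.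
  by right; apply: unit_fut_le; rewrite ?conf_circle // addrC.
have neg i : A *m col k C <> col i C -> lform (col i C) (A *m col k C) <= -1.
  by move=> ne; case: (pk i).
have [x hx] : exists x, forall i, i != x -> lform (col i C) (A *m col k C) <= -1.
  have [[a ea]|na] := pselect (exists a, A *m col k C = col a C).
    by exists a => i ia; rewrite ea conf_circle_le.
  have [a _] := vertex_exists; exists a => i _; apply: neg => e; apply: na.
  by exists i.
have x1 : lform (col x C) (A *m col k C) <= 1.
  by case: (pk x) => [e|]; [rewrite -e aa|lra].
have [b [c [bx cx cb]]] := three_vertices x.
rewrite /csum lform_suml (bigD1 x) //= (bigD1 b) //= (bigD1 c) ?cx //=.
have hb := hx b bx; have hc := hx c cx.
set r := \sum_(_ | _) _; suff : r <= 0 by lra.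
by apply: sumr_le0 => i /andP[/andP[/hx h _] _]; lra.
Qed.

Lemma csum_circle_lt0 k : lform csum (col k C) < 0.
Proof. by have := csum_orbit_lt0 k (word_group1 D); rewrite mul1mx. Qed.

Lemma tfut_csum : tfut csum.
Proof.
have [x _] := vertex_exists; have [b [c [bx cx cb]]] := three_vertices x.
have uu : lform csum csum < 0.
  rewrite {1}/csum lform_suml (bigD1 x) //=.
  have := csum_circle_lt0 x; rewrite lformC => hx.
  set r := \sum_(_ | _) _; suff : r <= 0 by lra.
  by apply: sumr_le0 => i _; rewrite lformC ltW // csum_circle_lt0.
case: (timelike_cases uu) => // h.
have := lform_fut_le0 (tfutW h) (conf_circle_fut bx).
have := csum_circle_lt0 x; have := csum_circle_lt0 b.
by rewrite !lformNl lformDr; lra.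
Qed.

Lemma csum_dual_lt0 j : lform csum (col j D) < 0.
Proof.
have [i ij] := polyhedron_facet_misses vF j.
rewrite /csum lform_suml (bigD1 i) //=.
have := conf_not_incident_le ij; set r := \sum_(_ | _) _.
suff : r <= 0 by lra.
by apply: sumr_le0 => k _; exact: conf_circle_dual_le0.
Qed.

End Configuration.

(** * The fundamental chamber *)

Section Chamber.
Context {R : realType} {m n : nat} (v : 'I_m -> 'cV[R]_3) (F : 'I_n -> {set 'I_m}).
Context (C : 'M[R]_(4, m)) (D : 'M[R]_(4, n)).
Hypothesis vF : convex_polyhedron v F.
Hypothesis conf : polyhedral_configuration v F C D.
Implicit Types (i k : 'I_m) (j l : 'I_n) (f x y : 'cV[R]_4).

(** The Gram determinant is [1 - lform c d ^+ 2]. For tangent circles it vanishes and leaves only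
    the relation [a = b], which the product with [s] excludes. *)
Lemma independent_units (c d s : 'cV[R]_4) : lform c c = 1 -> lform d d = 1 ->
  lform c d <= -1 -> lform s c < 0 -> lform s d < 0 ->
  forall a b : R, a *: c + b *: d = 0 -> a = 0 /\ b = 0.
Proof.
move=> cc dd g sc sd a b e.
have e1 : a + b * lform c d = 0.
  by have := lform0r c; rewrite -e !lformlin cc mulr1.
have e2 : a * lform c d + b = 0.
  by have := lform0r d; rewrite -e !lformlin dd (lformC d c) mulr1.
have e3 : a * lform s c + b * lform s d = 0.
  by have := lform0r s; rewrite -e !lformlin.
have bg : b * (1 - lform c d) * (1 + lform c d) = 0.
  have ea : a = - (b * lform c d) by lra.
  by rewrite ea in e2; rewrite -[RHS]e2; ring.
move/eqP: bg; rewrite !mulf_eq0 -orbA => /or3P[/eqP b0|/eqP|/eqP g1].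
- by split=> //; rewrite b0 mul0r addr0 in e1.
- by lra.
have ab : a = b.
  have g2 : lform c d = -1 by lra.
  by rewrite g2 in e1; lra.
suff : b = 0 by rewrite ab.
apply/eqP; rewrite ab -mulrDr in e3; move/eqP: e3; rewrite mulf_eq0.
by case/orP => // /eqP; lra.
Qed.

Lemma span_of_orthogonal (c c' d d' x : 'cV[R]_4) :
  (forall a b : R, a *: c + b *: c' = 0 -> a = 0 /\ b = 0) ->
  (forall a b : R, a *: d + b *: d' = 0 -> a = 0 /\ b = 0) ->
  lform c d = 0 -> lform c d' = 0 -> lform c' d = 0 -> lform c' d' = 0 ->
  lform x d = 0 -> lform x d' = 0 -> exists a b : R, x = a *: c + b *: c'.
Proof.
move=> /rank_independent rc /rank_independent rd cd cd' c'd c'd' xd xd'.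
pose A := qform R *m row_mx d d'.
have rA : \rank A = 2%N by rewrite (eqmxMfull _ _) // row_full_unit unit_qform.
have inA (y : 'cV[R]_4) : lform y d = 0 -> lform y d' = 0 -> (y^T <= kermx A)%MS.
  rewrite /lform => yd yd'; apply/sub_kermxP; rewrite /A mul_mx_row mul_mx_row.
  rewrite !mulmxA [y^T *m _ *m d]mx11_scalar [y^T *m _ *m d']mx11_scalar yd yd'.
  by rewrite raddf0 row_mx0.
have sub : ((row_mx c c')^T <= kermx A)%MS by rewrite tr_row_mx col_mx_sub !inA.
have : (kermx A <= (row_mx c c')^T)%MS.
  by rewrite -(geq_leqif (mxrank_leqif_sup sub)) mxrank_ker rA mxrank_tr rc.
move=> /(submx_trans (inA x xd xd')) /submxP [z e].
exists (lsubmx z 0 0), (rsubmx z 0 0); apply: trmx_inj; rewrite e.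
rewrite -{1}[z]hsubmxK tr_row_mx mul_row_col [lsubmx z]mx11_scalar [rsubmx z]mx11_scalar.
by rewrite !mul_scalar_mx linearD /= !linearZ /= !mxE eqxx !mulr1n.
Qed.

Lemma conf_circles_independent i k : i != k ->
  forall a b : R, a *: col i C + b *: col k C = 0 -> a = 0 /\ b = 0.
Proof.
move=> ik; apply: (@independent_units _ _ (csum C)).
- exact: (conf_circle conf).
- exact: (conf_circle conf).
- exact: (conf_circle_le conf).
- exact: (csum_circle_lt0 vF conf).
- exact: (csum_circle_lt0 vF conf).
Qed.

Lemma conf_duals_independent j l : j != l ->
  forall a b : R, a *: col j D + b *: col l D = 0 -> a = 0 /\ b = 0.
Proof.
move=> ik; apply: (@independent_units _ _ (csum C)).
- exact: (conf_dual conf).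
- exact: (conf_dual conf).
- exact: (conf_dual_le conf).
- exact: (csum_dual_lt0 vF conf).
- exact: (csum_dual_lt0 vF conf).
Qed.

Let inc i j : i \in F j -> lform (col i C) (col j D) = 0.
Proof. exact: (conf_incident conf). Qed.

(** Argued among circles: [col a C] would be [x *: col i C + y *: col k C], and its products with
    the two tangent circles, [x - y] and [y - x], would both be at most -1. *)
Lemma facets_meet_in_edge i k a j l : is_edge v i k -> j != l ->
  i \in F j -> k \in F j -> i \in F l -> k \in F l ->
  a != i -> a != k -> a \in F j -> a \notin F l.
Proof.
move=> e jl ij kj il kl ai ak aj; apply/negP => al.
have ik : i != k by case: e.
have [x [y eq]] := span_of_orthogonal (conf_circles_independent ik)
  (conf_duals_independent jl) (inc ij) (inc il) (inc kj) (inc kl) (inc aj) (inc al).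
have := conf_circle_le conf ai; have := conf_circle_le conf ak.
rewrite eq !lformlin !(conf_circle conf) (lformC (col k C)) (conf_edge conf e).
by lra.
Qed.

Definition local_chamber i x := forall j, i \in F j -> lform x (col j D) <= 0.
Definition chamber x := forall j, lform x (col j D) <= 0.

(** Let [a] and [b] end the other edges at [i] of the two facets on the edge. Modulo [col i C] and
    [col k C], where [f] vanishes, [x] is [s *: col a C + t *: col b C], and each coefficient is
    read off by the dual circle of the opposite facet. *)
Lemma edge_cone i k f x : is_edge v i k -> lform f (col i C) = 0 ->
  lform f (col k C) = 0 -> (forall a, is_edge v i a -> 0 <= lform f (col a C)) ->
  local_chamber i x -> 0 <= lform f x.
Proof.
move=> e fi fk fa hx.
have ik : i != k by case: e.
have ki : k != i by rewrite eq_sym.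
have [j [l [jl ij kj il kl]]] := polyhedron_edge_in_two_facets vF e.
have lj : l != j by rewrite eq_sym.
have [a [aj ak ea]] := polyhedron_edge_in_facet vF ij kj ki.
have [b [bl bk eb]] := polyhedron_edge_in_facet vF il kl ki.
have ai : a != i by case: ea; rewrite eq_sym.
have bi : b != i by case: eb; rewrite eq_sym.
have al := facets_meet_in_edge e jl ij kj il kl ai ak aj.
have bj := facets_meet_in_edge e lj il kl ij kj bi bk bl.
have hal := conf_not_incident_le vF conf al.
have hbj := conf_not_incident_le vF conf bj.
pose s := lform x (col l D) / lform (col a C) (col l D).
pose t := lform x (col j D) / lform (col b C) (col j D).
have s0 : 0 <= s by rewrite mulr_le0 ?hx // invr_le0; lra.
have t0 : 0 <= t by rewrite mulr_le0 ?hx // invr_le0; lra.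
have aln : lform (col a C) (col l D) != 0 by rewrite lt_eqF //; lra.
have bjn : lform (col b C) (col j D) != 0 by rewrite lt_eqF //; lra.
have zj : lform (x - s *: col a C - t *: col b C) (col j D) = 0.
  by rewrite !lformlin (inc aj) /t; field.
have zl : lform (x - s *: col a C - t *: col b C) (col l D) = 0.
  by rewrite !lformlin (inc bl) /s; field.
have [p [q eq]] := span_of_orthogonal (conf_circles_independent ik)
  (conf_duals_independent jl) (inc ij) (inc il) (inc kj) (inc kl) zj zl.
have : lform f (x - s *: col a C - t *: col b C) = 0.
  by rewrite eq !lformlin fi fk; ring.
have := mulr_ge0 s0 (fa _ ea); have := mulr_ge0 t0 (fa _ eb).
by rewrite !lformlin; lra.
Qed.

(** Denominators of the linear programs: negative on the neighbours of [i], respectively on all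
    circles, and nonpositive on the chamber. *)
Definition facet_sum i : 'cV[R]_4 := \sum_(j | i \in F j) col j D.
Definition dual_sum : 'cV[R]_4 := \sum_j col j D.

(** Some facet at [i] must miss [k]: of the two facets on another edge from [i], at most one
    contains [k]. *)
Lemma facet_sum_edge_lt0 i k : is_edge v i k -> lform (facet_sum i) (col k C) < 0.
Proof.
move=> e; have ik : i != k by case: e.
have ki : k != i by rewrite eq_sym.
have [j [_ [_ ij kj _ _]]] := polyhedron_edge_in_two_facets vF e.
have [a [aj ak ea]] := polyhedron_edge_in_facet vF ij kj ki.
have ia : i != a by case: ea.
have ka : k != a by rewrite eq_sym.
have [l1 [l2 [l12 il1 al1 il2 al2]]] := polyhedron_edge_in_two_facets vF ea.
have [l il kl] : exists2 l, i \in F l & k \notin F l.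
  have [kl1|] := boolP (k \in F l1); last by exists l1.
  by exists l2 => //; exact: (facets_meet_in_edge ea l12 il1 al1 il2 al2 ki ka kl1).
rewrite /facet_sum lform_suml (bigD1 l) //= lformC.
have := conf_not_incident_le vF conf kl; set r := \sum_(_ | _) _.
suff : r <= 0 by lra.
by apply: sumr_le0 => j' _; rewrite lformC; exact: (conf_circle_dual_le0 vF conf).
Qed.

Lemma facet_sum_self i : lform (facet_sum i) (col i C) = 0.
Proof.
by rewrite /facet_sum lform_suml big1 // => j ij; rewrite lformC inc.
Qed.

Lemma dual_sum_lt0 i : lform dual_sum (col i C) < 0.
Proof.
have [k e] := polyhedron_vertex_has_edge vF i.
have ik : i != k by case: e.
have ki : k != i by rewrite eq_sym.
have [j [_ [_ ij kj _ _]]] := polyhedron_edge_in_two_facets vF e.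
have [b [bj bi eb]] := polyhedron_edge_in_facet vF kj ij ik.
have kb : k != b by case: eb.
have ib : i != b by rewrite eq_sym.
have [l1 [l2 [l12 kl1 bl1 kl2 bl2]]] := polyhedron_edge_in_two_facets vF eb.
have [l il] : exists l, i \notin F l.
  have [il1|] := boolP (i \in F l1); last by exists l1.
  by exists l2; exact: (facets_meet_in_edge eb l12 kl1 bl1 kl2 bl2 ik ib il1).
rewrite /dual_sum lform_suml (bigD1 l) //= lformC.
have := conf_not_incident_le vF conf il; set r := \sum_(_ | _) _.
suff : r <= 0 by lra.
by apply: sumr_le0 => j' _; rewrite lformC; exact: (conf_circle_dual_le0 vF conf).
Qed.

(* Linear programming on the vertex figure: the minimum of [f / facet_sum i] is
   attained at a neighbour of [i]. *)
Lemma local_chamber_bound i f : lform f (col i C) = 0 -> exists2 k, is_edge v i k &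
  forall x, local_chamber i x ->
    lform f (col k C) * - lform (facet_sum i) x <=
    lform f x * - lform (facet_sum i) (col k C).
Proof.
move=> fi; have [k0 e0] := polyhedron_vertex_has_edge vF i.
pose g k := - lform (facet_sum i) (col k C).
have g0 k : is_edge v i k -> 0 < g k by move=> e; rewrite oppr_gt0 facet_sum_edge_lt0.
have [|k /asboolP ek kmin] := @fin_argmin _ _ [pred k | `[<is_edge v i k>]]
  (fun k => lform f (col k C) / g k) k0; first exact/asboolP.
exists k => // x hx.
pose r := lform f (col k C) / g k.
have := @edge_cone i k (f + r *: facet_sum i) x ek.
rewrite !lformDl !lformZl fi facet_sum_self mulr0 addr0 => /(_ erefl) H.
have gk := g0 k ek.
have : 0 <= lform f x + r * lform (facet_sum i) x.
  apply: H => //.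
    by rewrite -[lform (facet_sum i) (col k C)]opprK -/(g k) /r; field; rewrite gt_eqF.
  move=> a ea; have := kmin a; rewrite /= => /(_ (introT (asboolP _) ea)).
  rewrite lformDl lformZl -[lform (facet_sum i) (col a C)]opprK -/(g a) -/r.
  by rewrite ler_pdivlMr ?g0 //; lra.
rewrite -(ler_pM2r gk) mul0r mulrDl /r.
have -> : lform f (col k C) / g k * lform (facet_sum i) x * g k =
   lform f (col k C) * lform (facet_sum i) x by field; rewrite gt_eqF.
by rewrite -/(g k); lra.
Qed.

(** A vertex minimizing the ratio to [dual_sum] is optimal on the chamber: [f'] vanishes there and
    is nonnegative on its neighbours, so the local bound at this vertex gives [0 <= lform f' x]. *)
Lemma chamber_bound f : exists i, forall x, chamber x ->
    lform f (col i C) * - lform dual_sum x <= lform f x * - lform dual_sum (col i C).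
Proof.
have [i0 _] := vertex_exists vF.
pose g k := - lform dual_sum (col k C).
have g0 k : 0 < g k by rewrite oppr_gt0 dual_sum_lt0.
have [i _ imin] := @fin_argmin _ _ predT (fun k => lform f (col k C) / g k) i0 isT.
exists i => x hx; have gi := g0 i.
pose r := lform f (col i C) / g i.
pose f' := f + r *: dual_sum.
have f'i : lform f' (col i C) = 0.
  rewrite /f' lformDl lformZl -[lform dual_sum (col i C)]opprK -/(g i) /r.
  by field; rewrite gt_eqF.
have [k ek hk] := local_chamber_bound f'i.
have f'k : 0 <= lform f' (col k C).
  rewrite /f' lformDl lformZl -[lform dual_sum (col k C)]opprK -/(g k) /r.
  by have := imin k isT; rewrite ler_pdivlMr ?g0 //; lra.
have := hk x (fun j _ => hx j).
have fs : lform (facet_sum i) x <= 0.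
  by rewrite /facet_sum lform_suml sumr_le0 // => j _; rewrite lformC.
move=> h; have {h} : 0 <= lform f' x * - lform (facet_sum i) (col k C).
  by apply: le_trans h; rewrite mulr_ge0 // oppr_ge0.
rewrite pmulr_lge0 ?oppr_gt0 ?facet_sum_edge_lt0 // /f' lformDl lformZl.
rewrite -(ler_pM2r gi) mul0r mulrDl /r.
have -> : lform f (col i C) / g i * lform dual_sum x * g i =
   lform f (col i C) * lform dual_sum x by field; rewrite gt_eqF.
by rewrite -/(g i); lra.
Qed.

Lemma facet_sum_neq0 i x : local_chamber i x ->
  (forall j l, i \in F j -> i \in F l -> j != l ->
    lform x (col j D) = 0 -> lform x (col l D) <> 0) ->
  lform (facet_sum i) x < 0.
Proof.
move=> hx h2; have [k e] := polyhedron_vertex_has_edge vF i.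
have [j [l [jl ij _ il _]]] := polyhedron_edge_in_two_facets vF e.
rewrite /facet_sum lform_suml.
have key j' : i \in F j' -> lform x (col j' D) != 0 ->
    \sum_(j0 | i \in F j0) lform (col j0 D) x < 0.
  move=> ij' n0; rewrite (bigD1 j') //=.
  have : lform (col j' D) x < 0 by rewrite lformC lt_neqAle n0 hx.
  set r := \sum_(_ | _) _; suff : r <= 0 by lra.
  by apply: sumr_le0 => j0 /andP[hj _]; rewrite lformC hx.
have [xj|] := eqVneq (lform x (col j D)) 0; last exact: key.
by apply: (key l) => //; apply/eqP; exact: h2 xj.
Qed.

(** For future [q], the local bound with objective [lform q (col i C) *: col i C - q] compares
    [- lform y q] with the product of [q] with the future vector of an edge; self-duality then makes
    [y] future. A null [y] would be proportional to that vector, hence orthogonal to the two facets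
    of the edge. *)
Lemma local_chamber_tfut i y : local_chamber i y -> lform y (col i C) = 0 ->
  (forall j l, i \in F j -> i \in F l -> j != l ->
    lform y (col j D) = 0 -> lform y (col l D) <> 0) ->
  tfut y.
Proof.
move=> hy yi h2; have sy := facet_sum_neq0 hy h2.
have bound q : fut q -> exists2 k, is_edge v i k & exists2 a, 0 < a &
    a * - lform (col i C + col k C) q <= - lform y q.
  move=> fq; have [|k ek hk] := @local_chamber_bound i (lform q (col i C) *: col i C - q).
    by rewrite lformDl lformNl lformZl (conf_circle conf) mulr1 subrr.
  exists k => //; have sk := facet_sum_edge_lt0 ek.
  exists (- lform (facet_sum i) y / - lform (facet_sum i) (col k C)).
    by rewrite divr_gt0 ?oppr_gt0.
  have := hk y hy; rewrite !lformDl !lformNl !lformZl (conf_edge conf ek) (lformC (col i C) y) yi.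
  rewrite mulrAC ler_pdivrMr ?oppr_gt0 // (lformC (col i C) q) (lformC q) (lformC y).
  by rewrite (lformC (col k C) q); lra.
have fy : fut y.
  apply: fut_dual => q fq; have [k ek [a a0 h]] := bound q fq.
  have fe : fut (col i C + col k C) by apply: (conf_circle_fut conf); case: ek.
  have := lform_fut_le0 fe fq; nra.
apply/tfutP; split => //; rewrite lt_neqAle (fut_lform fy) andbT; apply/eqP => yy.
have [k ek [a a0 h]] := bound y fy.
have fe : fut (col i C + col k C) by apply: (conf_circle_fut conf); case: ek.
have ey : lform (col i C + col k C) y = 0.
  by apply/eqP; rewrite eq_le lform_fut_le0 //=; rewrite yy in h; nra.
have e0 : col i C + col k C != 0.
  apply/eqP => e; have := lform0r (csum C); rewrite -e lformDr.
  by have := csum_circle_lt0 vF conf i; have := csum_circle_lt0 vF conf k; lra.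
have [s es] := fut_orthogonal_colinear fe fy ey e0.
have [j [l [jl ij kj il kl]]] := polyhedron_edge_in_two_facets vF ek.
apply: (h2 j l ij il jl); rewrite es lformZl lformDl.
  by rewrite (inc ij) (inc kj) addr0 mulr0.
by rewrite (inc il) (inc kl) addr0 mulr0.
Qed.

Lemma chamber_cone x : chamber x ->
  (forall j l, j != l -> lform x (col j D) = 0 -> lform x (col l D) <> 0) ->
  tfut x \/ exists i, 0 < lform x (col i C) /\ tfut (x - lform x (col i C) *: col i C).
Proof.
move=> hx h2.
have [[i xi]|no] := pselect (exists i, 0 < lform x (col i C)).
  right; exists i; split=> //.
  have e j : i \in F j -> lform (x - lform x (col i C) *: col i C) (col j D) = lform x (col j D).
    by move=> ij; rewrite lformDl lformNl lformZl (inc ij) mulr0 subr0.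
  apply: (local_chamber_tfut (i := i)) => [j ij||j l ij il jl]; rewrite ?e //.
  - by rewrite lformDl lformNl lformZl (conf_circle conf) mulr1 subrr.
  - exact: h2.
left.
have {}no i : lform x (col i C) <= 0.
  by rewrite leNgt; apply/negP => xi; apply: no; exists i.
(* With [- x] as objective the bound controls [lform x x] itself. *)
have [i hi] := chamber_bound (- x).
have [z|xi] := eqVneq (lform x (col i C)) 0.
  by apply: (local_chamber_tfut (i := i)) => // j l _ _; exact: h2.
have xin : lform x (col i C) < 0 by rewrite lt_neqAle xi no.
have sx : lform dual_sum x < 0.
  have := @facet_sum_neq0 i x (fun j _ => hx j) (fun j l _ _ => @h2 j l).
  rewrite /dual_sum (bigID (fun j => i \in F j)) /= lformDl -/(facet_sum i).
  suff : lform (\sum_(j | i \notin F j) col j D) x <= 0 by lra.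
  by rewrite lform_suml sumr_le0 // => j _; rewrite lformC hx.
have xx : lform x x < 0.
  by have := hi x hx; rewrite !lformNl; have := dual_sum_lt0 i; nra.
apply: (tfut_of_lform xx (tfut_csum vF conf)).
have [k hk] := chamber_bound (- csum C).
have := hk x hx; rewrite !lformNl (lformC x).
have := csum_circle_lt0 vF conf k; have := dual_sum_lt0 k.
by nra.
Qed.

End Chamber.

(** * Convergence and divergence of the partition function *)

Section Summation.
Context {R : realType}.

Lemma geometric_sum_le (q : R) N : 0 < q < 1 -> \sum_(k < N) q ^+ k <= (1 - q)^-1.
Proof.
move=> /andP[q0 q1]; rewrite -[leRHS]mul1r ler_pdivlMr ?subr_gt0 // mulrC.
have -> : (1 - q) * \sum_(k < N) q ^+ k = 1 - q ^+ N.
  by rewrite -opprB mulNr -subrX1 opprB.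
by rewrite gerBl exprn_ge0 // ltW.
Qed.

(* The sum is part of the expansion of a product of geometric series. *)
Lemma integer_code_sum_le (T : choiceType) (I : finType) (code : T -> I -> int)
    (q : I -> R) (s : seq T) :
  uniq s -> {in s &, forall x y, code x =1 code y -> x = y} ->
  (forall i, 0 < q i < 1) ->
  \sum_(x <- s) \prod_i q i ^+ `|code x i|%N <= \prod_i (2 / (1 - q i)).
Proof.
move=> us inj q01.
pose N := (\max_(x <- s) \max_i `|code x i|%N)%N.
have hN x i : x \in s -> (`|code x i| < N.+1)%N.
  move=> xs; rewrite ltnS; apply: leq_trans (leq_bigmax_seq _ xs isT).
  exact: (leq_bigmax (F := fun i => `|code x i|%N)).
(* An integer is stored as its modulus and a sign bit; the sign bit gives the factor 2 in each
   series. *)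
pose enc x : {ffun I -> 'I_N.+1 * bool} := [ffun i => (inord `|code x i|%N, code x i < 0)].
pose G (g : {ffun I -> 'I_N.+1 * bool}) := \prod_i q i ^+ (g i).1.
have -> : \sum_(x <- s) \prod_i q i ^+ `|code x i|%N = \sum_(g <- map enc s) G g.
  rewrite big_map; apply: eq_big_seq => x xs; apply: eq_bigr => i _.
  by rewrite ffunE /= inordK // hN.
have u' : uniq (map enc s).
  rewrite map_inj_in_uniq // => x y xs ys /ffunP e; apply: inj => // i.
  have := e i; rewrite !ffunE => -[/(congr1 val)].
  rewrite /= !inordK ?hN // => h1 h2.
  by move: h1 h2; case: (code x i) => a; case: (code y i) => b //= [->].
rewrite big_uniq //=.
have G0 g : 0 <= G g.
  by apply: prodr_ge0 => i _; rewrite exprn_ge0 //; case/andP: (q01 i) => /ltW.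
apply: (@le_trans _ _ (\sum_g G g)).
  by rewrite [leRHS](bigID (mem (map enc s))) /= lerDl sumr_ge0.
rewrite -(bigA_distr_bigA (fun i (p : 'I_N.+1 * bool) => q i ^+ p.1)).
apply: ler_prod => i _; have q0 : 0 <= q i by case/andP: (q01 i) => /ltW.
apply/andP; split; first by apply: sumr_ge0 => p _; rewrite exprn_ge0.
rewrite -(pair_bigA _ (fun (k : 'I_N.+1) (_ : bool) => q i ^+ k)) /=.
under eq_bigr => k _ do rewrite big_bool /= -mulr2n -mulr_natl.
by rewrite -mulr_sumr ler_pM2l // geometric_sum_le.
Qed.

Lemma summable_bounded (T : choiceType) (G : set T) (f : T -> R) (B : R) :
  (forall x, 0 <= f x) ->
  (forall s : seq T, uniq s -> {in s, forall x, G x} -> \sum_(x <- s) f x <= B) ->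
  summable G (fun x => (f x)%:E).
Proof.
move=> f0 h; rewrite /summable; apply: (@le_lt_trans _ _ B%:E); last exact: ltry.
apply: ge_ereal_sup => _ [X [finX XG] <-].
rewrite fsbig_finite //= (eq_bigr (fun x => (f x)%:E)); last first.
  by move=> x _; rewrite ger0_norm.
rewrite sumEFin lee_fin; apply: h => // x.
by rewrite in_fset_set // inE => /XG.
Qed.

Lemma summable_finite_ge (T : choiceType) (G : set T) (f : T -> R) (e : R) :
  (forall x, 0 <= f x) -> 0 < e -> summable G (fun x => (f x)%:E) ->
  finite_set [set x | G x /\ e <= f x].
Proof.
move=> f0 e0 sm; apply: contrapT => inf.
have : (\esum_(x in G) `|(f x)%:E| = +oo)%E.
  apply/eqyP => A A0.
  have [B BG hB] := infinite_set_fset (Num.trunc (A / e)).+1 inf.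
  apply: esum_ge; exists [set` B]; first by split=> // x /BG [].
  rewrite fsbig_finite //= set_fsetK.
  rewrite (eq_bigr (fun x => (f x)%:E)); last by move=> x _; rewrite ger0_norm.
  rewrite sumEFin lee_fin.
  apply: (@le_trans _ _ (\sum_(x <- finmap.enum_fset B) e)); last first.
    by rewrite big_seq [leRHS]big_seq; apply: ler_sum => x xB; have [] := BG x xB.
  rewrite big_const_seq count_predT iter_addr_0 -mulr_natl -ler_pdivrMr //.
  apply: ltW; apply: lt_le_trans (truncnS_gt _) _.
  by rewrite ler_nat.
by move: sm; rewrite /summable => + e1; rewrite e1 ltxx.
Qed.

Lemma finite_argmin (T : choiceType) (A : set T) (f : T -> R) x0 :
  finite_set A -> A x0 -> exists2 x, A x & forall y, A y -> f x <= f y.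
Proof.
move=> /finite_seqP[s ->] /= x0s.
have [i _ h] := @fin_argmin _ _ predT (fun i : 'I_(size s) => f (tnth (in_tuple s) i))
  (Ordinal (etrans (index_mem x0 s) x0s)) isT.
exists (tnth (in_tuple s) i); first exact: mem_tnth.
move=> y /= ys; have := h (Ordinal (etrans (index_mem y s) ys)) isT.
by rewrite [tnth _ (Ordinal _)](tnth_nth y) /= nth_index.
Qed.

End Summation.

(** * The orbit sum and the descent to the chamber *)

Section Convergence.
Context {R : realType} {m n : nat} (v : 'I_m -> 'cV[R]_3) (F : 'I_n -> {set 'I_m}).
Context (C : 'M[R]_(4, m)) (D : 'M[R]_(4, n)) (Ct : 'M[R]_(m, 4)).
Hypothesis vF : convex_polyhedron v F.
Hypothesis conf : polyhedral_configuration v F C D.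
Hypothesis bdd : bounded_packing C D.
Hypothesis CCt : C *m Ct = 1%:M.
Implicit Types (i k : 'I_m) (j l : 'I_n) (x y : 'cV[R]_4) (A B : 'M[R]_4).

(** Infinity is not on the curve, so it is a circle; the ends [p + s] and [p - s] of its horizontal
    diameter bound center and radius. The other coordinates are the curvature times [p], [q] and
    [p ^+ 2 + q ^+ 2 - s ^+ 2]. *)
Lemma bounded_orbit : exists2 K : R, 0 < K & forall A i r, word_group D A ->
  `|(A *m col i C) r 0| <= K * `|(A *m col i C) 1 0|.
Proof.
have [M hM] := bdd; exists (1 + `|M| + M ^+ 2).
  have := normr_ge0 M; have := sqr_ge0 M; lra.
move=> A i r gA; have [js eA] := gA.
have := hM (word_fun D js) i (ex_intro _ js erefl).
rewrite (act_word (conf_dual conf)) ?(conf_circle conf) // -eA.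
have : lform (A *m col i C) (A *m col i C) = 1.
  by rewrite (lorentz_lform _ _ (word_group_lorentz (conf_dual conf) gA)) (conf_circle conf).
move: (A *m col i C) => c /unit_norm cc hc.
have b0 : c 1 0 != 0.
  by apply/eqP => b0; have [] : (Some @` [set z | cnorm z <= M]) None by exact: hc.
pose p := c 2 0 / c 1 0; pose q := c 3 0 / c 1 0; pose s := `|c 1 0|^-1.
have s0 : 0 < s by rewrite invr_gt0 normr_gt0.
have hz (e : R) : e ^+ 2 = 1 -> (p + e * s) ^+ 2 + q ^+ 2 <= M ^+ 2.
  move=> e2; have [|z zM [ez]] := hc (Some ((p + e * s) +i* q)%C).
    have : cnorm (((p + e * s) +i* q)%C - Defs.center c) = s.
      rewrite cnormE centerE -/p -/q /= addrAC subrr add0r.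
      by rewrite subrr expr0n /= addr0 exprMn e2 mul1r sqrtr_sqr gtr0_norm.
    by rewrite /curve /= /curv (negPf b0).
  rewrite /= ez cnormE /= in zM.
  have z0 : 0 <= (p + e * s) ^+ 2 + q ^+ 2 by rewrite addr_ge0 ?sqr_ge0.
  have M0 : 0 <= M by apply: le_trans zM; rewrite sqrtr_ge0.
  by rewrite -[leLHS]sqr_sqrtr // ler_pXn2r ?nnegrE ?sqrtr_ge0.
have h : p ^+ 2 + q ^+ 2 + s ^+ 2 <= M ^+ 2.
  by have := hz 1 (expr1n _ 2); have := hz (-1) (etrans (sqrrN 1) (expr1n _ 2)); nra.
have e2 : c 2 0 = c 1 0 * p by rewrite /p; field.
have e3 : c 3 0 = c 1 0 * q by rewrite /q; field.
have e0 : c 0 0 = c 1 0 * (p ^+ 2 + q ^+ 2 - s ^+ 2).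
  apply: (mulfI b0); rewrite /s exprVn real_normK ?num_real //.
  transitivity (c 2 0 ^+ 2 + c 3 0 ^+ 2 - 1); first by lra.
  by rewrite e2 e3; field.
have P2 := sqr_ge0 p; have Q2 := sqr_ge0 q; have S2 := sqr_ge0 s; have M2 := sqr_ge0 M.
have nM := normr_ge0 M.
have sq (a : R) : a ^+ 2 <= M ^+ 2 -> `|a| <= `|M|.
  by move=> ha; rewrite -(@ler_pXn2r _ 2) ?nnegrE ?normr_ge0 // !real_normK ?num_real.
have lift (a b : R) : a = c 1 0 * b -> `|b| <= 1 + `|M| + M ^+ 2 ->
    `|a| <= (1 + `|M| + M ^+ 2) * `|c 1 0|.
  by move=> -> hb; rewrite normrM mulrC ler_wpM2r.
case: r => [[|[|[|[|//]]]]] /= lti.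
- rewrite (_ : Ordinal lti = 0); last exact/val_inj.
  by apply: (lift _ _ e0); rewrite ler_norml; apply/andP; split; lra.
- rewrite (_ : Ordinal lti = 1); last exact/val_inj.
  by apply: (lift _ 1); rewrite ?mulr1 // normr1; lra.
- rewrite (_ : Ordinal lti = 2); last exact/val_inj.
  by apply: (lift _ _ e2); have := @sq p; lra.
- rewrite (_ : Ordinal lti = 3); last exact/val_inj.
  by apply: (lift _ _ e3); have := @sq q; lra.
Qed.

(** Both [y + e *: col i C] and [y - e *: col i C] are future for small [e], and stay so under the
    group; their second coordinates are therefore nonnegative. *)
Lemma timelike_bound y : tfut y -> exists2 kappa : 'I_4 * 'I_m -> R, forall p, 0 < kappa p &
  forall A p, word_group D A -> kappa p * `|(A *m C) p.1 p.2| <= (A *m y) 1 0.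
Proof.
move=> ty; have [K K0 hK] := bounded_orbit.
have ex i : exists e, 0 < e /\ forall A, word_group D A ->
    e * `|(A *m col i C) 1 0| <= (A *m y) 1 0.
  have [e1 e10 h1] := fut_subr (col i C) ty.
  have [e2 e20 h2] := fut_subr (- col i C) ty.
  exists (Num.min e1 e2); rewrite lt_min e10 e20; split=> // A gA.
  have lA := word_group_lorentz (conf_dual conf) gA.
  have [_ + _] := lA.2 _ h1; have [_ + _] := lA.2 _ h2.
  have -> : A *m (y - e2 *: - col i C) = A *m y + e2 *: (A *m col i C).
    by rewrite mulmxBr -scalemxAr mulmxN scalerN opprK.
  have -> : A *m (y - e1 *: col i C) = A *m y - e1 *: (A *m col i C).
    by rewrite mulmxBr -scalemxAr.
  move: (A *m y) (A *m col i C) => z c; rewrite !mxE => b2 b1.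
  have m1 : Num.min e1 e2 <= e1 by rewrite ge_min lexx.
  have m2 : Num.min e1 e2 <= e2 by rewrite ge_min lexx orbT.
  have m0 : 0 < Num.min e1 e2 by rewrite lt_min e10.
  case: (lerP 0 (c 1 0)) => c0; first by rewrite ger0_norm //; nra.
  by rewrite ltr0_norm //; nra.
have [e he] := choice ex.
exists (fun p => e p.2 / K) => [p|A p gA]; first by rewrite divr_gt0 //; case: (he p.2).
have [e0 h] := he p.2; apply: le_trans (h A gA).
rewrite -mulrA ler_pM2l // mulrC ler_pdivrMr // mulrC.
by have := hK A p.2 p.1 gA; rewrite colE mulmxA -colE !mxE.
Qed.

Definition entry_code A (p : 'I_4 * 'I_m) : int := Num.floor ((A *m C) p.1 p.2).

Lemma entry_code_inj A B : word_group D A -> word_group D B ->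
  entry_code A =1 entry_code B -> A = B.
Proof.
move=> gA gB e.
suff h : A *m C = B *m C by rewrite -[A]mulmx1 -[B]mulmx1 -CCt !mulmxA h.
have colM (M : 'M[R]_4) i : M *m col i C = col i (M *m C) by rewrite !colE mulmxA.
have hc i : A *m col i C = B *m col i C.
  have [//|h] := orbit_packs vF conf i i gA gB.
  have lA := word_group_lorentz (conf_dual conf) gA.
  have lB := word_group_lorentz (conf_dual conf) gB.
  have := fut_lform h; rewrite !lformlin !(lorentz_lform _ _ lA) !(lorentz_lform _ _ lB).
  rewrite (conf_circle conf) (lformC (B *m _)) => h1.
  have d1 r : `|(A *m col i C - B *m col i C) r 0| <= 1.
    rewrite !colM !mxE; have := e (r, i); rewrite /entry_code /= !mxE.
    set a := \sum_(_ | _) _; set b := \sum_(_ | _) _ => fe.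
    have := floor_itv a; have := floor_itv b; rewrite fe intrD.
    by move=> /andP[? ?] /andP[? ?]; rewrite ler_norml; apply/andP; split; lra.
  exfalso.
  have h2 : 4 <= lform (A *m col i C - B *m col i C) (A *m col i C - B *m col i C).
    rewrite !lformlin (lorentz_lform _ _ lA) (lorentz_lform _ _ lB) (conf_circle conf).
    by rewrite (lformC (B *m _)); lra.
  have := d1 0; have := d1 1; have := d1 2; have := d1 3; move: h2; rewrite lformE.
  move: (_ - _) => d; move: (d 0 0) (d 1 0) (d 2 0) (d 3 0) => d0 d1' d2 d3.
  have nn (a b : R) : `|a| <= 1 -> `|b| <= 1 -> -1 <= a * b <= 1.
    by move=> ha hb; rewrite -ler_norml normrM mulr_ile1.
  move=> hd n3 n2 n1 n0.
  have /andP[? ?] := nn _ _ n0 n1; have /andP[? ?] := nn _ _ n2 n2.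
  have /andP[? ?] := nn _ _ n3 n3; lra.
apply/matrixP => r i; have /matrixP /(_ r 0) := hc i.
by rewrite !colM !mxE.
Qed.

Lemma timelike_sum_bounded y : tfut y -> exists S : R, forall s : seq 'M[R]_4,
  uniq s -> {in s, forall A, word_group D A} ->
  \sum_(A <- s) expR (- (A *m y) 1 0) <= S.
Proof.
move=> ty; have [kappa k0 hk] := timelike_bound ty.
pose N : R := #|{: 'I_4 * 'I_m}|%:R.
have N0 : 0 < N.
  rewrite ltr0n card_prod !card_ord muln_gt0 /=.
  by have [i _] := vertex_exists vF; exact: leq_ltn_trans (ltn_ord i).
(* The exponent is split evenly over the entries. The factors [(q p)^-1] below pay for rounding,
   since a code may exceed the modulus of its entry by up to 1. *)
pose q p := expR (- (kappa p / N)).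
have q01 p : 0 < q p < 1.
  by rewrite expR_gt0 expR_lt1 oppr_lt0 divr_gt0.
exists ((\prod_p (q p)^-1) * \prod_p (2 / (1 - q p))) => s us sG.
apply: (@le_trans _ _ (\sum_(A <- s) (\prod_p (q p)^-1) *
    \prod_p q p ^+ `|entry_code A p|%N)); last first.
  rewrite -mulr_sumr ler_wpM2l //.
    by apply: prodr_ge0 => p _; rewrite invr_ge0 expR_ge0.
  by apply: integer_code_sum_le => // A B As Bs; apply: entry_code_inj; exact: sG.
rewrite big_seq [leRHS]big_seq; apply: ler_sum => A As; have gA := sG A As.
rewrite -big_split /=.
have -> : expR (- (A *m y) 1 0) = \prod_(p : 'I_4 * 'I_m) expR (- (A *m y) 1 0 / N).
  by rewrite prodr_const -expRM_natl -/N mulrC divfK // gt_eqF.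
apply: ler_prod => p _; rewrite expR_ge0 /= /q -expRN opprK -expRM_natl -expRD ler_expR.
have hp := hk A p gA.
have : `|entry_code A p|%:R <= `|(A *m C) p.1 p.2| + 1.
  have := floor_itv ((A *m C) p.1 p.2); rewrite -/(entry_code A p) intrD.
  rewrite natr_absz; case: (lerP 0 (entry_code A p)) => c0 /andP[c1 c2].
    rewrite ger0_norm //; have := ler_norm ((A *m C) p.1 p.2); lra.
  rewrite ltr0_norm // intrN; have := ler_norm (- (A *m C) p.1 p.2); rewrite normrN; lra.
move: (`|entry_code A p|%:R) (`|(A *m C) p.1 p.2|) hp => a b hp hab.
have kN : 0 < kappa p / N by rewrite divr_gt0.
have hp' : kappa p / N * b <= (A *m y) 1 0 / N by rewrite mulrAC ler_pM2r ?invr_gt0.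
by rewrite mulNr; nra.
Qed.

Lemma timelike_finite y (b : R) : tfut y ->
  finite_set [set A | word_group D A /\ (A *m y) 1 0 <= b].
Proof.
move=> /timelike_sum_bounded[S hS].
have sm : summable (word_group D) (fun A => (expR (- (A *m y) 1 0))%:E).
  by apply: (summable_bounded (B := S)) => // A; exact: expR_ge0.
have := summable_finite_ge (fun A => expR_ge0 _) (expR_gt0 (- b)) sm.
apply: sub_finite_set => A [gA hA]; split=> //.
by rewrite ler_expR lerN2.
Qed.

(** An image of [col i C] equals it or has a future sum with it, so its curvature is at least [- b];
    the circle part costs only the constant factor [expR (a * b)]. *)
Lemma cone_summable A0 i (a : R) y : word_group D A0 -> 0 <= a -> tfut y ->
  summable (word_group D)
    (fun A => (expR (- (A *m (a *: (A0 *m col i C) + y)) 1 0))%:E).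
Proof.
move=> g0 a0 /timelike_sum_bounded[S hS].
pose b := `|(col i C : 'cV[R]_4) 1 0|.
apply: (summable_bounded (B := expR (a * b) * S)) => [A|s us sG]; first exact: expR_ge0.
apply: le_trans (ler_wpM2l (expR_ge0 (a * b)) (hS s us sG)).
rewrite mulr_sumr big_seq [leRHS]big_seq; apply: ler_sum => A As.
rewrite -expRD ler_expR mulmxDr -scalemxAr mulmxA mxE mxE.
have := orbit_packs vF conf i i (word_groupM (sG A As) g0) (word_group1 D).
rewrite mul1mx => h; suff : - b <= (A *m A0 *m col i C) 1 0 by nra.
case: h => [->|[_ + _]]; first by rewrite /b lerNl -normrN ler_norm.
rewrite mxE; have := ler_norm ((col i C : 'cV[R]_4) 1 0); rewrite /b; lra.
Qed.

(* [A0] minimizes the curvature of [A *m csum]. *)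
Lemma fundamental_functional : exists2 A0, word_group D A0 &
  forall j, 0 <= (A0 *m col j D) 1 0.
Proof.
pose u := csum C.
have fin := timelike_finite ((1%:M *m u) 1 0) (tfut_csum vF conf).
have [A0 [g0 h0] hmin] := finite_argmin (fun A : 'M[R]_4 => (A *m u) 1 0) fin
  (conj (word_group1 D) (lexx _)).
exists A0 => // j.
have gj : word_group D (A0 *m refl (col j D)).
  apply: word_groupM => //; rewrite -[refl _]mulmx1; apply: word_group_refl.
  exact: word_group1.
have := csum_dual_lt0 vF conf j; rewrite -/u => uj.
have e : (A0 *m refl (col j D) *m u) 1 0 =
    (A0 *m u) 1 0 - 2 * lform u (col j D) * (A0 *m col j D) 1 0.
  by rewrite -mulmxA reflE mulmxBr -scalemxAr !mxE.
rewrite leNgt; apply/negP => neg.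
have lt : (A0 *m refl (col j D) *m u) 1 0 < (A0 *m u) 1 0 by rewrite e; nra.
have /hmin : [set A | word_group D A /\ (A *m u) 1 0 <= (1%:M *m u) 1 0]
    (A0 *m refl (col j D)) by split=> //; apply: ltW; exact: lt_le_trans lt h0.
by rewrite leNgt lt.
Qed.

Lemma summable_cone x :
  summable (word_group D) (fun A => (expR (- (A *m x) 1 0))%:E) ->
  exists A, word_group D A /\ (tfut (A *m x) \/ exists i,
    0 < lform (A *m x) (col i C) /\
    tfut (A *m x - lform (A *m x) (col i C) *: col i C)).
Proof.
move=> sm; have [A0 g0 h0] := fundamental_functional.
have fin (b : R) : finite_set [set A | word_group D A /\ (A *m x) 1 0 <= b].
  have := summable_finite_ge (fun A => expR_ge0 _) (expR_gt0 (- b)) sm.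
  by apply: sub_finite_set => A [gA hA]; split=> //; rewrite ler_expR lerN2.
pose u := csum C; have lA0 := word_group_lorentz (conf_dual conf) g0.
have ud j : lform u (col j D) < 0 by exact: (csum_dual_lt0 vF conf).
have finS : finite_set [set A | word_group D A /\ (A0 *m A *m x) 1 0 <= (A0 *m x) 1 0].
  have : finite_set [set invmx A0 *m A | A in
      [set A | word_group D A /\ (A *m x) 1 0 <= (A0 *m x) 1 0]] by exact: finite_image.
  apply: sub_finite_set => A [gA hA]; exists (A0 *m A); first by split=> //; exact: word_groupM.
  by rewrite mulKmx // lorentz_unit.
(* A reflection in a dual circle with positive product stays in the set, as [A0 *m col j D] has
   nonnegative curvature, and strictly lowers the objective, as [lform u (col j D)] is negative. *)
have [A1 [g1 h1] hmin] := finite_argmin (fun A : 'M[R]_4 => - lform u (A *m x)) finS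
  (conj (word_group1 D) (eq_ind_r (fun M => (M *m x) 1 0 <= (A0 *m x) 1 0) (lexx _) (mulmx1 A0))).
pose y := A1 *m x; exists A1; split=> //.
apply: (chamber_cone vF conf) => [j|j l jl yj yl].
  rewrite leNgt; apply/negP => pos.
  have /hmin : [set A | word_group D A /\ (A0 *m A *m x) 1 0 <= (A0 *m x) 1 0]
      (refl (col j D) *m A1).
    split; first exact: word_group_refl.
    apply: le_trans h1; rewrite -!mulmxA reflE mulmxBr -scalemxAr.
    have e (a b : 'cV[R]_4) (t : R) : (a - t *: b) 1 0 = a 1 0 - t * b 1 0.
      by rewrite !mxE.
    by rewrite e gerBl !mulr_ge0 // ltW.
  by rewrite -mulmxA reflE lformDr lformNr lformZr; have := ud j; nra.
have finT : finite_set [set A | word_group D A /\ A *m y = y].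
  have : finite_set [set A *m invmx A1 | A in
      [set A | word_group D A /\ (A *m x) 1 0 <= (A1 *m x) 1 0]] by exact: finite_image.
  apply: sub_finite_set => A [gA hA]; exists (A *m A1).
    by split; [exact: word_groupM|rewrite -mulmxA hA].
  rewrite mulmxK //; apply: lorentz_unit.
  exact: (word_group_lorentz (conf_dual conf) g1).
(* [B *m u] is an image of [u] under the stabilizer that no reflection fixing [y] moves farther
   away. It has nonnegative products with both dual circles, yet their sum is future. *)
have [B [gB hB] hmax] := finite_argmin (fun A : 'M[R]_4 => lform u (A *m u)) finT
  (conj (word_group1 D) (mul1mx _)).
have key j' : lform y (col j' D) = 0 -> 0 <= lform (B *m u) (col j' D).
  move=> yj'; have /hmax : [set A | word_group D A /\ A *m y = y] (refl (col j' D) *m B).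
    by split; [exact: word_group_refl|rewrite -mulmxA hB (refl_fix yj')].
  by rewrite -mulmxA reflE lformDr lformNr lformZr; have := ud j'; nra.
have tB : tfut (B *m u).
  apply: lorentz_tfut; last exact: (tfut_csum vF conf).
  exact: (word_group_lorentz (conf_dual conf) gB).
have := lform_tfut_lt0 tB (conf_dual_fut conf jl).
have -> : col j D + col l D != 0.
  by apply/eqP => e; have := lform0r u; rewrite -e lformDr; have := ud j; have := ud l; lra.
by move=> /(_ isT); rewrite lformDr; have := key j yj; have := key l yl; lra.
Qed.

End Convergence.

(** * The projective chart *)

Section ProjectiveChart.
Context {R : realType}.
Implicit Types (X Y A : 'cV[R]_4) (p q : 'cV[R]_3).

(** The null coordinates are [X 0 0 = t + z] and [X 1 0 = t - z], while [X 2 0] and [X 3 0] are x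
    and y. *)
Definition time X : R := (X 0 0 + X 1 0) / 2.
Definition space X : 'cV[R]_3 :=
  \col_i nth 0 [:: X 2 0; X 3 0; (X 0 0 - X 1 0) / 2] i.
Definition pchart X : 'cV[R]_3 := (time X)^-1 *: space X.
Definition plift q : 'cV[R]_4 :=
  \col_i nth 0 [:: 1 + q 2 0; 1 - q 2 0; q 0 0; q 1 0] i.

Lemma cV3P p q : p 0 0 = q 0 0 -> p 1 0 = q 1 0 -> p 2 0 = q 2 0 -> p = q.
Proof.
move=> h0 h1 h2; apply/matrixP => i j; rewrite (ord1 j).
case: i => [[|[|[|//]]]] /= lti.
- by rewrite (_ : Ordinal lti = 0); first exact: h0; exact/val_inj.
- by rewrite (_ : Ordinal lti = 1); first exact: h1; exact/val_inj.
- by rewrite (_ : Ordinal lti = 2); first exact: h2; exact/val_inj.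
Qed.

Lemma dotv3E p q : dotv p q = p 0 0 * q 0 0 + p 1 0 * q 1 0 + p 2 0 * q 2 0.
Proof.
rewrite dotvE !big_ord_recl big_ord0.
have -> : lift 0 (0 : 'I_2) = 1 :> 'I_3 by exact/val_inj.
have -> : lift 0 (lift 0 (0 : 'I_1)) = 2 :> 'I_3 by exact/val_inj.
by rewrite addr0 addrA.
Qed.

Lemma timeD X Y : time (X + Y) = time X + time Y.
Proof. by rewrite /time !mxE; field. Qed.
Lemma timeZ (a : R) X : time (a *: X) = a * time X.
Proof. by rewrite /time !mxE; field. Qed.
Lemma spaceD X Y : space (X + Y) = space X + space Y.
Proof. by apply: cV3P; rewrite !mxE /=; field. Qed.
Lemma spaceZ (a : R) X : space (a *: X) = a *: space X.
Proof. by apply: cV3P; rewrite !mxE /=; field. Qed.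

Lemma time_plift q : time (plift q) = 1.
Proof. by rewrite /time !mxE /=; field. Qed.
Lemma space_plift q : space (plift q) = q.
Proof. by apply: cV3P; rewrite !mxE /=; field. Qed.

Lemma plift_pchart X : time X != 0 -> plift (pchart X) = (time X)^-1 *: X.
Proof.
rewrite /time => t0; apply: cV4P; rewrite !mxE /= /time //; field.
all: by apply: contra t0 => /eqP ->; rewrite mul0r.
Qed.

Lemma pchart_space X : time X != 0 -> time X *: pchart X = space X.
Proof. by move=> t0; rewrite /pchart scalerA mulfV ?scale1r. Qed.

Lemma lform_plift p q : lform (plift p) (plift q) = dotv p q - 1.
Proof. by rewrite lformE dotv3E !mxE /=; field. Qed.

Lemma timelike_ball_pchart X : time X != 0 -> timelike_ball (pchart X) <-> lform X X < 0.
Proof.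
move=> t0; rewrite /timelike_ball /= -subr_lt0 -lform_plift plift_pchart //.
rewrite lformZl lformZr mulrA pmulr_rlt0 // -expr2 exprn_even_gt0 ?invr_eq0 //.
Qed.

Lemma fut_time_gt0 X : fut X -> X != 0 -> 0 < time X.
Proof.
move=> fX X0; have := lform_tfut_lt0 (@tfut_u0 R) fX X0.
by rewrite lformC lform_u0 /time; lra.
Qed.

Lemma tfut_time_gt0 X : tfut X -> 0 < time X.
Proof. by case=> *; rewrite /time; lra. Qed.

Lemma base_circle_pchart A q : time A != 0 ->
  base_circle (pchart A) q <-> lform (plift q) (plift q) = 0 /\ lform A (plift q) = 0.
Proof.
move=> t0; rewrite /base_circle /lightlike_sphere /= dotvDl dotvNl.
have -> : lform A (plift q) = time A * (dotv (pchart A) q - 1).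
  by rewrite -lform_plift plift_pchart // lformZl mulrA mulfV // mul1r.
rewrite lform_plift.
split=> -[h1 h2].
  by rewrite h1 subrr; split=> //; rewrite h1 in h2; rewrite h2 mulr0.
split; first lra.
by move/eqP: h2; rewrite mulf_eq0 (negPf t0) /= => /eqP; lra.
Qed.

Lemma plift_null_fut q : lform (plift q) (plift q) = 0 -> fut (plift q).
Proof.
move=> h; apply: fut_of_time; first by rewrite h.
by have := time_plift q; rewrite /time; lra.
Qed.

(* For a unit vector [A], [cone_lt A X] says that [X] is a positive multiple of [A]
   plus a future timelike vector orthogonal to [A]. *)
Definition cone_le A X := 0 <= lform X A /\ fut (X - lform X A *: A).
Definition cone_lt A X := 0 < lform X A /\ tfut (X - lform X A *: A).

Lemma cone_leD A X Y : cone_le A X -> cone_le A Y -> cone_le A (X + Y).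
Proof.
move=> [a1 f1] [a2 f2]; rewrite /cone_le lformDl; split; first exact: addr_ge0.
by rewrite scalerDl opprD addrACA; exact: futD.
Qed.

Lemma cone_leZ A X (a : R) : 0 <= a -> cone_le A X -> cone_le A (a *: X).
Proof.
move=> a0 [a1 f1]; rewrite /cone_le lformZl; split; first exact: mulr_ge0.
by rewrite -scalerA -scalerBr; exact: futZ.
Qed.

Lemma cone_ltD A X Y : cone_lt A X -> cone_le A Y -> cone_lt A (X + Y).
Proof.
move=> [a1 f1] [a2 f2]; rewrite /cone_lt lformDl; split; first exact: ltr_wpDr.
by rewrite scalerDl opprD addrACA; exact: tfutD.
Qed.

Lemma cone_ltZ A X (a : R) : 0 < a -> cone_lt A X -> cone_lt A (a *: X).
Proof.
move=> a0 [a1 f1]; rewrite /cone_lt lformZl; split; first exact: mulr_gt0.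
by rewrite -scalerA -scalerBr; exact: tfutZ.
Qed.

Lemma plift_sum (N : nat) (q : 'I_N -> 'cV[R]_3) (a : 'I_N -> R) :
  \sum_i a i = 1 -> plift (\sum_i a i *: q i) = \sum_i a i *: plift (q i).
Proof.
move=> a1.
have e (r : 'I_3) : (\sum_i a i *: q i) r 0 = \sum_i a i * q i r 0.
  by rewrite summxE; apply: eq_bigr => i _; rewrite mxE.
apply: cV4P; rewrite summxE !mxE /= e.
- by rewrite -a1 -big_split /=; apply: eq_bigr => i _; rewrite !mxE /= mulrDr mulr1.
- by rewrite -a1 -sumrB /=; apply: eq_bigr => i _; rewrite !mxE /= mulrBr mulr1.
- by apply: eq_bigr => i _; rewrite !mxE.
- by apply: eq_bigr => i _; rewrite !mxE.
Qed.

Lemma hull_cone_le A q : lform A A = 1 -> 0 < time A ->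
  Defs.convex_hull ([set pchart A] `|` base_circle (pchart A)) q -> cone_le A (plift q).
Proof.
move=> AA tA [N [x [a [hx a0 a1 ->]]]]; rewrite plift_sum //.
apply: (@big_ind _ (cone_le A)) => [|X Y|i _]; last 1 first.
- apply: cone_leZ => //; case: (hx i) => [/= ->|].
    rewrite plift_pchart ?gt_eqF //; apply: cone_leZ; first by rewrite invr_ge0 ltW.
    by rewrite /cone_le AA scale1r subrr; split=> //; exact: fut0.
  move/base_circle_pchart; rewrite gt_eqF // => /(_ isT) [h1 h2].
  by rewrite /cone_le lformC h2 scale0r subr0; split=> //; exact: plift_null_fut.
- by rewrite /cone_le lform0l scale0r subr0; split=> //; exact: fut0.
- exact: cone_leD.
Qed.

(** Two base points suffice to reach any point of the open cone: [Y] is the mean of [Y + s *: f] and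
    [Y - s *: f], with [f] orthogonal to [A] and [Y] and [s] making both null. *)
Lemma null_decomposition A Y : tfut Y -> lform Y A = 0 -> exists l1 l2,
  [/\ Y = l1 + l2, fut l1 /\ fut l2, lform l1 l1 = 0 /\ lform l2 l2 = 0,
      lform l1 A = 0 /\ lform l2 A = 0 & 0 < time l1 /\ 0 < time l2].
Proof.
move=> tY YA; have [f [f0 fA fY _]] := orthogonal3 A Y Y.
have YY : lform Y Y < 0 by case/tfutP: tY.
have ff : 0 < lform f f by exact: spacelike_orthogonal fY f0.
pose s := Num.sqrt (- lform Y Y / lform f f).
have s2 : s ^+ 2 = - lform Y Y / lform f f.
  by rewrite sqr_sqrtr // ltW // divr_gt0 // oppr_gt0.
have key (e : R) : e ^+ 2 = 1 -> let l := 2^-1 *: (Y + (e * s) *: f) in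
    [/\ fut l, lform l l = 0, lform l A = 0 & 0 < time l].
  move=> e2 l.
  have ll : lform l l = 0.
    rewrite /l !lformlin fY (lformC Y f) fY.
    transitivity (4^-1 * (lform Y Y + e ^+ 2 * s ^+ 2 * lform f f)); first by field.
    by rewrite e2 s2; field; rewrite gt_eqF.
  have lY : lform l Y < 0 by rewrite /l lformZl lformDl lformZl fY; lra.
  have l0 : l != 0 by apply: contraTneq lY => ->; rewrite lform0l ltxx.
  have fl : fut l.
    have : lform l l <= 0 by rewrite ll.
    case/causal_cases => // h; have := lform_fut_le0 h (tfutW tY).
    by rewrite lformNl; lra.
  split=> //; last exact: fut_time_gt0.
  by rewrite /l lformZl lformDl lformZl fA YA mulr0 addr0 mulr0.
have [a1 a2 a3 a4] := key 1 (expr1n _ 2).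
have [b1 b2 b3 b4] := key (-1) (etrans (sqrrN 1) (expr1n _ 2)).
exists (2^-1 *: (Y + (1 * s) *: f)), (2^-1 *: (Y + (-1 * s) *: f)); split=> //.
by apply/matrixP => i j; rewrite !mxE; field.
Qed.

Lemma cone_lt_hull A q : 0 < time A -> lform A A = 1 -> cone_lt A (plift q) ->
  Defs.convex_hull ([set pchart A] `|` base_circle (pchart A)) q.
Proof.
move=> tA AA [a0]; set a := lform _ _ in a0 *; set Y := _ - _ => tY.
have YA : lform Y A = 0 by rewrite /Y lformDl lformNl lformZl AA mulr1 subrr.
have [l1 [l2 [eY [f1 f2] [n1 n2] [z1 z2] [t1 t2]]]] := null_decomposition tY YA.
have eq : plift q = a *: A + l1 + l2 by rewrite -addrA -eY /Y addrC subrK.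
have base l : fut l -> lform l l = 0 -> lform l A = 0 -> 0 < time l ->
    base_circle (pchart A) (pchart l).
  move=> fl ll lA tl; apply/base_circle_pchart; rewrite ?gt_eqF //.
  by rewrite plift_pchart ?gt_eqF // !(lformZl, lformZr) ll (lformC A) lA !mulr0.
pose x (i : 'I_3) := nth 0 [:: pchart A; pchart l1; pchart l2] i.
(* The barycentric weights are the time coordinates of the three parts of [plift q], whose time is
   1. *)
pose w (i : 'I_3) := nth 0 [:: a * time A; time l1; time l2] i.
exists 3, x, w; split.
- case=> [[|[|[|//]]]] lti; rewrite /x /=; [by left|right|right]; exact: base.
- case=> [[|[|[|//]]]] lti; rewrite /w /=; [|exact: ltW|exact: ltW].
  by rewrite mulr_ge0 // ltW.
- rewrite !big_ord_recl big_ord0 /w /= addr0 -(time_plift q) eq !timeD timeZ addrA //.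
- rewrite !big_ord_recl big_ord0 /w /x /= addr0 -scalerA !pchart_space ?gt_eqF //.
  by rewrite -[LHS]space_plift eq !spaceD spaceZ addrA.
Qed.

Lemma cone_lt_open A : open [set q : 'cV[R]_3 | cone_lt A (plift q)].
Proof.
have cc (i : 'I_3) : continuous (fun q : 'cV[R]_3 => q i 0) by exact: coord_continuous.
have c0 (a : R) : continuous (fun _ : 'cV[R]_3 => a) by move=> q; exact: cst_continuous.
have cD (f g : 'cV[R]_3 -> R) : continuous f -> continuous g ->
    continuous (fun q => f q + g q).
  by move=> cf cg q; exact: (continuousD (cf q) (cg q)).
have cB (f g : 'cV[R]_3 -> R) : continuous f -> continuous g ->
    continuous (fun q => f q - g q).
  by move=> cf cg q; exact: (continuousB (cf q) (cg q)).
have cM (f g : 'cV[R]_3 -> R) : continuous f -> continuous g ->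
    continuous (fun q => f q * g q).
  by move=> cf cg q; exact: (continuousM (cf q) (cg q)).
have aff (a b c d : R) :
    continuous (fun q : 'cV[R]_3 => a + b * q 0 0 + c * q 1 0 + d * q 2 0).
  by do 3 (apply: (cD); last by apply: (cM); [exact: c0|exact: cc]).
have op (f : 'cV[R]_3 -> R) : continuous f -> open [set q | 0 < f q].
  move=> cf; apply: (@open_comp _ _ f [set y | 0 < y]); last exact: open_gt.
  by move=> q _; exact: cf.
have cl : continuous (fun q : 'cV[R]_3 => lform (plift q) A).
  rewrite (_ : (fun _ => _) = fun q : 'cV[R]_3 =>
    - (A 0 0 + A 1 0) / 2 + A 2 0 * q 0 0 + A 3 0 * q 1 0 + (A 0 0 - A 1 0) / 2 * q 2 0).
    exact: aff.
  by apply/funext => q; rewrite lformE !mxE /=; field.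
have cp (i : 'I_4) : continuous (fun q : 'cV[R]_3 => plift q i 0).
  have k (a b c d : R) f : (forall q, f q = a + b * q 0 0 + c * q 1 0 + d * q 2 0) ->
      continuous (f : 'cV[R]_3 -> R).
    by move=> /funext ->; exact: aff.
  case: i => [[|[|[|[|//]]]]] lti.
  - by apply: (k 1 0 0 1) => q; rewrite !mxE /=; ring.
  - by apply: (k 1 0 0 (-1)) => q; rewrite !mxE /=; ring.
  - by apply: (k 0 1 0 0) => q; rewrite !mxE /=; ring.
  - by apply: (k 0 0 1 0) => q; rewrite !mxE /=; ring.
pose Y (q : 'cV[R]_3) := plift q - lform (plift q) A *: A.
have cY (i : 'I_4) : continuous (fun q => Y q i 0).
  rewrite (_ : (fun _ => _) = fun q => plift q i 0 - lform (plift q) A * A i 0); last first.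
    by apply/funext => q; rewrite /Y !mxE.
  by apply: (cB); [exact: cp|apply: (cM); [exact: cl|exact: c0]].
have -> : [set q : 'cV[R]_3 | cone_lt A (plift q)] =
    [set q | 0 < lform (plift q) A] `&` ([set q | 0 < Y q 0 0] `&` ([set q | 0 < Y q 1 0] `&`
    [set q | 0 < Y q 0 0 * Y q 1 0 - (Y q 2 0 * Y q 2 0 + Y q 3 0 * Y q 3 0)])).
  apply/seteqP; split=> q /=.
    by move=> [h [h0 h1 h2]]; rewrite -!expr2 subr_gt0; repeat split.
  by move=> [h [h0 [h1]]]; rewrite -!expr2 subr_gt0 => h2; split.
apply: openI; first exact: op.
apply: openI; first exact/op/cY.
apply: openI; first exact/op/cY.
by apply: op; apply: (cB); [|apply: (cD)]; apply: (cM); exact: cY.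
Qed.

(** An interior point [q] can be moved slightly away from a strict point [q0] without leaving the
    hull; then [q] is a proper mean of a strict and a weak point, hence strict. *)
Lemma solid_cone_pchart A q : lform A A = 1 -> 0 < time A ->
  solid_cone (pchart A) q <-> cone_lt A (plift q).
Proof.
move=> AA tA; split; last first.
  move=> h; rewrite /solid_cone /interior /=.
  have : nbhs q [set q : 'cV[R]_3 | cone_lt A (plift q)].
    by apply: open_nbhs_nbhs; split=> //; exact: cone_lt_open.
  by apply: filterS => q' h'; exact: cone_lt_hull.
rewrite /solid_cone /interior /= => /nbhs_normP [e /= e0 he].
pose Y0 := u0 - lform u0 A *: A.
have uu1 : lform u0 u0 = -1 :> R by rewrite lform_u0 !mxE /=; lra.
have s2 := sqr_ge0 (lform u0 A).
have YA : lform Y0 A = 0 by rewrite /Y0 !lformlin AA mulr1 subrr.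
have tY : tfut Y0.
  apply: (tfut_of_lform _ (@tfut_u0 R)); rewrite /Y0 !lformlin (lformC A u0) uu1 ?AA; nra.
pose X0 := A + Y0.
have X0A : lform X0 A = 1 by rewrite /X0 lformDl YA AA addr0.
have cX0 : cone_lt A X0.
  by rewrite /cone_lt X0A scale1r /X0 addrAC subrr add0r; split.
have tX0 : 0 < time X0 by rewrite /X0 timeD addr_gt0 // tfut_time_gt0.
pose q0 := pchart X0.
have c0 : cone_lt A (plift q0).
  by rewrite plift_pchart ?gt_eqF //; apply: cone_ltZ; rewrite ?invr_gt0.
pose d := e / (1 + `|q - q0|) / 2.
have n0 : 0 < 1 + `|q - q0| by rewrite ltr_pwDl.
have d0 : 0 < d by rewrite !divr_gt0.
have : Defs.convex_hull ([set pchart A] `|` base_circle (pchart A)) (q + d *: (q - q0)).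
  apply: he; rewrite /= opprD addrA subrr add0r normrN normrZ gtr0_norm //.
  rewrite /d mulrAC ltr_pdivrMr // mulrAC ltr_pdivrMr //.
  have := normr_ge0 (q - q0); nra.
move/(hull_cone_le AA tA) => h.
have mid (t : R) (r : 'cV[R]_3) : 1 + t != 0 ->
    plift q = (1 + t)^-1 *: (t *: plift r + plift (q + t *: (q - r))).
  by move=> t1; apply: cV4P; rewrite !mxE /=; field.
rewrite (mid d q0) ?gt_eqF ?addr_gt0 //.
apply: cone_ltZ; first by rewrite invr_gt0 addr_gt0.
by apply: cone_ltD => //; exact: cone_ltZ.
Qed.

End ProjectiveChart.

(** * Lorentz coordinates and the dual reflection group *)

Section LorentzCoordinates.
Context {R : realType}.
Implicit Types (T : 'M[R]_4) (X : 'cV[R]_4).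

Definition std_frame : 'M[R]_4 := \matrix_(i, j) nth 0 (nth [::]
  [:: [:: 0; 0; 1; 0]; [:: 0; 0; 0; 1];
      [:: 2^-1; - 2^-1; 0; 0]; [:: 2^-1; 2^-1; 0; 0]] i) j.

Definition std_frame_inv : 'M[R]_4 := \matrix_(i, j) nth 0 (nth [::]
  [:: [:: 0; 0; 1; 1]; [:: 0; 0; - 1; 1]; [:: 1; 0; 0; 0]; [:: 0; 1; 0; 0]] i) j.

Lemma std_frameK : std_frame *m std_frame_inv = 1%:M.
Proof.
apply/matrixP => i j; rewrite !mxE !big_ord_recl big_ord0 !mxE /=.
by case: i => [[|[|[|[|//]]]]] ?; case: j => [[|[|[|[|//]]]]] ?; rewrite /=; field.
Qed.

Lemma std_frame_form : std_frame^T *m lorentz_form R *m std_frame = qform R.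
Proof.
apply/matrixP => i j; rewrite /lorentz_form mul_mx_diag !mxE !big_ord_recl big_ord0 !mxE /=.
by case: i => [[|[|[|[|//]]]]] ?; case: j => [[|[|[|[|//]]]]] ?; rewrite /=; field.
Qed.

Lemma std_frame_inv_form : std_frame_inv^T *m qform R *m std_frame_inv = lorentz_form R.
Proof.
rewrite -std_frame_form -mulmxA -(mulmxA _ std_frame) std_frameK mulmx1 mulmxA.
by rewrite -trmx_mul std_frameK trmx1 mul1mx.
Qed.

Lemma std_frameE X : [/\ (std_frame *m X) 0 0 = X 2 0, (std_frame *m X) 1 0 = X 3 0,
  (std_frame *m X) 2 0 = (X 0 0 - X 1 0) / 2 & (std_frame *m X) 3 0 = time X].
Proof.
have e1 : lift 0 (0 : 'I_3) = 1 :> 'I_4 by exact/val_inj.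
have e2 : lift 0 (lift 0 (0 : 'I_2)) = 2 :> 'I_4 by exact/val_inj.
have e3 : lift 0 (lift 0 (lift 0 (0 : 'I_1))) = 3 :> 'I_4 by exact/val_inj.
rewrite /time; split; rewrite !mxE !big_ord_recl big_ord0 !mxE /= ?e1 ?e2 ?e3; by field.
Qed.

(** One timelike vector decides: if [T] sent some future vector to the past, its product with [p]
    would change sign. *)
Lemma lorentz_of_time T p :
  (forall x y, lform (T *m x) (T *m y) = lform x y) -> tfut p ->
  0 <= time (T *m p) -> lorentz T.
Proof.
move=> hT tp t0; split=> [|x fx]; first exact: lform_preserving.
have tTp : tfut (T *m p).
  have pp : lform (T *m p) (T *m p) < 0 by rewrite hT; case/tfutP: tp.
  apply/tfutP; split=> //; apply: fut_of_time; first exact: ltW.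
  by move: t0; rewrite /time; lra.
have : lform (T *m x) (T *m x) <= 0 by rewrite hT fut_lform.
case/causal_cases => // h; have := lform_fut_le0 (tfutW tTp) h.
rewrite lformNr hT oppr_le0 => px.
have [->|x0] := eqVneq x 0; first by rewrite mulmx0; exact: fut0.
by have := lform_tfut_lt0 tp fx x0; rewrite ltNge px.
Qed.

Lemma cone_lt_mul T (a x : 'cV[R]_4) : lorentz T -> cone_lt a x -> cone_lt (T *m a) (T *m x).
Proof.
move=> hT [h1 h2]; rewrite /cone_lt lorentz_lform //; split=> //.
by rewrite scalemxAr -mulmxBr; exact: lorentz_tfut.
Qed.

End LorentzCoordinates.

Section CoordinatesOfConfiguration.
Context {R : realType} {m n : nat}.
Context (C : 'M[R]_(4, m)) (D : 'M[R]_(4, n)) (Ct : 'M[R]_(m, 4)).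
Hypothesis CCt : C *m Ct = 1%:M.

(** With [U := L *m Ct], both [L] and [U *m C] have the same product with the invertible matrix
    [U^T *m lorentz_form R]. *)
Lemma lorentz_coordinatesP (L : 'M[R]_(4, m)) : lorentz_coordinates C L ->
  exists2 T : 'M[R]_4, (forall x y, lform (T *m x) (T *m y) = lform x y) &
    L = std_frame *m T *m C.
Proof.
rewrite /lorentz_coordinates => hL; pose U := L *m Ct.
have UU : U^T *m lorentz_form R *m U = qform R.
  have -> : U^T *m lorentz_form R *m U = Ct^T *m (L^T *m lorentz_form R *m L) *m Ct.
    by rewrite /U trmx_mul !mulmxA.
  by rewrite hL !mulmxA -trmx_mul CCt trmx1 mul1mx -mulmxA CCt mulmx1.
have uU : U^T *m lorentz_form R \in unitmx.
  by have := @unit_qform R; rewrite -UU unitmx_mul => /andP[].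
have eL : L = U *m C.
  apply: (can_inj (mulKmx uU)); rewrite (mulmxA _ U) UU.
  have -> : U^T *m lorentz_form R *m L = Ct^T *m (L^T *m lorentz_form R *m L).
    by rewrite /U trmx_mul !mulmxA.
  by rewrite hL !mulmxA -trmx_mul CCt trmx1 mul1mx.
exists (std_frame_inv *m U) => [x y|].
  apply: lform_mulmx; rewrite trmx_mul.
  transitivity (U^T *m (std_frame_inv^T *m qform R *m std_frame_inv) *m U).
    by rewrite !mulmxA.
  by rewrite std_frame_inv_form.
by rewrite mulmxA std_frameK mul1mx.
Qed.

Lemma tcoordE (T : 'M[R]_4) s : tcoord (std_frame *m T *m C) s = time (T *m (C *m s)).
Proof. by rewrite /tcoord -!mulmxA; have [_ _ _ ->] := std_frameE (T *m (C *m s)). Qed.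

Lemma chartE (T : 'M[R]_4) s : chart (std_frame *m T *m C) s = pchart (T *m (C *m s)).
Proof.
rewrite /chart tcoordE -!mulmxA; have [e0 e1 e2 _] := std_frameE (T *m (C *m s)).
have w0 : widen_ord (leqnSn 3) 0 = 0 :> 'I_4 by exact/val_inj.
have w1 : widen_ord (leqnSn 3) 1 = 1 :> 'I_4 by exact/val_inj.
have w2 : widen_ord (leqnSn 3) 2 = 2 :> 'I_4 by exact/val_inj.
apply: cV3P.
- by rewrite mxE w0 e0 /pchart [RHS]mxE [X in _ = _ * X]mxE /= mulrC.
- by rewrite mxE w1 e1 /pchart [RHS]mxE [X in _ = _ * X]mxE /= mulrC.
- by rewrite mxE w2 e2 /pchart [RHS]mxE [X in _ = _ * X]mxE /= mulrC.
Qed.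

Lemma qform_sym : (qform R)^T = qform R.
Proof.
apply/matrixP => i j; rewrite !mxE.
by case: i => [[|[|[|[|//]]]]] ?; case: j => [[|[|[|[|//]]]]] ?.
Qed.

(** The map [s |-> C *m s] intertwines the dual of [sigma] with the reflection in the dual circle:
    in [Gtilde] the factors [qform R] and [C *m Ct] cancel. Transposition reverses products, hence
    [rev] for words. *)
Lemma sigma_dual j : C *m (sigma C D Ct j)^T = refl (col j D) *m C.
Proof.
have e : alpha C D j *m ((alpha C D j)^T *m Gtilde Ct) =
    - (alpha C D j *m ((col j D)^T *m Ct^T)).
  rewrite -mulmxN; congr (_ *m _); rewrite /alpha /Gtilde linearN /= mulNmx; congr (- _).
  rewrite !trmx_mul trmxK qform_sym !mulmxA -(mulmxA _ C) CCt mulmx1.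
  by rewrite -(mulmxA _ (qform R)) mulmxV ?unit_qform // mulmx1.
rewrite /sigma e scalerN opprK linearD /= trmx1 linearZ /= mulmxDr mulmx1.
rewrite /refl mulmxBl mul1mx; congr (_ + _).
rewrite -scalemxAr -scalemxAl -scalerN; congr (_ *: _).
rewrite !trmx_mul !trmxK !mulmxA CCt mul1mx /alpha linearN /= mulmxN; congr (- _).
by rewrite !trmx_mul trmxK qform_sym !mulmxA.
Qed.

Definition word_sigma (js : seq 'I_n) : 'M[R]_m :=
  foldr (fun j => mulmx (sigma C D Ct j)) 1%:M js.

Lemma word_sigma_dual js : C *m (word_sigma js)^T = word_mx D (rev js) *m C.
Proof.
elim: js => [|j js IH] /=; first by rewrite trmx1 mulmx1 mul1mx.
rewrite trmx_mul mulmxA IH rev_cons -cats1 word_mx_cat /= mulmx1.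
by rewrite -!mulmxA sigma_dual.
Qed.

Lemma Omega_orbit s : Omega C D Ct s <->
  exists js i, s = (word_sigma js)^T *m omega i.
Proof.
split=> [[w [i [[js ->] ->]]]|[js [i ->]]]; first by exists js, i.
by exists (word_sigma js), i; split=> //; exists js.
Qed.

Lemma C_Omega js i : C *m ((word_sigma js)^T *m omega i) = word_mx D (rev js) *m col i C.
Proof. by rewrite mulmxA word_sigma_dual -mulmxA /omega -colE. Qed.

End CoordinatesOfConfiguration.

(** * Stereographic projection and transport of configurations *)

Section Transport.
Context {R : realType} {m n : nat} (v : 'I_m -> 'cV[R]_3) (F : 'I_n -> {set 'I_m}).
Implicit Types (T : 'M[R]_4).

Lemma stereoE (x : riemann_sphere R) : stereo x = pchart (ptv x).
Proof.
case: x => [[a b]|]; apply: cV3P; rewrite /stereo /pchart /time !mxE /=; try by field.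
all: have s : a ^+ 2 + b ^+ 2 + 1 != 0
  by rewrite gt_eqF // ltr_wpDl ?ltr01 // addr_ge0 ?sqr_ge0.
all: by field.
Qed.

Lemma stereo_curve (c : 'cV[R]_4) : lform c c = 1 -> 0 < time c ->
  stereo @` curve c = base_circle (pchart c).
Proof.
move=> cc tc; have tx x : 0 < time (ptv x) :> R.
  by apply: fut_time_gt0; [exact: fut_ptv|exact: ptv_neq0].
rewrite curveE //; apply/seteqP; split=> q /=.
  move=> [x xc <-]; rewrite stereoE; apply/base_circle_pchart; first by rewrite gt_eqF.
  by rewrite plift_pchart ?gt_eqF // !(lformZl, lformZr) ptv_null (lformC c) xc !mulr0.
move/base_circle_pchart; rewrite gt_eqF // => /(_ isT) [qq cq].
have q0 : plift q != 0.
  by apply/eqP => e; have := time_plift q; rewrite e /time !mxE addr0 mul0r; lra.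
have [k k0] := ptv_vpt (plift_null_fut qq) qq q0; move: (vpt _) => x e.
exists x; first by move/eqP: cq; rewrite e lformZr mulf_eq0 gt_eqF //= lformC => /eqP.
have kt : k * time (ptv x) = 1 by rewrite -timeZ -e time_plift.
rewrite stereoE /pchart -[RHS]space_plift e spaceZ; congr (_ *: _).
by rewrite -[LHS]mul1r -kt mulfK // gt_eqF.
Qed.

Lemma transport_configuration T C D : lorentz T ->
  polyhedral_configuration v F C D ->
  polyhedral_configuration v F (T *m C) (T *m D).
Proof.
move=> hT conf; have cc := conf_circle conf; have dd := conf_dual conf.
have colC i : col i (T *m C) = T *m col i C by rewrite !colE mulmxA.
have colD j : col j (T *m D) = T *m col j D by rewrite !colE mulmxA.
have inj := vact_inj hT.
have imI (A B : set (riemann_sphere R)) :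
    vact T @` A `&` vact T @` B = vact T @` (A `&` B).
  apply/seteqP; split=> x /=.
    by move=> [[y yA <-] [z zB /inj e]]; exists y => //; split=> //; rewrite -e.
  by move=> [y [yA yB] <-]; split; exists y.
have dj c d : lform c c = 1 -> lform d d = 1 -> disjoint_circles c d ->
    disjoint_circles (T *m c) (T *m d).
  by move=> c1 d1; rewrite /disjoint_circles !curve_vact // imI => ->; rewrite image_set0.
have tg c d : lform c c = 1 -> lform d d = 1 -> tangent c d -> tangent (T *m c) (T *m d).
  move=> c1 d1 [x e]; exists (vact T x).
  by rewrite !curve_vact // imI e image_set1.
have ds c d : lform c c = 1 -> lform d d = 1 -> disc c `&` disc d = set0 ->
    disc (T *m c) `&` disc (T *m d) = set0.
  by move=> c1 d1; rewrite !disc_vact // imI => ->; rewrite image_set0.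
case: conf => _ hc hd hcd; split.
- by split=> [i|j]; apply/ocircleE; rewrite ?colC ?colD lorentz_lform.
- move=> i k /(hc i k) [h1 h2 h3]; rewrite !colC; split; first exact: ds.
    by move=> /h2; exact: tg.
  by move=> /h3; exact: dj.
- move=> i k /(hd i k) [h1 h2 h3]; rewrite !colD; split; first exact: ds.
    by move=> /h2; exact: tg.
  by move=> /h3; exact: dj.
- move=> i j; have [h1 h2] := hcd i j; rewrite colC colD; split.
    move=> /h1 /(orthogonalP (cc i) (dd j)) h; apply/orthogonalP; rewrite ?lorentz_lform //.
  by move=> /h2; exact: dj.
Qed.

Lemma word_mx_transport T (D : 'M[R]_(4, n)) js : lorentz T ->
  word_mx (T *m D) js *m T = T *m word_mx D js.
Proof.
move=> hT; elim: js => [|j js IH] /=; first by rewrite mul1mx mulmx1.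
have e : refl (col j (T *m D)) *m T = T *m refl (col j D).
  apply: mulmx_colP => x; rewrite -!mulmxA !reflE mulmxBr.
  have -> : col j (T *m D) = T *m col j D by rewrite !colE mulmxA.
  by rewrite lorentz_lform // scalemxAr.
by rewrite -mulmxA IH mulmxA e mulmxA.
Qed.

End Transport.

(** * Domain of convergence and packing on the lightlike sphere *)

Section Main.
Context {R : realType} {m n : nat} (v : 'I_m -> 'cV[R]_3) (F : 'I_n -> {set 'I_m}).
Context (C : 'M[R]_(4, m)) (D : 'M[R]_(4, n)) (Ct : 'M[R]_(m, 4)).
Hypothesis vF : convex_polyhedron v F.
Hypothesis conf : polyhedral_configuration v F C D.
Hypothesis CCt : C *m Ct = 1%:M.

(** Reindexes the sum by matrices. A map of the sphere determines the images of all circles, and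
    these determine the matrix because [C] has a right inverse. *)
Lemma Wgeom_bij : set_bij (word_group D) (Wgeom D) (@vact R).
Proof.
have dd := conf_dual conf; split.
- by move=> A [js ->]; exists js; rewrite -(word_funE dd).
- move=> A B; rewrite !inE => gA gB e.
  suff h : A *m C = B *m C by rewrite -[A]mulmx1 -[B]mulmx1 -CCt !mulmxA h.
  apply/matrixP => r i.
  have : A *m col i C = B *m col i C.
    have lA := word_group_lorentz dd gA; have lB := word_group_lorentz dd gB.
    by rewrite -!act_vact ?e // (conf_circle conf).
  by rewrite !colE !mulmxA -!colE => /matrixP /(_ r 0); rewrite !mxE.
- by move=> g [js ->]; exists (word_mx D js); [exists js|rewrite -(word_funE dd)].
Qed.

Lemma abs_conv_domainE s : abs_conv_domain C D s <->
  summable (word_group D) (fun A => (expR (- (A *m (C *m s)) 1 0))%:E).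
Proof.
rewrite /abs_conv_domain /= /summable (reindex_esum _ _ _ _ Wgeom_bij).
suff -> : (\esum_(A in word_group D) `|(expR (- dotv (curvature_vector C (vact A)) s))%:E| =
    \esum_(A in word_group D) `|(expR (- (A *m (C *m s)) 1 0))%:E|)%E by [].
apply: eq_esum => A gA; congr (`|(expR (- _))%:E|)%E.
have lA := word_group_lorentz (conf_dual conf) gA.
rewrite dotvE mulmxA mxE; apply: eq_bigr => i _; rewrite mxE /curv act_vact //; last first.
  exact: (conf_circle conf).
by rewrite colE mulmxA -colE mxE.
Qed.

Section GivenCoordinates.
Variable T : 'M[R]_4.
Hypothesis TT : forall x y : 'cV[R]_4, lform (T *m x) (T *m y) = lform x y.
Let L := std_frame *m T *m C.
Hypothesis posL : forall s, Omega C D Ct s -> 0 < tcoord L s.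

Lemma orbit_time_gt0 A i : word_group D A -> 0 < time (T *m (A *m col i C)).
Proof.
move=> [js ->]; have := posL (s := (word_sigma C D Ct (rev js))^T *m omega i).
by rewrite tcoordE C_Omega // revK; apply; apply/Omega_orbit; exists (rev js), i.
Qed.

(** Positivity of the time on the orbit fixes the orientation, as it gives [csum] a nonnegative
    time. *)
Lemma lorentz_coordinate_change : lorentz T.
Proof.
apply: (lorentz_of_time TT (tfut_csum vF conf)).
rewrite /csum mulmx_sumr; elim/big_rec: _ => [|i x _ hx].
  by rewrite /time !mxE addr0 mul0r.
rewrite timeD addr_ge0 // ltW //.
by have := orbit_time_gt0 i (word_group1 D); rewrite mul1mx.
Qed.

Let hT := lorentz_coordinate_change.

Lemma orbit_unit A i : word_group D A -> lform (A *m col i C) (A *m col i C) = 1.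
Proof.
move=> gA; rewrite (lorentz_lform _ _ (word_group_lorentz (conf_dual conf) gA)).
exact: (conf_circle conf).
Qed.

Lemma cone_lt_time (a x : 'cV[R]_4) : 0 < time a -> cone_lt a x -> 0 < time x.
Proof.
move=> ta [h1 h2]; rewrite -[x](subrK (lform x a *: a)) timeD timeZ.
by apply: addr_gt0; [exact: tfut_time_gt0|exact: mulr_gt0].
Qed.

Lemma domain_eq : bounded_packing C D ->
  abs_conv_domain C D = [set s | 0 < tcoord L s /\
    (timelike_ball `|` \bigcup_(a in Omega C D Ct) solid_cone (chart L a)) (chart L s)].
Proof.
move=> bdd; apply/seteqP; split=> s.
  move/abs_conv_domainE/(summable_cone vF conf bdd CCt) => [A [gA h]].
  have lA := word_group_lorentz (conf_dual conf) gA.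
  have uA := lorentz_unit lA; have lA' := lorentz_inv lA.
  rewrite /= tcoordE chartE; set x := C *m s in h *.
  have [tx|[i cx]] : tfut x \/ exists i, cone_lt (invmx A *m col i C) x.
    case: h => [h|[i h]]; [left|right; exists i]; rewrite -[x](mulKmx uA).
      exact: lorentz_tfut.
    exact: cone_lt_mul.
  - have tTx : tfut (T *m x) by exact: lorentz_tfut.
    have t0 := tfut_time_gt0 tTx; split=> //; left.
    by apply/timelike_ball_pchart; [rewrite gt_eqF|case/tfutP: tTx].
  have gA' := word_group_inv (conf_dual conf) gA.
  have cTx := cone_lt_mul hT cx; have ta := orbit_time_gt0 i gA'.
  have t0 := cone_lt_time ta cTx; split=> //; right.
  have [js ejs] := gA'; exists ((word_sigma C D Ct (rev js))^T *m omega i).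
    by apply/Omega_orbit; exists (rev js), i.
  rewrite chartE C_Omega // revK -ejs; apply/solid_cone_pchart => //.
    by rewrite TT orbit_unit.
  by rewrite plift_pchart ?gt_eqF //; apply: cone_ltZ; rewrite ?invr_gt0.
rewrite /= tcoordE chartE => -[]; set x := C *m s => t0 h; apply/abs_conv_domainE.
rewrite -/x; have [i0 _] := vertex_exists vF.
have TK (y : 'cV[R]_4) : invmx T *m (T *m y) = y by rewrite mulKmx // lorentz_unit.
case: h => [/timelike_ball_pchart|[a]].
  rewrite gt_eqF // => /(_ isT) xx; have tTx : tfut (T *m x).
    by apply/tfutP; split=> //; apply: fut_of_time; [exact: ltW|move: t0; rewrite /time; lra].
  have tx : tfut x by rewrite -(TK x); apply: lorentz_tfut => //; exact: lorentz_inv.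
  have := cone_summable vF conf bdd CCt i0 (word_group1 D) (lexx 0) tx.
  by rewrite scale0r add0r.
move=> /Omega_orbit [js [i ->]]; rewrite chartE C_Omega //.
have gA : word_group D (word_mx D (rev js)) by exists (rev js).
move: gA; move: (word_mx D (rev js)) => A gA.
move/solid_cone_pchart; rewrite TT orbit_unit // => /(_ erefl (orbit_time_gt0 i gA)).
rewrite plift_pchart ?gt_eqF // => /(cone_ltZ t0); rewrite scalerA mulfV ?gt_eqF // scale1r.
move=> /(cone_lt_mul (lorentz_inv hT)); rewrite !TK => -[x0 ty].
have := cone_summable vF conf bdd CCt i gA (ltW x0) ty.
by rewrite addrC subrK.
Qed.

Lemma packing_eq : packing_on_N v F
  [set (fun i => base_circle (chart L (w^T *m omega i))) | w in Wrefl C D Ct].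
Proof.
exists (T *m C), (T *m D).
have conf' := transport_configuration hT conf; split=> //.
have colC i : col i (T *m C) = T *m col i C by rewrite !colE mulmxA.
have key js i : stereo @` curve (act (word_fun (T *m D) js) (col i (T *m C))) =
    base_circle (chart L ((word_sigma C D Ct (rev js))^T *m omega i)).
  have gA : word_group D (word_mx D js) by exists js.
  rewrite (act_word (conf_dual conf')) ?(conf_circle conf') // colC mulmxA.
  rewrite word_mx_transport // -mulmxA stereo_curve ?TT ?orbit_unit ?orbit_time_gt0 //.
  by rewrite chartE C_Omega // revK.
apply/seteqP; split=> f /= [].
  move=> w [js ->] <-; exists (word_fun (T *m D) (rev js)); first by exists (rev js).
  by apply/funext => i; rewrite key revK.
move=> g [js ->] <-; exists (word_sigma C D Ct (rev js)); first by exists (rev js).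
by apply/funext => i; rewrite -key.
Qed.

End GivenCoordinates.

Lemma coordinates_exist : exists L : 'M[R]_(4, m), lorentz_coordinates C L /\
  forall s, Omega C D Ct s -> 0 < tcoord L s.
Proof.
have tu := tfut_csum vF conf; have [_ uu] := (iffLR (tfutP _)) tu.
pose k := (Num.sqrt (- lform (csum C) (csum C)))^-1.
have k0 : 0 < k by rewrite invr_gt0 sqrtr_gt0 oppr_gt0.
have [h hE] : exists h, h = k *: csum C by exists (k *: csum C).
have hh : lform h h = -1.
  rewrite hE lformZl lformZr mulrA -expr2 exprVn sqr_sqrtr ?oppr_ge0 1?ltW //.
  by field; rewrite lt_eqF.
have th : tfut h by rewrite hE; exact: tfutZ.
have uu1 : lform u0 u0 = -1 :> R by rewrite lform_u0 !mxE /=; lra.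
have hu : lform h u0 <= 0 by apply: lform_fut_le0; [exact: tfutW|exact/tfutW/tfut_u0].
have [w wE] : exists w, w = h + u0 by exists (h + u0).
have ww : lform w w = 2 * (lform h u0 - 1).
  by rewrite wE !lformDl !lformDr hh uu1 (lformC u0 h); ring.
have wn : lform w w != 0 by rewrite ww lt_eqF //; lra.
have hw : 2 * lform h w = lform w w by rewrite ww wE lformDr hh; ring.
pose T : 'M[R]_4 := (2 / lform w w) *: (w *m (w^T *m qform R)) - 1%:M.
have TE x : T *m x = (2 * lform x w / lform w w) *: w - x.
  rewrite mulmxBl mul1mx -scalemxAl -mulmxA [w^T *m _ *m x]mx11_scalar -/(lform w x).
  by rewrite mul_mx_scalar scalerA lformC mulrAC.
have TT x y : lform (T *m x) (T *m y) = lform x y.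
  by rewrite !TE !(lformDl, lformDr, lformNl, lformNr, lformZl, lformZr) (lformC w y); field.
have Th : T *m h = u0.
  by rewrite TE hw mulfV // scale1r wE addrC addKr.
exists (std_frame *m T *m C); split.
  rewrite /lorentz_coordinates !trmx_mul.
  transitivity (C^T *m (T^T *m (std_frame^T *m lorentz_form R *m std_frame) *m T) *m C).
    by rewrite !mulmxA.
  by rewrite std_frame_form (lform_preserving TT).
move=> s /Omega_orbit [js [i ->]]; rewrite tcoordE C_Omega //.
have gA : word_group D (word_mx D (rev js)) by exists (rev js).
have := csum_orbit_lt0 vF conf i gA; rewrite -(pmulr_rlt0 _ k0) -lformZl -hE.
rewrite -TT Th lformC lform_u0 /time; lra.
Qed.

End Main.

Theorem theorem4p5 (R : realType) (m n : nat)
    (v : 'I_m -> 'cV[R]_3) (F : 'I_n -> {set 'I_m})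
    (C : 'M[R]_(4, m)) (D : 'M[R]_(4, n)) (Ct : 'M[R]_(m, 4)) :
  convex_polyhedron v F ->
  polyhedral_configuration v F C D ->
  bounded_packing C D ->
  C *m Ct = 1%:M ->
  (exists L : 'M[R]_(4, m), lorentz_coordinates C L /\
     forall s, Omega C D Ct s -> 0 < tcoord L s) /\
  forall L : 'M[R]_(4, m), lorentz_coordinates C L ->
    (forall s, Omega C D Ct s -> 0 < tcoord L s) ->
    abs_conv_domain C D =
      [set s | 0 < tcoord L s /\
         (timelike_ball `|`
          \bigcup_(a in Omega C D Ct) solid_cone (chart L a)) (chart L s)] /\
    packing_on_N v F
      [set (fun i => base_circle (chart L (w^T *m omega i)))
        | w in Wrefl C D Ct].
Proof.
move=> vF conf bdd CCt; split; first exact: (coordinates_exist vF conf CCt).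
move=> L /(lorentz_coordinatesP CCt) [T TT ->] posL; split.
  exact: (domain_eq vF conf CCt TT posL bdd).
exact: (packing_eq vF conf CCt TT posL).
Qed.
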